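(* Let $f$ be a mixing piecewise expanding $C^3$ unimodal map. Let $X\in C^2(f(I))$ satisfy $X(a)=0$, $\mathcal J(f,X)=0$ and, in addition, $$\sum_{j=1}^\infty\frac{j\,X(f^j(c_1))}{(f^j)'(c_1)}=0 .$$ Then for every $\varphi\in C^1([a,b])$, $$\Psi_1=\lim_{z\in(0,1),\,z\to1}\Psi(z),$$ where, for $|z|<1$, $$\Psi(z)=\sum_{n=0}^\infty\int z^n\,X(y)\,\rho_0(y)\,(\varphi\circ f^n)'(y)\,dy$$ and $$\Psi_1=-\sum_{j=1}^{M_f}\varphi(c_j)\sum_{k=1}^{j}\frac{s_1X(c_k)}{(f^{k-1})'(c_1)}-\int(\mathrm{id}-\mathcal L_1)^{-1}\bigl(X'\rho_{sal}+(X\rho_{reg})'\bigr)\varphi\,dx .$$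
   Context: Fix $I=[a,b]$, $a<c<b$, $I_+=[a,c]$, $I_-=[c,b]$. For $r\ge1$, a piecewise expanding $C^r$ unimodal map is a continuous $f:I\to I$, strictly increasing on $I_+$, strictly decreasing on $I_-$, with $f(a)=f(b)=a$, such that for $\sigma=\pm$ the map $f|_{I_\sigma}$ extends to a $C^r$ map on a neighbourhood of $I_\sigma$ and $\inf|f'|_{I_\sigma}|>1$. The point $c$ is called the critical point; put $c_k=f^k(c)$. $f$ is mixing if it is topologically mixing on $[f^2(c),f(c)]$. $(f^j)'(x)=\prod_{i<j}f'(f^i(x))$. If $c$ is periodic with minimal period $n_1\ge2$, set $M_f=N_f=n_1$. If $c$ is not periodic, set $M_f=\infty$; in that case, if some iterate of $c$ is periodic, let $n_0$ be minimal with $c_{n_0}$ periodic, $n_1$ the minimal period of $c_{n_0}$, and set $N_f=n_0+n_1-1$, while if the orbit of $c$ is infinite, set $N_f=\infty$. If $c$ is periodic, $f$ is not differentiable at $c_{n_1}=c$, so $(f^j)'(c_1)$ is defined only for $j\le n_1-1$; the sum over $j\ge1$ in the hypothesis is then understood as the sum over $1\le j\le M_f-1$. $\rho_0$ denotes the density (extended by $0$ to $\mathbb R$) of the unique absolutely continuous $f$-invariant probability measure; it has bounded variation. Let $H_u(x)=-1$ for $x<u$, $0$ for $x>u$, $H_u(u)=-1/2$. Then $\rho_0=\rho_{sal}+\rho_{reg}$ with $\rho_{reg}$ continuous and $\rho_{sal}=\sum_{n=1}^{N_f}s_nH_{c_n}$, $s_n=\lim_{y\downarrow c_n}\rho_0(y)-\lim_{x\uparrow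 c_n}\rho_0(x)$. It is known that $\rho_{reg}'$ has bounded variation. $\mathcal J(f,X)=\sum_{n=1}^{N_f}s_nX(c_n)$. Note $f(I)=[a,c_1]$; $X$ and $X'$ are set to be $0$ outside $[a,c_1]$ in all products. $\mathcal L_1$ is the Perron–Frobenius operator $\mathcal L_1\varphi(x)=\sum_{f(y)=x}\varphi(y)/|f'(y)|$ acting on functions of bounded variation supported in $[a,b]$ (modulo countable sets). Since $f$ is mixing, $\mathcal L_1$ has simple eigenvalue $1$ (eigenvector $\rho_0$, dual eigenvector Lebesgue measure) and the rest of its spectrum lies in a disc of radius $<1$, so on functions $g$ of bounded variation with $\int g\,dx=0$ one puts $(\mathrm{id}-\mathcal L_1)^{-1}g=\sum_{j\ge0}\mathcal L_1^jg$. When $\mathcal J(f,X)=0$, $X'\rho_{sal}+(X\rho_{reg})'$ is such a $g$, and it is known that $\Psi_1$ is then a well-defined number and that $\Psi(z)$ is holomorphic in the open unit disc, where it equals $$\Psi(z)=-\sum_{j=1}^{\infty}\varphi(c_j)\sum_{k=1}^{\min(j,M_f)}z^{j-k}\frac{s_1X(c_k)}{(f^{k-1})'(c_1)}-\int(\mathrm{id}-z\mathcal L_1)^{-1}\bigl(X'\rho_{sal}+(X\rho_{reg})'\bigr)\varphi\,dx .$$ *)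

(* Defs.v *)
From HB Require Import structures.
From mathcomp Require Export all_boot all_order all_algebra.
From mathcomp Require Export all_classical all_reals all_analysis.
Export Order.TTheory GRing.Theory Num.Theory.
Export numFieldNormedType.Exports.

Set Implicit Arguments.
Unset Strict Implicit.
Unset Printing Implicit Defensive.

Local Open Scope classical_set_scope.
Local Open Scope ring_scope.

Section calculus.
Context {R : realType}.
Implicit Types (A : set R) (f g : R -> R).

(* Difference quotient and derivative of the restriction of [f] to [A]: at an
   endpoint of an interval this is the one-sided derivative, so that only the
   values of [f] on [A] matter; on an open set it is the usual derivative. *)
Definition quot_in A f (x : R) : set_system R :=
  (f y - f x) / (y - x) @[y --> within A x^'].

Definition deriv_in A f (x : R) : R := lim (quot_in A f x).

Fixpoint Ck_on (k : nat) A f : Prop :=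
  if k is k'.+1 then
    (forall x, A x -> cvg (quot_in A f x)) /\ Ck_on k' A (deriv_in A f)
  else {within A, continuous f}.

Definition Ck_extends (k : nat) A f : Prop :=
  exists U : set R, exists g : R -> R,
    [/\ open U, A `<=` U, forall x, A x -> g x = f x & Ck_on k U g].

(* [None] stands for an infinite upper bound; the sum starts at 1. *)
Definition sum_upto (N : option nat) (F : nat -> R) : R :=
  if N is Some n then \sum_(1 <= j < n.+1) F j
  else limn (fun n => \sum_(1 <= j < n) F j).

End calculus.

Section dynamics.
Context {R : realType}.
Implicit Types (f : R -> R) (a b c x : R).

Definition unimodal_expanding (r : nat) a c b f : Prop :=
  [/\ a < c < b,
      {within `[a, b], continuous f} /\ {homo f : x / x \in `[a, b]},
      (forall x y, x \in `[a, c] -> y \in `[a, c] -> x < y -> f x < f y) /\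
      (forall x y, x \in `[c, b] -> y \in `[c, b] -> x < y -> f y < f x),
      f a = a /\ f b = a
    & forall A : set R, A = `[a, c]%classic \/ A = `[c, b]%classic ->
        Ck_extends r A f /\ 1 < inf [set `|deriv_in A f x| | x in A]].

Definition topologically_mixing_on (K : set R) f : Prop :=
  forall U V : set R, open U -> open V ->
    U `&` K !=set0 -> V `&` K !=set0 ->
    \forall n \near \oo, (iter n f @` (U `&` K)) `&` (V `&` K) !=set0.

Definition mixing c f : Prop := topologically_mixing_on `[f (f c), f c] f.

Definition is_periodic f x : Prop := exists n, (0 < n)%N /\ iter n f x = x.

Definition least (P : set nat) : nat :=
  xget 0%N [set n | P n /\ forall m, P m -> (n <= m)%N].

Definition min_period f x : nat :=
  least [set n | (0 < n)%N /\ iter n f x = x].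

Definition preperiod f x : nat := least [set n | is_periodic f (iter n f x)].

Definition Mf f c : option nat :=
  if `[< is_periodic f c >] then Some (min_period f c) else None.

Definition Nf f c : option nat :=
  if `[< is_periodic f c >] then Some (min_period f c)
  else if `[< exists n, is_periodic f (iter n f c) >] then
    Some (preperiod f c + min_period f (iter (preperiod f c) f c) - 1)%N
  else None.

(* (f^j)'(x), by the chain rule along the orbit of [x]. *)
Definition deriv_iter a b f (j : nat) x : R :=
  \prod_(i < j) deriv_in `[a, b] f (iter i f x).

Definition acip a b f (m : probability (measurableTypeR R) R) : Prop :=
  [/\ m `<< lebesgue_measure,
      m `[a, b]%classic = 1%E
    & forall A : set R, measurable A -> m (`[a, b] `&` f @^-1` A) = m A].

(* A bounded variation version of the density, extended by 0. *)
Definition acip_density a b f (rho : R -> R) : Prop :=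
  [/\ bounded_variation a b rho,
      forall x, 0 <= rho x,
      forall x, x \notin `[a, b] -> rho x = 0
    & exists2 m : probability (measurableTypeR R) R, acip a b f m &
        forall A : set R, measurable A ->
          m A = (\int[lebesgue_measure]_(x in A) (rho x)%:E)%E].

End dynamics.

Section susceptibility.
Context {R : realType}.
Variables (a c b : R) (f : R -> R).
Implicit Types (rho X phi g : R -> R).

Definition crit (k : nat) : R := iter k f c.

Definition step_fun (u x : R) : R :=
  if x < u then -1 else if x == u then - 2^-1 else 0.

Definition jump rho (n : nat) : R :=
  lim (rho y @[y --> (crit n)^'+]) - lim (rho y @[y --> (crit n)^'-]).

Definition rho_sal rho (x : R) : R :=
  sum_upto (Nf f c) (fun n => jump rho n * step_fun (crit n) x).

(* The decomposition holds modulo a countable set, since the values of [rho] at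
   its jumps are not normalized. *)
Definition regular_part rho (rho_reg : R -> R) : Prop :=
  continuous rho_reg /\
  countable [set x | rho x <> rho_sal rho x + rho_reg x].

Definition Jfun rho X : R :=
  sum_upto (Nf f c) (fun n => jump rho n * X (crit n)).

(* The derivative of [f] does not exist at [c], which affects the value of
   [transfer g] at the single point [crit 1] only. *)
Definition transfer g (x : R) : R :=
  \sum_(y \in [set y | y \in `[a, b] /\ f y = x])
    (g y / `|deriv_in `[a, b] f y|).

(* [(id - transfer)^-1 g] as the Neumann series, for [g] of zero integral; it
   converges outside of a null set and is only used under an integral. *)
Definition resolvent1 g (x : R) : R :=
  limn (series (fun j => iter j transfer g x)).

(* [`[a, crit 1]] is the image of [f]; [X] and its derivative are extended by 0
   outside of it. *)
Definition source rho (rho_reg : R -> R) X (x : R) : R :=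
  (deriv_in `[a, crit 1] X \_ `[a, crit 1]) x * rho_sal rho x +
  derive1 (fun y => (X \_ `[a, crit 1]) y * rho_reg y) x.

Definition Psi rho X phi (z : R) : R :=
  limn (series (fun n =>
    \int[lebesgue_measure]_(y in `[a, b])
      (z ^+ n * (X \_ `[a, crit 1]) y * rho y * derive1 (phi \o iter n f) y))).

Definition Psi1 rho (rho_reg : R -> R) X phi : R :=
  - sum_upto (Mf f c) (fun j => phi (crit j) *
      \sum_(1 <= k < j.+1)
        jump rho 1 * X (crit k) / deriv_iter a b f k.-1 (crit 1))
  - \int[lebesgue_measure]_(x in `[a, b])
      (resolvent1 (source rho rho_reg X) x * phi x).

End susceptibility.

(* Main.v *)
(* Write [orb i] for [f^i(c_1)] and [sg i] for the jump [s_1 / (f^i)'(c_1)] carried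
   to [orb i]. The invariance of [rho0] and a contraction of the variation show
   that [rho0] minus the steps [sg i] at [orb i] is, almost everywhere, the
   primitive of an integrable [H]; hence the steps give [rho_sal], and [rho_reg]
   is absolutely continuous. Integrating by parts, the coefficient of [z^n] in
   [Psi] is [- sum_i tau i * phi (orb (n + i)) - beta n], where
   [tau i = sg i * X (orb i)] decays exponentially and [beta n] is the integral
   of [g * (phi o f^n)] for [g = X' rho0 + X H], which is the source of
   [rho_sal] and [rho_reg]. The hypothesis on [J] says that [tau] has zero sum,
   so [g] has zero mean and [beta] decays by the spectral gap (a Lasota-Yorke
   inequality and Doeblin coupling, with mixing providing the covering). The
   additional hypothesis says that the sequence of tails of [tau] also has zero
   sum; so the coefficients are second differences of a bounded sequence, and
   two Abel summations give the limit as [z -> 1]. *)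

(* Estimates of variation are made in dual form, on functionals of bounded measurable test
   functions, where transfer becomes composition of the test function with [f]. Variation is then
   measured by test functions with small primitive, so no norm modulo null sets is needed, and
   [rho0], whose values on a null set are arbitrary, fits in. Pointwise identities for [rho0] hold
   off a single null set [N] that contains the orbit of [f c] and is mapped into itself by [f], so
   that its complement is closed under preimages.

   Two Abel summations are needed because [phi] is evaluated along the critical orbit, which need
   not converge. When [tau] has zero sum, a coefficient is a first difference g n - g (n + 1), whose
   Abel sum is g 0 - (1 - z) * sum z^n g (n + 1). The last term has no reason to vanish for a merely
   bounded g. It does vanish once g is itself the difference of a bounded sequence, and this is what
   the additional hypothesis provides. *)
From HB Require Import structures.
Require Import Defs.
From mathcomp Require Import measurable_realfun ring lra zify.

Set Implicit Arguments.
Unset Strict Implicit.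
Unset Printing Implicit Defensive.

Local Open Scope classical_set_scope.
Local Open Scope ring_scope.

(** * Primitives of integrable functions *)

Section intervals.
Context {R : realType}.
Notation mu := (@lebesgue_measure R).
Implicit Types (x y z k K L : R) (q p Q P : R -> R).

Definition intg x y q := mu.-integrable `[x, y] (EFin \o q).

Definition Int x y q : R := \int[mu]_(t in `[x, y]) q t.

Definition bmeas x y q := measurable_fun `[x, y] q /\
  exists K, forall t, x <= t <= y -> `|q t| <= K.

Lemma eq_Int x y p q :
  (forall t, x <= t <= y -> p t = q t) -> Int x y p = Int x y q.
Proof. by move=> h; apply: eq_Rintegral => t; rewrite inE /= in_itv /= => /h. Qed.

Lemma eq_intg x y p q :
  (forall t, x <= t <= y -> p t = q t) -> intg x y p -> intg x y q.
Proof.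
move=> h; apply: eq_integrable => // t; rewrite inE /= in_itv /= => /h ht.
by rewrite /= ht.
Qed.

Lemma intgS x y x' y' q : x <= x' -> y' <= y -> intg x y q -> intg x' y' q.
Proof.
move=> xx yy; apply: integrableS => //.
move=> t /=; rewrite !in_itv /= => /andP[h1 h2].
by rewrite (le_trans xx h1) (le_trans h2 yy).
Qed.

Lemma measS x y x' y' q : x <= x' -> y' <= y ->
  measurable_fun `[x, y] q -> measurable_fun `[x', y'] q.
Proof.
move=> xx yy; apply: measurable_funS => //.
move=> t /=; rewrite !in_itv /= => /andP[h1 h2].
by rewrite (le_trans xx h1) (le_trans h2 yy).
Qed.

Lemma bmeasS x y x' y' q : x <= x' -> y' <= y -> bmeas x y q -> bmeas x' y' q.
Proof.
move=> xx yy [m [K hK]]; split; first exact: measS m.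
exists K => t /andP[h1 h2]; apply: hK.
by rewrite (le_trans xx h1) (le_trans h2 yy).
Qed.

Lemma intg_meas x y q : intg x y q -> measurable_fun `[x, y] q.
Proof. by move=> /integrableP[/measurable_EFinP]. Qed.

Lemma bmeas_intg x y q : bmeas x y q -> intg x y q.
Proof.
move=> [m [K hK]]; apply: measurable_bounded_integrable => //.
  rewrite /= lebesgue_measure_itv /=; case: ifP => // _.
  by rewrite -EFinB ltry.
exists K; split; first exact: num_real.
move=> M KM t /=; rewrite in_itv /= => /hK h.
exact: le_trans h (ltW KM).
Qed.

Lemma intgD x y p q : intg x y p -> intg x y q -> intg x y (fun t => p t + q t).
Proof. by move=> ip iq; exact: (integrableD _ ip iq). Qed.

Lemma intgZ x y k q : intg x y q -> intg x y (fun t => k * q t).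
Proof. by move=> iq; exact: (integrableZl _ k iq). Qed.

Lemma intgN x y q : intg x y q -> intg x y (fun t => - q t).
Proof. by move=> iq; exact: (integrableN iq). Qed.

Lemma intgB x y p q : intg x y p -> intg x y q -> intg x y (fun t => p t - q t).
Proof. by move=> ip iq; exact: (integrableB _ ip iq). Qed.

Lemma intg_norm x y q : intg x y q -> intg x y (fun t => `|q t|).
Proof. by move=> iq; exact: (integrable_norm iq). Qed.

Lemma intgM x y p q : bmeas x y p -> intg x y q -> intg x y (fun t => p t * q t).
Proof.
move=> [m [K hK]] iq.
suff bp : [bounded p t | t in `[x, y]%classic] by apply: (@integrableMr _ _ R mu `[x, y]%classic _ p (EFin \o q) m bp iq).
exists K; split; first exact: num_real.
move=> M KM t /=; rewrite in_itv /= => /hK h.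
exact: le_trans h (ltW KM).
Qed.

Lemma le_intg x y p q : measurable_fun `[x, y] p ->
  (forall t, x <= t <= y -> `|p t| <= `|q t|) -> intg x y q -> intg x y p.
Proof.
move=> mp h; apply: le_integrable => //; exact/measurable_EFinP.
Qed.

Lemma IntD x y p q : intg x y p -> intg x y q ->
  Int x y (fun t => p t + q t) = Int x y p + Int x y q.
Proof. by move=> ip iq; rewrite /Int RintegralD. Qed.

Lemma IntB x y p q : intg x y p -> intg x y q ->
  Int x y (fun t => p t - q t) = Int x y p - Int x y q.
Proof. by move=> ip iq; rewrite /Int RintegralB. Qed.

Lemma IntZ x y k q : intg x y q -> Int x y (fun t => k * q t) = k * Int x y q.
Proof. by move=> iq; rewrite /Int RintegralZl. Qed.

Lemma IntN x y q : intg x y q -> Int x y (fun t => - q t) = - Int x y q.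
Proof.
move=> iq; rewrite -[RHS]mulN1r -IntZ //.
by apply: eq_Int => t _; rewrite mulN1r.
Qed.

Lemma Int_cst x y k : x <= y -> Int x y (fun=> k) = k * (y - x).
Proof.
move=> xy; rewrite /Int Rintegral_cst//= lebesgue_measure_itv /= lte_fin.
case: ltP => // yx; have -> : x = y by apply/eqP; rewrite eq_le xy yx.
by rewrite subrr mulr0.
Qed.

Lemma le_Int x y p q : intg x y p -> intg x y q ->
  (forall t, x <= t <= y -> p t <= q t) -> Int x y p <= Int x y q.
Proof.
by move=> ip iq h; apply: le_Rintegral => // t /=; rewrite in_itv /= => /h.
Qed.

Lemma Int_ge0 x y q : (forall t, x <= t <= y -> 0 <= q t) -> 0 <= Int x y q.
Proof. by move=> h; apply: Rintegral_ge0 => t /=; rewrite in_itv /= => /h. Qed.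

Lemma norm_Int x y q : intg x y q -> `|Int x y q| <= Int x y (fun t => `|q t|).
Proof. by move=> iq; apply: le_normr_Rintegral. Qed.

Lemma bmeas_cst x y k : bmeas x y (fun=> k).
Proof. by split=> //; exists `|k|. Qed.

Lemma intg_cst x y k : intg x y (fun=> k).
Proof. exact/bmeas_intg/bmeas_cst. Qed.

Lemma Int_bound x y q K : x <= y -> intg x y q ->
  (forall t, x <= t <= y -> `|q t| <= K) -> `|Int x y q| <= K * (y - x).
Proof.
move=> xy iq h; have := norm_Int iq; move/le_trans; apply.
rewrite -Int_cst //; apply: le_Int => //; first exact: intg_norm.
exact: intg_cst.
Qed.

Lemma Intxx x q : Int x x q = 0.
Proof. by rewrite /Int set_itv1 Rintegral_set1. Qed.

Lemma Int_cat y x z q : x <= y -> y <= z -> intg x z q ->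
  Int x z q = Int x y q + Int y z q.
Proof.
move=> xy yz iq; have := @Rintegral_itvB R q (BLeft x) (BRight z) y iq.
rewrite !bnd_simp => /(_ xy yz); rewrite Rintegral_itv_obnd_cbnd.
  by move=> h; rewrite /Int -h addrC subrK.
apply: integrableS iq => //= t /=; rewrite !in_itv /= => /andP[h1 ->].
by rewrite (le_trans xy (ltW h1)).
Qed.

Lemma intg_cat y x z q : x <= y -> y <= z -> intg x y q -> intg y z q ->
  intg x z q.
Proof.
move=> xy yz i1 i2.
have e : `[x, z]%classic = `[x, y] `|` `]y, z] :> set R.
  apply/seteqP; split => t /=; rewrite !in_itv /=.
    by case/andP=> -> ->; case: (leP t y) => h; [left|right].
  case=> /andP[h1 h2]; first by rewrite h1 (le_trans h2 yz).
  by rewrite h2 (le_trans xy (ltW h1)).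
have i3 : mu.-integrable `]y, z] (EFin \o q).
  apply: integrableS i2 => //= t /=; rewrite !in_itv /= => /andP[h1 ->].
  by rewrite (ltW h1).
move/integrableP : i1 => [m1 f1]; move/integrableP : i3 => [m2 f2].
apply/integrableP; rewrite e; split; first by apply/measurable_funU.
rewrite ge0_integral_setU//.
- exact: lte_add_pinfty.
- by apply/measurable_funU => //; split; exact: measurableT_comp.
- apply/disj_setPS => t /= []; rewrite !in_itv /= => /andP[_ h1] /andP[h2 _].
  by move: h2; rewrite ltNge h1.
Qed.

Lemma bmeasD x y p q : bmeas x y p -> bmeas x y q -> bmeas x y (fun t => p t + q t).
Proof.
move=> [mp [K hK]] [mq [L hL]]; split; first exact: measurable_funD.
exists (K + L) => t ht; apply: le_trans (ler_normD _ _) _.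
by apply: lerD; [exact: hK|exact: hL].
Qed.

Lemma bmeasN x y p : bmeas x y p -> bmeas x y (fun t => - p t).
Proof.
move=> [mp [K hK]]; split; first exact: measurableT_comp.
by exists K => t ht; rewrite normrN hK.
Qed.

Lemma bmeasM x y p q : bmeas x y p -> bmeas x y q -> bmeas x y (fun t => p t * q t).
Proof.
move=> [mp [K hK]] [mq [L hL]]; split; first exact: measurable_funM.
exists (K * L) => t ht; rewrite normrM.
by apply: ler_pM => //; [exact: hK|exact: hL].
Qed.

Lemma bmeasB x y p q : bmeas x y p -> bmeas x y q -> bmeas x y (fun t => p t - q t).
Proof. by move=> bp bq; apply: bmeasD => //; exact: bmeasN. Qed.

Lemma bmeasZ x y k q : bmeas x y q -> bmeas x y (fun t => k * q t).
Proof. by move=> bq; apply: bmeasM => //; exact: bmeas_cst. Qed.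

Lemma eq_bmeas x y p q :
  (forall t, x <= t <= y -> p t = q t) -> bmeas x y p -> bmeas x y q.
Proof.
move=> h [m [K hK]]; split.
  by apply: eq_measurable_fun m => t; rewrite inE /= in_itv /= => /h.
by exists K => t ht; rewrite -h ?hK.
Qed.

Lemma bmeas_if x y z p q : bmeas x y p -> bmeas x y q ->
  bmeas x y (fun t => if t <= z then p t else q t).
Proof.
move=> [mp [K hK]] [mq [L hL]]; split.
  apply: measurable_fun_if => //.
  + apply: measurable_fun_ler => //.
  + by apply: measurable_funS mp => // t [].
  + by apply: measurable_funS mq => // t [].
exists (`|K| + `|L|) => t ht; case: ifP => _.
  by apply: le_trans (hK _ ht) _; apply: le_trans (ler_norm _) _; rewrite lerDl.
by apply: le_trans (hL _ ht) _; apply: le_trans (ler_norm _) _; rewrite lerDr.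
Qed.

Import HBNNSimple.

(** The integral of a nonnegative function is a supremum over simple functions below it. Cutting
    such a simple function off on [A] keeps its integral and puts it below [v], so neither [u] nor
    [v] has to be measurable. This matters later for [derive1] and [resolvent1]. *)
Lemma le_integral_off_null (A : set R) (u v : R -> \bar R) : measurable A ->
  mu A = 0%E -> (forall t, ~ A t -> u t = v t) ->
  (forall t, (0 <= u t)%E) -> (forall t, (0 <= v t)%E) ->
  (\int[mu]_t u t <= \int[mu]_t v t)%E.
Proof.
move=> mA A0 uv u0 v0; rewrite !ge0_integralTE //.
apply: ub_ereal_sup => _ [h hu <-].
pose hh := proj_nnsfun h (measurableC mA).
apply: le_trans (ereal_sup_ubound _); last first.
  exists hh => //.
  move=> t /=; rewrite mindicE; case: (boolP (t \in ~` A)) => /=.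
    by rewrite inE /= => /uv <-; rewrite mulr1 hu.
  by move=> _; rewrite mulr0 v0.
rewrite -!integralT_nnsfun.
have -> : (\int[mu]_t (hh t)%:E = \int[mu]_(t in ~` A) (h t)%:E)%E.
  rewrite [RHS]integral_mkcond; apply: eq_integral => t _ /=.
  rewrite mindicE /patch; case: ifP => _ /=; first by rewrite mulr1.
  by rewrite mulr0.
have := @ge0_negligible_integral _ _ _ mu setT A (EFin \o h).
rewrite setTD => -> //; last by move=> t _ /=; rewrite lee_fin.
by apply/measurable_EFinP; exact: measurable_funP.
Qed.

Lemma integral_off_null (A : set R) (u v : R -> \bar R) : measurable A ->
  mu A = 0%E -> (forall t, ~ A t -> u t = v t) ->
  (\int[mu]_t u t = \int[mu]_t v t)%E.
Proof.
move=> mA A0 uv; rewrite integralE [RHS]integralE.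
congr (_ - _)%E; apply/eqP; rewrite eq_le; apply/andP; split;
  apply: (le_integral_off_null mA A0) => // t; try (move=> /uv h); by rewrite ?funeposE ?funenegE ?h.
Qed.

Lemma Rint_ae (D : set R) (N : set R) (f g : R -> R) : measurable D ->
  mu.-negligible N -> (forall t, D t -> ~ N t -> f t = g t) ->
  \int[mu]_(t in D) f t = \int[mu]_(t in D) g t.
Proof.
move=> mD [A [mA A0 NA]] fg; rewrite /Rintegral; congr fine.
rewrite integral_mkcond [RHS]integral_mkcond.
apply: (integral_off_null mA A0) => t At.
rewrite /patch; case: ifP => // /set_mem Dt /=.
by rewrite fg // => /NA.
Qed.

Lemma Int_ae x y (N : set R) f g : mu.-negligible N ->
  (forall t, x <= t <= y -> ~ N t -> f t = g t) -> Int x y f = Int x y g.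
Proof.
by move=> hN h; apply: Rint_ae hN _ => // t /=; rewrite in_itv /= => /h.
Qed.

Lemma prim_local_cst x y q t e : intg x y q -> x <= t <= y -> 0 < e ->
  exists2 d, 0 < d & forall s, x <= s <= y -> `|s - t| < d ->
     `|Int x s q - Int x t q| <= e.
Proof.
move=> iq txy e0.
have xy : x <= y by case/andP: txy; exact: le_trans.
have /subspace_continuousP /(_ t) := parameterized_integral_continuous xy iq.
rewrite /= in_itv /= => /(_ txy) /cvgrPdist_le /(_ _ e0).
rewrite near_withinE => /nbhs_ballP[d /= d0 h].
exists d => // s sxy sd; rewrite distrC.
by apply: (h s) => //=; rewrite ?in_itv // /ball /= distrC.
Qed.

(** Continuous induction, by the supremum of the points reachable from [x]. It replaces
    differentiation almost everywhere: an inequality between additive interval functions needs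
    checking only on short intervals around each point. *)
Lemma Cousin (P : R -> R -> Prop) x y : x <= y ->
  (forall s t u, s <= t -> t <= u -> P s t -> P t u -> P s u) ->
  (forall t, x <= t <= y -> exists2 e, 0 < e & forall s u, x <= s -> u <= y ->
     t - e < s -> s <= t -> t <= u -> u < t + e -> P s u) ->
  P x y.
Proof.
move=> xy tr loc.
pose S := [set s | x <= s <= y /\ P x s].
have Sx : S x.
  have [|e e0 h] := loc x; first by rewrite lexx.
  by split; rewrite ?lexx//; apply: h; rewrite ?lexx// ?ltrBlDr ?ltrDl.
have hS : has_sup S.
  by split; [exists x|exists y => s [/andP[]]].
have xs : x <= sup S by exact: ub_le_sup hS.2 _ Sx.
have sy : sup S <= y by apply: ge_sup => [|s [/andP[]]//]; exists x.
have [|e e0 h] := loc (sup S); first by rewrite xs sy.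
have [s Ss hs] := sup_adherent e0 hS.
have ss : s <= sup S by exact: ub_le_sup hS.2 _ Ss.
have Pxs : P x (sup S).
  case: Ss => /andP[s1 s2] Ps; apply: tr Ps _ => //.
  by apply: h; rewrite ?lexx// ltrDl.
pose u := Num.min y (sup S + e / 2).
have su : sup S <= u by rewrite le_min sy lerDl ltW// divr_gt0.
have uy : u <= y by rewrite ge_min lexx.
have Pu : P x u.
  apply: (tr _ _ _ xs su Pxs); apply: h => //.
    by rewrite ltrBlDr ltrDl.
  rewrite gt_min; apply/orP; right; rewrite ltrD2l ltr_pdivrMr// mulr_natr.
  by rewrite mulr2n ltrDl.
have Su : S u by split => //; rewrite uy (le_trans xs su).
have us : u <= sup S by exact: ub_le_sup hS.2 _ Su.
move: Pu us; rewrite /u; case: (leP y (sup S + e / 2)) => // _ _.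
by rewrite gerDl leNgt divr_gt0.
Qed.

Lemma Int_oo x y p q : (forall t, x < t < y -> p t = q t) -> Int x y p = Int x y q.
Proof.
move=> h; apply: (@Int_ae _ _ ([set x] `|` [set y])).
  by apply: negligibleU; [exists [set x]|exists [set y]]; split => //;
    exact: lebesgue_measure_set1.
move=> t /andP[xt ty] /not_orP[/eqP tx /eqP ty']; apply: h.
by rewrite !lt_neqAle xt ty eq_sym tx ty'.
Qed.

Lemma intg_oo x y p q : (forall t, x < t < y -> p t = q t) ->
  intg x y p -> intg x y q.
Proof.
move=> h ip.
apply: (@eq_intg _ _ (fun t => if t == x then q x else if t == y then q y else p t)).
  move=> t /andP[xt ty]; case: eqP => [->//|/eqP tx]; case: eqP => [->//|/eqP ty'].
  by apply: h; rewrite !lt_neqAle xt ty eq_sym tx ty'.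
pose b t := `|p t| + (`|q x| + `|q y|).
apply: (@le_intg _ _ _ b).
- apply: measurable_fun_if => //; first exact: measurable_fun_eqr.
  apply: measurable_fun_if => //.
  + have m : measurable_fun `[x, y] (eq_op^~ x) by exact: measurable_fun_eqr.
    exact: m.
  + by apply: measurable_fun_eqr.
  + by apply: measurable_funS (intg_meas ip) => // t [[]].
- move=> t _; rewrite [X in _ <= X]ger0_norm ?addr_ge0// /b.
  case: eqP => _; first by rewrite addrCA lerDl addr_ge0.
  case: eqP => _; first by rewrite addrA lerDr addr_ge0.
  by rewrite lerDl addr_ge0.
- by apply: intgD; [exact: intg_norm|exact: intg_cst].
Qed.

(* [Q] is absolutely continuous on [[x0, y0]], with density [q]. *)
Definition prim x0 y0 Q q := intg x0 y0 q /\
  forall x y, x0 <= x -> x <= y -> y <= y0 -> Q y - Q x = Int x y q.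

Lemma primS x y x' y' Q q : x <= x' -> y' <= y -> prim x y Q q -> prim x' y' Q q.
Proof.
move=> xx yy [iq hq]; split; first exact: intgS iq.
by move=> s t xs st ty; apply: hq => //; [exact: le_trans xs|exact: le_trans yy].
Qed.

Lemma prim_Int x y q : intg x y q -> prim x y (fun t => Int x t q) q.
Proof.
move=> iq; split=> // s t xs st ty.
rewrite (@Int_cat s x t) //; last exact: intgS iq.
by rewrite addrAC subrr add0r.
Qed.

Lemma prim_cont x y Q q t e : prim x y Q q -> x <= t <= y -> 0 < e ->
  exists2 d, 0 < d & forall s, x <= s <= y -> `|s - t| < d -> `|Q s - Q t| <= e.
Proof.
move=> [iq hq] txy e0; have [d d0 h] := prim_local_cst iq txy e0.
exists d => // s sxy sd; have := h _ sxy sd.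
case/andP: sxy => xs sy; case/andP: txy => xt ty.
rewrite -[Q s](subrK (Q x)) hq // -[Q t](subrK (Q x)) hq //.
by rewrite opprD addrACA subrr addr0.
Qed.

Lemma prim_within x y Q q : prim x y Q q -> {within `[x, y], continuous Q}.
Proof.
move=> pq; apply/subspace_continuousP => t; rewrite /= in_itv /= => txy.
apply/cvgrPdist_le => e e0; have [d d0 h] := prim_cont pq txy e0.
rewrite near_withinE; apply/nbhs_ballP; exists d => // s /= ts; rewrite in_itv /= => sxy.
rewrite distrC; apply: h => //; rewrite distrC.
by move: ts; rewrite /ball /=.
Qed.

Lemma within_bmeas x y Q : {within `[x, y], continuous Q} -> bmeas x y Q.
Proof.
move=> cQ; split; first exact: subspace_continuous_measurable_fun.
have := continuous_compact cQ (@segment_compact R x y).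
move=> /compact_bounded[M [_ hM]]; exists (M + 1) => t txy.
by apply: (hM (M + 1)); rewrite ?ltrDl //=; exists t => //=; rewrite in_itv.
Qed.

Lemma prim_bmeas x y Q q : prim x y Q q -> bmeas x y Q.
Proof. by move=> /prim_within /within_bmeas. Qed.

Lemma prim_cst x y k : prim x y (fun=> k) (fun=> 0).
Proof.
split; first exact: intg_cst.
by move=> s t _ st _; rewrite subrr Int_cst// mul0r.
Qed.

Lemma primN x y P p : prim x y P p -> prim x y (fun t => - P t) (fun t => - p t).
Proof.
move=> [ip hp]; split; first exact: intgN.
move=> s t xs st ty; rewrite IntN; last exact: intgS ip.
by rewrite -hp // opprB opprK addrC.
Qed.

Lemma eq_prim x y P p Q q : (forall t, x <= t <= y -> P t = Q t) ->
  (forall t, x <= t <= y -> p t = q t) -> prim x y P p -> prim x y Q q.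
Proof.
move=> PQ pq [ip hp]; split; first exact: eq_intg ip.
move=> s t xs st ty; rewrite -!PQ ?hp ?xs ?(le_trans st) ?(le_trans xs st) //.
apply: eq_Int => u /andP[su ut].
by rewrite pq // (le_trans xs su) (le_trans ut ty).
Qed.

(** Densities may be changed at endpoints, which is what allows pieces with different one-sided
    derivatives to be glued at [c]. *)
Lemma prim_oo x y P p Q q : (forall t, x <= t <= y -> P t = Q t) ->
  (forall t, x < t < y -> p t = q t) -> prim x y P p -> prim x y Q q.
Proof.
move=> PQ pq [ip hp]; split; first exact: intg_oo ip.
move=> s t xs st ty; rewrite -!PQ ?hp ?xs ?(le_trans st) ?(le_trans xs st) //.
apply: Int_oo => u /andP[su ut].
by rewrite pq // (le_lt_trans xs su) (lt_le_trans ut ty).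
Qed.

Lemma prim_cat y x z Q q : x <= y -> y <= z -> prim x y Q q -> prim y z Q q ->
  prim x z Q q.
Proof.
move=> xy yz [i1 h1] [i2 h2]; split; first exact: intg_cat i2.
move=> s t xs st tz; have [ty|yt] := leP t y; first exact: h1.
have [ys|sy] := leP y s; first exact: h2.
rewrite (@Int_cat y) ?(ltW yt) ?(ltW sy) //.
  rewrite -h1 ?(ltW sy) // -h2 ?(ltW yt) //.
  by rewrite [RHS]addrC addrA subrK.
by apply: (@intgS x z) => //; exact: intg_cat i2.
Qed.

(* [|QP(y) - QP(x) - int (qP + Qp)| <= e int (|q| + |p|)] holds on short
   intervals, and both sides are additive. *)
Lemma primM x y P p Q q : prim x y P p -> prim x y Q q ->
  prim x y (fun t => P t * Q t) (fun t => p t * Q t + P t * q t).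
Proof.
move=> pP pQ; have [ip hp] := pP; have [iq hq] := pQ.
have bP := prim_bmeas pP; have bQ := prim_bmeas pQ.
have ipQ : intg x y (fun t => p t * Q t).
  by apply: eq_intg (intgM bQ ip) => t _; rewrite mulrC.
have iPq := intgM bP iq.
split; first exact: intgD.
move=> s t xs st ty.
apply/eqP; rewrite -subr_eq0 -normr_eq0; apply/eqP.
pose M := Int s t (fun u => `|p u| + `|q u|).
suff H e : 0 < e -> `|P t * Q t - P s * Q s - Int s t (fun u => p u * Q u + P u * q u)| <=
   e * M.
  apply/le_anti; rewrite normr_ge0 andbT; apply/ler_addgt0Pr => e e0; rewrite add0r.
  have M0 : 0 <= M by apply: Int_ge0 => u _; rewrite addr_ge0.
  have M1 : 0 < M + 1 by rewrite ltr_wpDl.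
  apply: le_trans (H (e / (M + 1)) _) _; first by rewrite divr_gt0.
  by rewrite mulrAC ler_pdivrMr // ler_pM2l // lerDl.
move=> e0; rewrite /M.
pose E s t := x <= s -> t <= y -> `|P t * Q t - P s * Q s - Int s t (fun u => p u * Q u + P u * q u)| <=
   e * Int s t (fun u => `|p u| + `|q u|).
have iA : intg x y (fun u => p u * Q u + P u * q u) by exact: intgD.
have iM : intg x y (fun u => `|p u| + `|q u|) by apply: intgD; exact: intg_norm.
suff : E s t by apply.
apply: (@Cousin E) => // [s' u' t' su ut Esu Eut xs' ty'|u /andP[su ut]].
  have uy : u' <= y by exact: le_trans ty'.
  have xu : x <= u' by exact: le_trans su.
  rewrite (@Int_cat u' s' t') //; last exact: intgS iA.
  rewrite (@Int_cat u' s' t' (fun u => `|p u| + _)) //; last exact: intgS iM.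
  rewrite mulrDr; apply: le_trans (lerD (Esu xs' uy) (Eut xu ty')).
  apply: le_trans (ler_normD _ _); rewrite le_eqVlt; apply/orP; left; apply/eqP.
  by congr (`| _ |); ring.
have uxy : x <= u <= y by rewrite (le_trans xs su) (le_trans ut ty).
have e2 : 0 < e / 2 by rewrite divr_gt0.
have [d1 d10 h1] := prim_cont pP uxy e2.
have [d2 d20 h2] := prim_cont pQ uxy e2.
exists (Num.min d1 d2); first by rewrite lt_min d10.
move=> s' t' ss' tt' us' s'u ut' t'u xs' t'y.
have s't' : s' <= t' by exact: le_trans ut'.
have near v : s' <= v <= t' -> `|v - u| < Num.min d1 d2.
  move=> /andP[sv vt]; rewrite ltr_norml; apply/andP; split.
    by rewrite ltrBrDl; exact: lt_le_trans sv.
  by rewrite ltrBlDl; exact: le_lt_trans t'u.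
have near1 v w : s' <= v <= t' -> s' <= w <= t' -> `|P v - P w| <= e /\ `|Q v - Q w| <= e.
  move=> hv hw; have hvx : x <= v <= y.
    by case/andP: hv => a b; rewrite (le_trans xs' a) (le_trans b t'y).
  have hwx : x <= w <= y.
    by case/andP: hw => a b; rewrite (le_trans xs' a) (le_trans b t'y).
  have := near _ hv; have := near _ hw; rewrite !lt_min => /andP[a1 a2] /andP[b1 b2].
  split.
    rewrite -(subrKA (P u)) (le_trans (ler_normD _ _)) // [X in _ <= X]splitr lerD ?h1 //.
    by rewrite distrC h1.
  rewrite -(subrKA (Q u)) (le_trans (ler_normD _ _)) // [X in _ <= X]splitr lerD ?h2 //.
  by rewrite distrC h2.
have st1 : s' <= s' <= t' by rewrite lexx.
have st2 : s' <= t' <= t' by rewrite lexx s't'.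
have j1 : intg s' t' p by exact: intgS ip.
have j2 : intg s' t' q by exact: intgS iq.
(* Discrete product rule with the coefficients frozen at the two ends; continuity makes them
   [e]-close to the moving ones. *)
have -> : P t' * Q t' - P s' * Q s' = Int s' t' (fun v => Q s' * p v + P t' * q v).
  rewrite IntD; [|exact: intgZ|exact: intgZ].
  by rewrite !IntZ // -hp // -hq //; ring.
have j3 : intg s' t' (fun v => Q s' * p v + P t' * q v).
  by apply: intgD; exact: intgZ.
have j4 : intg s' t' (fun u => p u * Q u + P u * q u) by exact: intgS iA.
have j5 : intg s' t' (fun u => `|p u| + `|q u|) by exact: intgS iM.
rewrite -IntB // -IntZ //; apply: le_trans (norm_Int _) _; first exact: intgB.
apply: le_Int; [by apply: intg_norm; exact: intgB|exact: intgZ|].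
move=> v hv.
have -> : Q s' * p v + P t' * q v - (p v * Q v + P v * q v) =
  (Q s' - Q v) * p v + (P t' - P v) * q v by ring.
apply: le_trans (ler_normD _ _) _; rewrite !normrM mulrDr lerD // ler_wpM2r //.
  by have [] := near1 _ _ st1 hv.
by have [] := near1 _ _ st2 hv.
Qed.

End intervals.

(** * Substitution by monotone maps *)

Section line.
Context {R : realType}.
Notation mu := (@lebesgue_measure R).
Variables (phi dphi : R -> R).
Hypothesis mphi : measurable_fun setT phi.
Hypothesis mdphi : measurable_fun setT dphi.
Hypothesis dphi0 : forall t, 0 <= dphi t.
Hypothesis phi_itv : forall u v, u < v ->
  (\int[mu]_(t in phi @^-1` `]u, v]) (dphi t)%:E = (v - u)%:E)%E.

Let nu (A : set (measurableTypeR R)) : \bar R :=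
  (\int[mu]_(t in phi @^-1` A) (dphi t)%:E)%E.

Let mpre (A : set R) : measurable A -> measurable (phi @^-1` A).
Proof. by move=> mA; rewrite -[X in measurable X]setTI; exact: mphi. Qed.

Let nu0 : nu set0 = 0%E.
Proof. by rewrite /nu preimage_set0 integral_set0. Qed.

Let nu_ge0 A : (0 <= nu A)%E.
Proof. by apply: integral_ge0 => t _; rewrite lee_fin. Qed.

Let nu_sigma : semi_sigma_additive nu.
Proof.
move=> F mF tF mUF; rewrite /nu preimage_bigcup.
rewrite (@ge0_integral_bigcup _ _ R mu (fun k => phi @^-1` F k)) //.
- by apply: is_cvg_nneseries => n _ _; exact: nu_ge0.
- by move=> k; apply: mpre; exact: mF.
- apply/measurable_EFinP; apply: measurable_funS mdphi => //.
- by move=> x _; rewrite lee_fin.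
- move/trivIsetP : tF => tF; apply/trivIsetP => i j _ _ ij.
  by rewrite -preimage_setI tF // preimage_set0.
Qed.

HB.instance Definition _ := isMeasure.Build _ _ _ nu nu0 nu_ge0 nu_sigma.

Lemma lebesgue_line A : measurable A -> mu A = nu A.
Proof.
apply: (@lebesgue_measure_unique R nu) => _ [[u v] /= uv <-].
rewrite /= lebesgue_measure_itv /= lte_fin; case: ifPn => h.
  by rewrite -EFinB -phi_itv.
by rewrite set_itv_ge ?nu0 // bnd_simp.
Qed.

Import HBNNSimple.

(** Change of variables from uniqueness of Lebesgue measure: [lebesgue_line] treats level sets, and
    monotone convergence passes from simple functions to [q]. *)
Lemma integral_line (q : R -> \bar R) : measurable_fun setT q ->
  (forall t, 0 <= q t)%E ->
  (\int[mu]_t q t = \int[mu]_t (q (phi t) * (dphi t)%:E))%E.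
Proof.
move=> mq q0.
have mE : measurable_fun setT (EFin \o dphi) by exact/measurable_EFinP.
have mq' : measurable_fun (setT : set (measurableTypeR R)) q := mq.
pose f_ := nnsfun_approx (@measurableT _ (measurableTypeR R)) mq'.
have m1 n y : measurable_fun (setT : set (measurableTypeR R))
    (\1_(f_ n @^-1` [set y]) : _ -> R) by exact: measurable_indic.
transitivity (limn (fun n => \int[mu]_t (f_ n t)%:E)%E).
  rewrite -monotone_convergence//.
  - apply: eq_integral => t _; apply/esym/cvg_lim => //.
    by apply: cvg_nnsfun_approx => // *.
  - by move=> n; apply/measurable_EFinP; exact: measurable_funP.
  - by move=> *; rewrite lee_fin.
  - by move=> x _ m n mn; rewrite lee_fin; exact/lefP/nd_nnsfun_approx.
transitivity (limn (fun n => \int[mu]_t ((f_ n (phi t))%:E * (dphi t)%:E))%E).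
  congr (limn _); apply/funext => n.
  transitivity (\int[mu]_x (\sum_(y \in range (f_ n)) (y * \1_(f_ n @^-1` [set y]) x)%:E))%E.
    by apply: eq_integral => x _; rewrite fimfunE -fsumEFin.
  rewrite ge0_integral_fsum//; last 2 first.
  - by move=> y; apply/measurable_EFinP; exact: measurable_funM.
  - by move=> y x _; exact: nnfun_muleindic_ge0.
  transitivity (\int[mu]_x (\sum_(y \in range (f_ n))
      ((y * \1_(f_ n @^-1` [set y]) (phi x))%:E * (dphi x)%:E)))%E; last first.
    apply: eq_integral => x _; rewrite -ge0_mule_fsuml.
    by rewrite [in RHS]fimfunE -fsumEFin.
    by move=> y; exact: nnfun_muleindic_ge0.
  rewrite ge0_integral_fsum//; last 2 first.
  - move=> y; apply: emeasurable_funM => //.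
    apply/measurable_EFinP; apply: measurable_funM => //.
    exact: measurableT_comp (m1 _ _) mphi.
  - by move=> y x _; apply: mule_ge0; [exact: nnfun_muleindic_ge0|rewrite lee_fin].
  apply: eq_fsbigr => y /[!inE] -[x _ yx].
  have y0 : 0 <= y by rewrite -yx.
  under eq_integral do rewrite EFinM.
  rewrite ge0_integralZl//; last first.
    by apply/measurable_EFinP.
  have -> : (\int[mu]_x (\1_(f_ n @^-1` [set y]) x)%:E = nu (f_ n @^-1` [set y]))%E.
    by rewrite integral_indic// setIT; exact: lebesgue_line.
  under [RHS]eq_integral do rewrite EFinM -muleA.
  rewrite ge0_integralZl//; last 2 first.
  - apply: emeasurable_funM => //; apply/measurable_EFinP.
    exact: measurableT_comp (m1 _ _) mphi.
  - by move=> z _; rewrite mule_ge0 ?lee_fin.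
  congr (_ * _)%E; rewrite /nu [LHS]integral_mkcond; apply: eq_integral => z _.
  rewrite /patch indicE.
  have -> : (z \in phi @^-1` (f_ n @^-1` [set y])) = (phi z \in f_ n @^-1` [set y]).
    by apply/idP/idP; rewrite !inE.
  by case: ifPn => _; rewrite ?mul1e ?mul0e.
rewrite -monotone_convergence//.
- apply: eq_integral => t _; apply/cvg_lim => //.
  apply: cvgeZr => //.
  by apply: cvg_nnsfun_approx => // *.
- move=> n; apply: emeasurable_funM => //; apply/measurable_EFinP.
  exact: measurableT_comp (measurable_funP (f_ n)) mphi.
- by move=> n x _; rewrite mule_ge0 ?lee_fin.
- move=> x _ m n mn; apply: lee_wpmul2r; rewrite lee_fin//.
by have := @nd_nnsfun_approx _ _ R _ (@measurableT _ (measurableTypeR R)) _ mq' _ _ mn => /lefP; apply.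
Qed.

End line.

Section reflection.
Context {R : realType}.
Notation mu := (@lebesgue_measure R).

Lemma integral_reflect (q : R -> \bar R) : measurable_fun setT q ->
  (forall t, 0 <= q t)%E -> (\int[mu]_t q t = \int[mu]_t q (- t)%R)%E.
Proof.
move=> mq q0; rewrite (@integral_line R -%R (fun=> 1)) //.
- by under eq_integral do rewrite mule1.
move=> u v uv; rewrite integral_cst; last first.
  by rewrite opp_preimage_itvbndbnd.
transitivity (1 * mu `[(- v)%R, (- u)%R[)%E; last first.
  by rewrite lebesgue_measure_itv /= lte_fin ltrN2 uv mul1e -EFinB opprK addrC.
by rewrite opp_preimage_itvbndbnd.
Qed.

End reflection.

Section increasing.
Context {R : realType}.
Notation mu := (@lebesgue_measure R).
Variables (x0 y0 : R) (f F : R -> R).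
Hypothesis xy0 : x0 <= y0.
Hypothesis f_inc : forall s t, x0 <= s -> s < t -> t <= y0 -> f s < f t.
Hypothesis pf : prim x0 y0 f F.
Hypothesis F0 : forall t, x0 <= t <= y0 -> 0 <= F t.

(** [f] is continued by pieces of slope 1 to an increasing bijection of the line, so that the
    preimage of every interval []u, v]] is again such an interval and [integral_line] applies. *)
Let phi t := if t < x0 then f x0 + (t - x0) else
  if t <= y0 then f t else f y0 + (t - y0).
Let dphi t := if x0 <= t <= y0 then F t else 1.

Let phiE t : x0 <= t <= y0 -> phi t = f t.
Proof. by rewrite /phi ltNge => /andP[-> ->]. Qed.

Let phi_inc s t : s < t -> phi s < phi t.
Proof.
have fle u : x0 <= u <= y0 -> f x0 <= f u <= f y0.
  move=> /andP[]; rewrite le_eqVlt => /predU1P[<-|xu].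
    move=> _; rewrite lexx /=; move: xy0; rewrite le_eqVlt => /predU1P[<-//|h].
    by rewrite ltW // f_inc.
  rewrite le_eqVlt => /predU1P[uE|uy]; first by rewrite -uE lexx andbT ltW // f_inc // uE.
  by rewrite !ltW // f_inc // ltW.
move=> st; rewrite /phi.
have [sx|xs] := ltP s x0.
  have [tx|xt] := ltP t x0; first by lra.
  have [ty|yt] := leP t y0.
    have /andP[h1 h2] : f x0 <= f t <= f y0 by apply: fle; rewrite xt.
    by lra.
  have /andP[h1 h2] : f x0 <= f x0 <= f y0 by apply: fle; rewrite lexx.
  by lra.
have xt : x0 <= t by lra.
rewrite [t < x0]ltNge xt /=.
have [sy|ys] := leP s y0; have [ty|yt] := leP t y0.
- exact: f_inc.
- have /andP[h1 h2] : f x0 <= f s <= f y0 by apply: fle; rewrite xs.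
  by lra.
- by lra.
- by lra.
Qed.

Let prim_phi u v : prim u v phi dphi.
Proof.
have aff (u' v' k : R) : prim u' v' (fun t => k + t) (fun=> 1).
  split; first exact: intg_cst.
  by move=> s t _ st _; rewrite Int_cst// mul1r; ring.
pose u' := Num.min u x0; pose v' := Num.max v y0.
suff : prim u' v' phi dphi.
  by apply: primS; [rewrite ge_min lexx|rewrite le_max lexx].
have ux : u' <= x0 by rewrite ge_min lexx orbT.
have yv : y0 <= v' by rewrite le_max lexx orbT.
apply: (@prim_cat _ y0) => //; first exact: le_trans xy0.
  apply: (@prim_cat _ x0) => //; last first.
    by apply: (eq_prim _ _ pf) => t ht; rewrite ?phiE ?/dphi ?ht.
  apply: (prim_oo _ _ (aff u' x0 (f x0 - x0))) => t /andP[_].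
    rewrite le_eqVlt /phi => /predU1P[->|h]; first by rewrite ltxx xy0; ring.
    by rewrite h; ring.
  by move=> h; rewrite /dphi leNgt h.
apply: (prim_oo _ _ (aff y0 v' (f y0 - y0))) => t /andP[h _].
  rewrite /phi ltNge (le_trans xy0 h) /=; move: h.
  rewrite le_eqVlt => /predU1P[<-|h]; first by rewrite lexx; ring.
  by rewrite leNgt h /=; ring.
by rewrite /dphi [t <= _]leNgt h andbF.
Qed.

Let phi_onto v : exists u, phi u = v.
Proof.
have [vx|xv] := ltP v (f x0).
  by exists (x0 + (v - f x0)); rewrite /phi ifT; [ring|lra].
have [yv|vy] := ltP (f y0) v.
  exists (y0 + (v - f y0)); rewrite /phi ifF; last first.
    by apply/negbTE; rewrite -leNgt (le_trans xy0) // lerDl subr_ge0 ltW.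
  by rewrite ifF; [ring|apply/negbTE; rewrite -ltNge ltrDl subr_gt0].
have [|t] := @IVT R f x0 y0 v xy0 (prim_within pf).
  by rewrite ge_min xv le_max vy orbT.
by rewrite in_itv /= => /phiE <- <-; exists t.
Qed.

Let mphi : measurable_fun setT phi.
Proof.
apply: nondecreasing_measurable => // s t; rewrite le_eqVlt => /predU1P[->//|/phi_inc].
exact: ltW.
Qed.

Let mdphi : measurable_fun setT dphi.
Proof.
apply: measurable_fun_if => //.
- by apply: measurable_and; apply: measurable_fun_ler.
- apply: measurable_funS (intg_meas pf.1) => // t /= [_].
Qed.

Let dphi0 t : 0 <= dphi t.
Proof. by rewrite /dphi; case: ifP => // /F0. Qed.

Let phi_itv u v : u < v ->
  (\int[mu]_(t in phi @^-1` `]u, v]) (dphi t)%:E = (v - u)%:E)%E.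
Proof.
move=> uv; have [s su] := phi_onto u; have [t tv] := phi_onto v.
have phi_lt p q : (phi p < phi q) = (p < q).
  apply/idP/idP => [|/phi_inc //]; apply: contraTT; rewrite -!leNgt.
  by rewrite le_eqVlt => /predU1P[->//|/phi_inc /ltW].
have st : s < t by rewrite -phi_lt su tv.
have -> : phi @^-1` `]u, v] = `]s, t]%classic.
  apply/seteqP; split => r /=; rewrite !in_itv /= -su -tv phi_lt !leNgt phi_lt //.
have [ip hp] := prim_phi s t.
rewrite integral_itv_obnd_cbnd; last first.
  apply/measurable_EFinP; exact: measurable_funS mdphi.
rewrite -su -tv hp ?lexx ?(ltW st) //.
by rewrite /Int /Rintegral fineK //; exact: integrable_fin_num.
Qed.

Lemma integral_increasing (q : R -> R) :
  measurable_fun `[f x0, f y0] q -> (forall t, 0 <= q t) ->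
  (\int[mu]_(t in `[f x0, f y0]) (q t)%:E =
   \int[mu]_(t in `[x0, y0]) (q (f t) * F t)%:E)%E.
Proof.
move=> mq q0; rewrite integral_mkcond [RHS]integral_mkcond.
rewrite (integral_line mphi mdphi dphi0 phi_itv); last 2 first.
- by apply/(measurable_restrictT _ _).1 => //; exact/measurable_EFinP.
- by move=> t; rewrite /patch; case: ifP => // _; rewrite lee_fin.
have phi_le p r : (phi p <= phi r) = (p <= r).
  apply/idP/idP; last by rewrite le_eqVlt => /predU1P[->//|/phi_inc /ltW].
  by apply: contraTT; rewrite -!ltNge => /phi_inc.
apply: eq_integral => t _; rewrite /patch !mem_setE !in_itv /=.
rewrite -(@phiE x0) ?lexx// -(@phiE y0) ?lexx ?xy0// !phi_le /dphi.
by case: ifPn => h; rewrite ?mul0e // phiE ?EFinM.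
Qed.

End increasing.

Section substitution.
Context {R : realType}.
Notation mu := (@lebesgue_measure R).
Implicit Types (x y s t u v : R) (f F q Q : R -> R).

Definition incr x0 y0 f := forall s t, x0 <= s -> s < t -> t <= y0 -> f s < f t.
Definition decr x0 y0 f := forall s t, x0 <= s -> s < t -> t <= y0 -> f t < f s.

Lemma incr_le x0 y0 f s t : incr x0 y0 f -> x0 <= s -> s <= t -> t <= y0 -> f s <= f t.
Proof.
by move=> h xs; rewrite le_eqVlt => /predU1P[->//|st ty]; rewrite ltW // h.
Qed.

Lemma decr_le x0 y0 f s t : decr x0 y0 f -> x0 <= s -> s <= t -> t <= y0 -> f t <= f s.
Proof.
by move=> h xs; rewrite le_eqVlt => /predU1P[->//|st ty]; rewrite ltW // h.
Qed.

Lemma incrS x0 y0 x1 y1 f : x0 <= x1 -> y1 <= y0 -> incr x0 y0 f -> incr x1 y1 f.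
Proof. by move=> xx yy h s t xs st ty; apply: h => //; [exact: le_trans xs|exact: le_trans yy]. Qed.

Lemma decrS x0 y0 x1 y1 f : x0 <= x1 -> y1 <= y0 -> decr x0 y0 f -> decr x1 y1 f.
Proof. by move=> xx yy h s t xs st ty; apply: h => //; [exact: le_trans xs|exact: le_trans yy]. Qed.

Lemma integral_decreasing x0 y0 f F (q : R -> R) : x0 <= y0 -> decr x0 y0 f ->
  prim x0 y0 f F -> (forall t, x0 <= t <= y0 -> F t <= 0) ->
  measurable_fun `[f y0, f x0] q -> (forall t, 0 <= q t) ->
  (\int[mu]_(t in `[f y0, f x0]) (q t)%:E =
   \int[mu]_(t in `[x0, y0]) (q (f t) * - F t)%:E)%E.
Proof.
move=> xy df pf F0 mq q0.
pose g t := - f t; pose q' t := q (- t).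
have mq' : measurable_fun `[g x0, g y0] q'.
  apply: (measurable_comp (F := `[f y0, f x0]%classic)) => //.
  by move=> _ [t /=] + <-; rewrite !in_itv /g /= lerNl lerNr andbC.
have := @integral_increasing R x0 y0 g (fun t => - F t) xy _ (primN pf) _ q' mq'.
rewrite /q' /g; under [X in _ -> _ -> _ -> _ = X]eq_integral do rewrite opprK.
move=> <- //; last 2 first.
- by move=> s t xs st ty; rewrite ltrN2; exact: df.
- by move=> t /F0; rewrite oppr_ge0.
rewrite integral_mkcond [RHS]integral_mkcond integral_reflect; last 2 first.
- by apply/(measurable_restrictT _ _).1 => //; exact/measurable_EFinP.
- by move=> t; rewrite /patch; case: ifP => // _; rewrite lee_fin.
apply: eq_integral => t _; rewrite /patch !mem_setE !in_itv /=.
by rewrite lerNl lerNr andbC.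
Qed.

Definition monot (b : bool) x0 y0 f := if b then incr x0 y0 f else decr x0 y0 f.

(* [[flo b (f x) (f y), flo b (f y) (f x)]] is the image of [[x, y]] under [f]. *)
Definition flo (b : bool) (u v : R) := if b then u else v.

Definition sgb (b : bool) (u : R) := if b then u else - u.

Lemma monotS b x0 y0 x1 y1 f : x0 <= x1 -> y1 <= y0 -> monot b x0 y0 f -> monot b x1 y1 f.
Proof. by case: b; [exact: incrS|exact: decrS]. Qed.

Lemma monot_itv b x0 y0 f t : monot b x0 y0 f -> x0 <= t <= y0 ->
  flo b (f x0) (f y0) <= f t <= flo b (f y0) (f x0).
Proof.
move=> + /andP[xt ty]; case: b => h /=.
  by rewrite !(incr_le h) ?lexx// (le_trans xt ty).
by rewrite !(decr_le h) ?lexx// (le_trans xt ty).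
Qed.

Lemma ge0_subst b x0 y0 f F (q : R -> R) : x0 <= y0 -> monot b x0 y0 f ->
  prim x0 y0 f F -> (forall t, x0 <= t <= y0 -> 0 <= sgb b (F t)) ->
  measurable_fun `[flo b (f x0) (f y0), flo b (f y0) (f x0)] q -> (forall t, 0 <= q t) ->
  (\int[mu]_(t in `[flo b (f x0) (f y0), flo b (f y0) (f x0)]) (q t)%:E =
   \int[mu]_(t in `[x0, y0]) (q (f t) * sgb b (F t))%:E)%E.
Proof.
case: b => /= xy mf pf F0 mq q0; first exact: (integral_increasing xy mf pf F0).
by apply: integral_decreasing => // t /F0; rewrite oppr_ge0.
Qed.

Lemma intg_sgb b x y q : intg x y q -> intg x y (fun t => sgb b (q t)).
Proof. by case: b => //; exact: intgN. Qed.

Lemma bmeas_sgb b x y q : bmeas x y q -> bmeas x y (fun t => sgb b (q t)).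
Proof. by case: b => //; exact: bmeasN. Qed.

Lemma meas_comp_mono b x0 y0 f F (q : R -> R) : monot b x0 y0 f -> prim x0 y0 f F ->
  measurable_fun `[flo b (f x0) (f y0), flo b (f y0) (f x0)] q ->
  measurable_fun `[x0, y0] (q \o f).
Proof.
move=> mf pf mq.
apply: (measurable_comp (F := `[flo b (f x0) (f y0), flo b (f y0) (f x0)]%classic)) => //.
- by move=> _ [t /=] + <-; rewrite !in_itv => /(monot_itv mf).
- exact: (prim_bmeas pf).1.
Qed.

Lemma intg_subst b x0 y0 f F (q : R -> R) : x0 <= y0 -> monot b x0 y0 f ->
  prim x0 y0 f F -> (forall t, x0 <= t <= y0 -> 0 <= sgb b (F t)) ->
  intg (flo b (f x0) (f y0)) (flo b (f y0) (f x0)) q ->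
  intg x0 y0 (fun t => q (f t) * sgb b (F t)).
Proof.
move=> xy mf pf F0 iq.
apply/integrableP; split.
  apply/measurable_EFinP; apply: measurable_funM.
    exact: meas_comp_mono mf pf (intg_meas iq).
  exact: intg_meas (intg_sgb b pf.1).
have := @ge0_subst b x0 y0 f F (fun t => `|q t|) xy mf pf F0.
move=> /(_ (intg_meas (intg_norm iq)) (fun=> normr_ge0 _)) h.
under eq_integral => t tI.
  rewrite /= normrM (@ger0_norm _ (sgb _ _)); last by apply: F0; move: tI; rewrite inE /= in_itv.
  over.
by rewrite -h; case/integrableP : iq.
Qed.

Lemma Int_subst b x0 y0 f F (q : R -> R) : x0 <= y0 -> monot b x0 y0 f ->
  prim x0 y0 f F -> (forall t, x0 <= t <= y0 -> 0 <= sgb b (F t)) ->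
  intg (flo b (f x0) (f y0)) (flo b (f y0) (f x0)) q ->
  Int (flo b (f x0) (f y0)) (flo b (f y0) (f x0)) q =
  Int x0 y0 (fun t => q (f t) * sgb b (F t)).
Proof.
move=> xy mf pf F0 iq.
have H (p : R -> R) : intg (flo b (f x0) (f y0)) (flo b (f y0) (f x0)) p -> (forall t, 0 <= p t) ->
    Int (flo b (f x0) (f y0)) (flo b (f y0) (f x0)) p =
    Int x0 y0 (fun t => p (f t) * sgb b (F t)).
  by move=> ip p0; rewrite /Int /Rintegral (ge0_subst xy mf pf F0) //; exact: intg_meas.
(* Used with [p' = |q|]: both [q + |q|] and [|q|] are nonnegative, which reduces the claim to
   [ge0_subst]. *)
have e x y (p p' : R -> R) : intg x y p -> intg x y p' -> Int x y p = Int x y (fun t => p t + p' t) - Int x y p'.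
  by move=> ip ip'; rewrite IntD// addrK.
have iN := intg_norm iq; have iA := intgD iq iN.
rewrite (e _ _ q (fun t => `|q t|)) // H // ?H //; last first.
  by move=> t; rewrite -lerBlDr sub0r lerNnormlW.
have jN := intg_subst xy mf pf F0 iN; have jA := intg_subst xy mf pf F0 iA.
rewrite -IntB //; apply: eq_Int => t _; ring.
Qed.

Lemma prim_comp b x0 y0 f F Q q : x0 <= y0 -> monot b x0 y0 f ->
  prim x0 y0 f F -> (forall t, x0 <= t <= y0 -> 0 <= sgb b (F t)) ->
  prim (flo b (f x0) (f y0)) (flo b (f y0) (f x0)) Q q ->
  prim x0 y0 (Q \o f) (fun t => q (f t) * F t).
Proof.
move=> xy mf pf F0 [iq hq]; split.
  have := intg_sgb b (intg_subst xy mf pf F0 iq).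
  by apply: eq_intg => t _; case: b {mf F0 iq hq} => //=; rewrite mulrN opprK.
move=> s t xs st ty.
have F0' u : s <= u <= t -> 0 <= sgb b (F u).
  by move=> /andP[su ut]; apply: F0; rewrite (le_trans xs su) (le_trans ut ty).
have mst : monot b s t f by exact: monotS mf.
have /andP[s1 s2] : flo b (f x0) (f y0) <= f s <= flo b (f y0) (f x0).
  by apply: monot_itv mf _; rewrite xs (le_trans st ty).
have /andP[t1 t2] : flo b (f x0) (f y0) <= f t <= flo b (f y0) (f x0).
  by apply: monot_itv mf _; rewrite ty (le_trans xs st).
have iq' : intg (flo b (f s) (f t)) (flo b (f t) (f s)) q.
  by apply: intgS iq; case: b {mf F0 F0' mst hq} s1 s2 t1 t2.
have := Int_subst st mst (primS xs ty pf) F0' iq'.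
have /andP[fst' fst] : flo b (f s) (f t) <= f s <= flo b (f t) (f s).
  by apply: monot_itv mst _; rewrite lexx.
have iqF := intg_subst st mst (primS xs ty pf) F0' iq'.
case: b {mf F0 F0' mst iq} hq s1 s2 t1 t2 iq' fst' fst iqF => /= hq s1 s2 t1 t2 iq' fst' fst iqF e.
  by rewrite hq.
have -> : Q (f t) - Q (f s) = - (Q (f s) - Q (f t)) by rewrite opprB.
rewrite hq // e -IntN //.
by apply: eq_Int => u _; rewrite mulrN opprK.
Qed.

End substitution.

(** * The Lasota-Yorke inequality *)

Section concat.
Context {R : realType}.
Notation mu := (@lebesgue_measure R).
Implicit Types (x y z s t u v k K L C : R) (f F q Q p P : R -> R).

Lemma bmeas_cat x y z p q : x <= y -> y <= z -> bmeas x y p -> bmeas y z q ->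
  bmeas x z (fun t => if t <= y then p t else q t).
Proof.
move=> xy yz [mp [K hK]] [mq [L hL]]; split.
  apply: measurable_fun_if => //.
  - exact: measurable_fun_ler.
  - apply: measurable_funS mp => // t [] /=; rewrite !in_itv /= => /andP[-> _] //.
  - apply: measurable_funS mq => // t [] /=; rewrite !in_itv /= => /andP[_ ->].
    by rewrite andbT leNgt => /negbFE /ltW.
exists (`|K| + `|L|) => t /andP[xt tz]; case: ifPn => h.
  by apply: (le_trans (hK _ _)); [rewrite xt|apply: (le_trans (ler_norm _)); rewrite lerDl].
apply: (le_trans (hL _ _)); first by rewrite tz ltW // ltNge.
by apply: (le_trans (ler_norm _)); rewrite lerDr.
Qed.

(* [P] coincides, up to a bounded error [r], with a function whose primitive
   vanishes at both ends and is small in between. *)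
Definition small_prim P K C x y := exists r, [/\ bmeas x y r,
  forall t, x <= t <= y -> `|r t| <= K,
  Int x y (fun t => P t - r t) = 0 &
  forall t, x <= t <= y -> `|Int x t (fun t => P t - r t)| <= C].

(** The primitive of the corrected function returns to zero at [y], so [C] does not add up over the
    pieces. Hence the leading constant of the Lasota-Yorke inequality does not depend on the number
    of laps. *)
Lemma small_prim_cat P K C x y z : x <= y -> y <= z -> bmeas x z P ->
  small_prim P K C x y -> small_prim P K C y z -> small_prim P K C x z.
Proof.
move=> xy yz bP [r [br rK r0 rC]] [r' [br' rK' r0' rC']].
pose s t := if t <= y then r t else r' t.
have bs : bmeas x z s by exact: bmeas_cat.
have iP : intg x z (fun t => P t - s t) by apply: bmeas_intg; exact: bmeasB.
have e1 t : x <= t -> t <= y -> Int x t (fun t => P t - s t) = Int x t (fun t => P t - r t).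
  move=> xt ty; apply: eq_Int => u /andP[_ ut].
  by rewrite /s (le_trans ut ty).
have e2 t : y <= t -> t <= z -> Int y t (fun t => P t - s t) = Int y t (fun t => P t - r' t).
  move=> yt tz; apply: Int_oo => u /andP[yu _].
  by rewrite /s leNgt yu.
exists s; split => //.
- move=> t /andP[xt tz]; rewrite /s; case: ifPn => h; first by rewrite rK ?xt.
  by rewrite rK' // tz ltW // ltNge.
- by rewrite (@Int_cat _ y) // e1 // e2 // r0 r0' addr0.
- move=> t /andP[xt tz]; have [ty|yt] := leP t y.
    by rewrite e1 // rC // xt.
  rewrite (@Int_cat _ y) ?(ltW yt) //; last exact: intgS iP.
  by rewrite e1 // e2 ?(ltW yt)// r0 add0r rC' // (ltW yt).
Qed.

(** A finite subdivision whose cells satisfy [P], encoded as a transitive closure so that its nodes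
    need not be enumerated. *)
Inductive chain (P : R -> R -> Prop) : R -> R -> Prop :=
| chain1 x y : x < y -> P x y -> chain P x y
| chainD x y z : chain P x y -> chain P y z -> chain P x z.

Lemma chain_lt (P : R -> R -> Prop) x y : chain P x y -> x < y.
Proof. by elim=> // u v w _ uv _; exact: lt_trans. Qed.

End concat.

Section functional.
Context {R : realType}.
Variables (a b : R).
Hypothesis ab : a < b.
Implicit Types (x y z s t u v k K L C M N V : R) (q Q p P : R -> R).
Implicit Types (T : (R -> R) -> R).

(* A functional [T] on bounded measurable functions stands for a measure, [func_bd]
   bounds its mass and [func_var] the variation of its density: dually to a sup
   norm, the latter tests [T] on functions whose primitive is small. *)
Definition func_lin T := forall k p q, bmeas a b p -> bmeas a b q ->
  T (fun t => k * p t + q t) = k * T p + T q.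

Definition func_bd T M := forall q K, bmeas a b q ->
  (forall t, a <= t <= b -> `|q t| <= K) -> `|T q| <= M * K.

Definition func_var T V := forall p C, bmeas a b p ->
  (forall x, a <= x <= b -> `|Int a x p| <= C) -> `|T p| <= V * C.

Lemma funcD T p q : func_lin T -> bmeas a b p -> bmeas a b q ->
  T (fun t => p t + q t) = T p + T q.
Proof.
move=> lT bp bq; rewrite -[T p]mul1r -lT //.
by congr T; apply/funext => t; rewrite mul1r.
Qed.

Lemma funcZ T k p : func_lin T -> bmeas a b p -> T (fun t => k * p t) = k * T p.
Proof.
move=> lT bp.
have T0 : T (fun=> 0) = 0.
  have := funcD lT (bmeas_cst a b 0) (bmeas_cst a b 0).
  rewrite (_ : (fun=> _) = (fun=> 0)); last by apply/funext => t; rewrite addr0.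
  by move/eqP; rewrite -subr_eq0 opprD addrA subrr sub0r oppr_eq0 => /eqP.
rewrite -[RHS]addr0 -T0 -lT //; last exact: bmeas_cst.
by congr T; apply/funext => t; rewrite addr0.
Qed.

Lemma funcB T p q : func_lin T -> bmeas a b p -> bmeas a b q ->
  T (fun t => p t - q t) = T p - T q.
Proof.
move=> lT bp bq; rewrite -[- T q]mulN1r -funcZ // -funcD //; last exact: bmeasZ.
by congr T; apply/funext => t; rewrite mulN1r.
Qed.

Lemma func_bd_ge0 T M : func_bd T M -> 0 <= M.
Proof.
move=> /(_ (fun=> 1) 1 (bmeas_cst _ _ _)); rewrite mulr1 => /(_ _)/(le_trans _); apply => //.
by move=> t _; rewrite normr1.
Qed.

Lemma func_var_ge0 T M : func_var T M -> 0 <= M.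
Proof.
move=> /(_ (fun=> 0) 1 (bmeas_cst _ _ _)); rewrite mulr1 => /(_ _)/(le_trans _); apply => //.
by move=> t /andP[at_ _]; rewrite Int_cst // mul0r normr0.
Qed.

Lemma func_bdW T M M' : M <= M' -> func_bd T M -> func_bd T M'.
Proof.
move=> MM hT q K bq qK; apply: le_trans (hT _ _ bq qK) _.
by rewrite ler_wpM2r // (le_trans _ (qK a _)) // lexx ltW.
Qed.

Lemma func_varW T M M' : M <= M' -> func_var T M -> func_var T M'.
Proof.
move=> MM hT q K bq qK; apply: le_trans (hT _ _ bq qK) _.
by rewrite ler_wpM2r // (le_trans _ (qK a _)) // lexx ltW.
Qed.

Definition func N T := [/\ func_lin T, func_bd T N & func_var T N].

Lemma funcW T M M' : M <= M' -> func M T -> func M' T.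
Proof. by move=> h [l h1 h2]; split => //; [exact: func_bdW h1|exact: func_varW h2]. Qed.

End functional.

Section expanding.
Context {R : realType}.
Notation mu := (@lebesgue_measure R).
Implicit Types (x y z s t u v k K L C M N V : R) (q Q p P : R -> R) (n i j : nat).
Implicit Types (T : (R -> R) -> R) (e : bool).

Definition blo (a c : R) e := if e then a else c.
Definition bhi (c b : R) e := if e then c else b.

(* [w] is [1 / f'] on each of the two branches, closed intervals included. *)
Record expanding (a c b th : R) (f : R -> R) (w dw : bool -> R -> R) : Prop := Expanding {
  ex_acb : a < c < b;
  ex_th : 0 < th < 1;
  ex_map : forall t, a <= t <= b -> a <= f t <= b;
  ex_mono : forall e, monot e (blo a c e) (bhi c b e) f;
  ex_f : forall e, prim (blo a c e) (bhi c b e) f (fun t => (w e t)^-1);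
  ex_bf : forall e, bmeas (blo a c e) (bhi c b e) (fun t => (w e t)^-1);
  ex_w : forall e, prim (blo a c e) (bhi c b e) (w e) (dw e);
  ex_dw : forall e, bmeas (blo a c e) (bhi c b e) (dw e);
  ex_w0 : forall e t, blo a c e <= t <= bhi c b e -> 0 < sgb e (w e t) <= th }.

Variables (a c b th : R) (f : R -> R) (w dw : bool -> R -> R).
Hypothesis ex : expanding a c b th f w dw.

Notation lo := (blo a c).
Notation hi := (bhi c b).

Lemma ex_lohi e : a <= lo e /\ hi e <= b /\ lo e < hi e.
Proof. by have /andP[ac cb] := ex_acb ex; case: e => /=; rewrite ?lexx ?ltW. Qed.

Lemma ex_ab : a < b.
Proof. by have /andP[ac cb] := ex_acb ex; exact: lt_trans cb. Qed.

Lemma ex_prim_f e x y : lo e <= x -> y <= hi e -> prim x y f (fun t => (w e t)^-1).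
Proof. by move=> lx yh; apply: primS (ex_f ex e). Qed.

Lemma ex_inv0 e t : lo e <= t <= hi e -> 0 <= sgb e (w e t)^-1.
Proof.
by move=> /(ex_w0 ex) /andP[+ _]; case: e => /= h; rewrite -?invrN invr_ge0 ltW.
Qed.

Lemma ex_w_neq0 e t : lo e <= t <= hi e -> w e t != 0.
Proof.
move=> /(ex_w0 ex) /andP[+ _]; case: e => /= h; first by rewrite gt_eqF.
by rewrite -oppr_eq0 gt_eqF.
Qed.

Lemma ex_w_le e t : lo e <= t <= hi e -> `|w e t| <= th.
Proof.
move=> /(ex_w0 ex) /andP[+ +]; case: e => /= h; first by rewrite gtr0_norm.
by rewrite ltr0_norm // -oppr_gt0.
Qed.

Lemma bmeas_comp_f q : bmeas a b q -> bmeas a b (q \o f).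
Proof.
have /andP[ac cb] := ex_acb ex.
move=> [mq [K hK]]; split; last first.
  by exists K => t /(ex_map ex) /hK.
apply: (measurable_comp (F := `[a, b]%classic)) => //.
  by move=> _ [t /=] + <-; rewrite !in_itv => /(ex_map ex).
have b1 := prim_bmeas (ex_f ex true); have b2 := prim_bmeas (ex_f ex false).
have [+ _] := bmeas_cat (ltW ac) (ltW cb) b1 b2.
by apply: eq_measurable_fun => t _; case: ifP.
Qed.

Lemma ex_iter n t : a <= t <= b -> a <= iter n f t <= b.
Proof. by move=> h; elim: n => //= n /(ex_map ex). Qed.

Lemma bmeas_iter n q : bmeas a b q -> bmeas a b (fun t => q (iter n f t)).
Proof. by elim: n q => // n IH q /IH /bmeas_comp_f; apply: eq_bmeas => t _; rewrite /= -iterSr. Qed.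

(** The itinerary form of an interval of monotonicity of [f^n]: each of its first [n] successive
    images lies in one closed branch. *)
Fixpoint lap n x y : Prop := if n is n'.+1 then
  exists e, [/\ lo e <= x, y <= hi e &
    lap n' (flo e (f x) (f y)) (flo e (f y) (f x))] else True.

(** A subdivision of the image is pulled back node by node by the intermediate value theorem; on the
    decreasing branch the order of the pieces is reversed. *)
Lemma lap_pull n e x y u v : chain (lap n) u v -> lo e <= x -> y <= hi e -> x < y ->
  u = flo e (f x) (f y) -> v = flo e (f y) (f x) -> chain (lap n.+1) x y.
Proof.
move=> ch; elim: ch x y => [{}u {}v uv luv|{}u m {}v c1 IH1 c2 IH2] x y lx yh xy ue ve.
  by apply: chain1 => //=; exists e; rewrite -ue -ve; split.
have um := chain_lt c1; have mv := chain_lt c2.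
have [|z] := @IVT R f x y m (ltW xy) (prim_within (ex_prim_f lx yh)).
  move: um mv; rewrite ue ve; case: (e) => /= h1 h2.
    by rewrite ge_min le_max (ltW h1) (ltW h2) orbT.
  by rewrite ge_min le_max (ltW h1) (ltW h2) orbT.
rewrite in_itv /= => /andP[xz zy] fz.
have xz' : x < z.
  rewrite lt_neqAle xz andbT; apply/eqP => xE; move: um mv; rewrite ue ve -fz -xE.
  by case: (e); rewrite /= ltxx.
have zy' : z < y.
  rewrite lt_neqAle zy andbT; apply/eqP => xE; move: um mv; rewrite ue ve -fz xE.
  by case: (e); rewrite /= ltxx.
have lz := le_trans lx xz; have zh := le_trans zy yh.
move: ue ve IH1 IH2; rewrite -fz; case: (e) lx yh lz zh => /= lx yh lz zh ue ve IH1 IH2.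
  by apply: (@chainD _ _ _ z); [exact: IH1|exact: IH2].
by apply: (@chainD _ _ _ z); [exact: IH2|exact: IH1].
Qed.

Lemma ex_image e x y : lo e <= x -> y <= hi e -> x < y ->
  [/\ a <= flo e (f x) (f y), flo e (f y) (f x) <= b &
      flo e (f x) (f y) < flo e (f y) (f x)].
Proof.
move=> lx yh xy; have [la [hb _]] := ex_lohi e.
have /andP[a1 b1] : a <= f x <= b.
  by apply: (ex_map ex); rewrite (le_trans la lx) (le_trans (ltW xy)) // (le_trans yh).
have /andP[a2 b2] : a <= f y <= b.
  by apply: (ex_map ex); rewrite (le_trans yh hb) (le_trans (le_trans la lx)) // ltW.
by have := ex_mono ex e; case: e {la hb} lx yh => /= lx yh h; split => //; exact: h.
Qed.

Lemma lap_chain n x y : a <= x -> y <= b -> x < y -> chain (lap n) x y.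
Proof.
elim: n x y => [|n IH] x y ax yb xy; first exact: chain1.
have one e x' y' : lo e <= x' -> y' <= hi e -> x' < y' -> chain (lap n.+1) x' y'.
  move=> lx yh xy'; have [h1 h2 h3] := ex_image lx yh xy'.
  by apply: lap_pull lx yh xy' _ _ => //; exact: IH.
have [yc|cy] := leP y c; first exact: (one true).
have [cx|xc] := leP c x; first exact: (one false).
by apply: (@chainD _ _ _ c); [exact: (one true)|exact: (one false)].
Qed.

Lemma bmeas_mono e x y q : lo e <= x -> y <= hi e -> x <= y ->
  bmeas (flo e (f x) (f y)) (flo e (f y) (f x)) q -> bmeas x y (q \o f).
Proof.
move=> lx yh xy [mq [K hK]]; have mf := monotS lx yh (ex_mono ex e).
split; first exact: meas_comp_mono mf (ex_prim_f lx yh) mq.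
by exists K => t txy; apply: hK; exact: monot_itv mf txy.
Qed.

Lemma prim_mono e x y Q q : lo e <= x -> y <= hi e -> x <= y ->
  prim (flo e (f x) (f y)) (flo e (f y) (f x)) Q q ->
  prim x y (Q \o f) (fun t => q (f t) * (w e t)^-1).
Proof.
move=> lx yh xy pQ; have mf := monotS lx yh (ex_mono ex e).
apply: prim_comp xy mf (ex_prim_f lx yh) _ pQ => t /andP[xt ty].
by apply: ex_inv0; rewrite (le_trans lx xt) (le_trans ty yh).
Qed.

(** If [p o f^n - r] is the derivative of [Psi] on the image, then [(Psi o f) * w] has derivative
    [(p o f^n - r) o f + (Psi o f) * dw], since [w] cancels [f']. So each step multiplies the
    primitive by [w], at most [th], and moves a bounded term into the error. *)
Lemma lap_prim n x y : a <= x -> y <= b -> x < y -> lap n x y ->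
  exists2 K, 0 <= K & forall p C, bmeas a b p ->
    (forall t, a <= t <= b -> `|Int a t p| <= C) ->
    exists r Psi, [/\ bmeas x y r, forall t, x <= t <= y -> `|r t| <= K * C,
      forall t, x <= t <= y -> `|Psi t| <= th ^+ n * C &
      prim x y Psi (fun t => p (iter n f t) - r t)].
Proof.
elim: n x y => [|n IH] x y ax yb xy.
  move=> _; exists 0 => // p C bp hp.
  exists (fun=> 0), (fun t => Int a t p); split.
  - exact: bmeas_cst.
  - by move=> t _; rewrite normr0 mul0r.
  - by move=> t /andP[xt ty]; rewrite expr0 mul1r hp // (le_trans ax xt) (le_trans ty yb).
  - apply: (eq_prim _ _ (primS ax yb (prim_Int (bmeas_intg bp)))) => // t _.
    by rewrite subr0.
move=> [e [lx yh]]; have [h1 h2 h3] := ex_image lx yh xy => /(IH _ _ h1 h2 h3)[K K0 hK].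
have [_ [D hD]] := ex_dw ex e.
have sub t : x <= t <= y -> lo e <= t <= hi e.
  by move=> /andP[xt ty]; rewrite (le_trans lx xt) (le_trans ty yh).
exists (K + `|D|) => [|p C bp hp]; first by rewrite addr_ge0.
have C0 : 0 <= C.
  by apply: le_trans (hp a _); rewrite // lexx ltW // ex_ab.
have /andP[th0 th1] := ex_th ex.
have [r [Psi [br rK PsiC pPsi]]] := hK p C bp hp.
have mf := monotS lx yh (ex_mono ex e).
exists (fun t => r (f t) - Psi (f t) * dw e t), (fun t => Psi (f t) * w e t); split.
- apply: bmeasB; first exact: (bmeas_mono lx yh (ltW xy) br).
  apply: bmeasM; last exact: bmeasS (ex_dw ex e).
  exact: (bmeas_mono lx yh (ltW xy) (prim_bmeas pPsi)).
- move=> t txy; have ft := monot_itv mf txy.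
  apply: le_trans (ler_normB _ _) _; rewrite mulrDl normrM lerD ?rK //.
  rewrite mulrC ler_pM //.
    by apply: le_trans (hD _ (sub _ txy)) (ler_norm _).
  apply: le_trans (PsiC _ ft) _; apply: ler_piMl => //.
  by rewrite exprn_ile1 // ltW.
- move=> t txy; have ft := monot_itv mf txy.
  rewrite normrM exprSr mulrAC ler_pM ?PsiC //.
  exact: ex_w_le (sub _ txy).
- have := primM (prim_mono lx yh (ltW xy) pPsi) (primS lx yh (ex_w ex e)).
  apply: eq_prim => // t txy /=.
  rewrite -iterS iterSr divfK ?ex_w_neq0 ?sub //; ring.
Qed.

Lemma lap_small n x y : a <= x -> y <= b -> x < y -> lap n x y ->
  exists2 K, 0 <= K & forall p C, bmeas a b p ->
    (forall t, a <= t <= b -> `|Int a t p| <= C) ->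
    small_prim (fun t => p (iter n f t)) (K * C) (4 * th ^+ n * C) x y.
Proof.
move=> ax yb xy lxy; have [K K0 hK] := lap_prim ax yb xy lxy.
have yx0 : 0 < y - x by rewrite subr_gt0.
have /andP[th0 th1] := ex_th ex.
have thn : 0 <= th ^+ n by rewrite exprn_ge0 // ltW.
exists (K + 2 * th ^+ n / (y - x)) => [|p C bp hp].
  by rewrite addr_ge0 // divr_ge0 ?mulr_ge0 // ltW.
have [r [Psi [br rK PsiC pPsi]]] := hK p C bp hp.
(* Subtracting the slope of the chord makes the primitive vanish at [y]. The increment of [Psi] and
   the chord are each at most [2 * th ^+ n * C], whence the 4. *)
pose m := (Psi y - Psi x) / (y - x).
have Pd : `|Psi y - Psi x| <= 2 * th ^+ n * C.
  apply: le_trans (ler_normB _ _) _.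
  have := PsiC y; have := PsiC x; rewrite !lexx (ltW xy) => /(_ isT) h1 /(_ isT) h2.
  lra.
have iP : intg x y (fun t => p (iter n f t) - r t) := pPsi.1.
have Ie t : x <= t <= y -> Int x t (fun t => p (iter n f t) - (r t + m)) =
    Psi t - Psi x - m * (t - x).
  move=> /andP[xt ty]; rewrite (pPsi.2 x t) // -Int_cst // -IntB.
  - by apply: eq_Int => u _; ring.
  - exact: intgS iP.
  - exact: intg_cst.
exists (fun t => r t + m); split.
- by apply: bmeasD => //; exact: bmeas_cst.
- move=> t txy; apply: le_trans (ler_normD _ _) _; rewrite mulrDl lerD ?rK //.
  by rewrite /m normrM normfV (gtr0_norm yx0) mulrAC ler_pM2r // invr_gt0.
- by rewrite Ie ?lexx ?(ltW xy) // /m divfK ?gt_eqF // subrr.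
- move=> t txy; rewrite Ie //; apply: le_trans (ler_normB _ _) _.
  have h1 : `|m * (t - x)| <= 2 * th ^+ n * C.
    apply: le_trans Pd; rewrite /m normrM normrM normfV (gtr0_norm yx0).
    case/andP: txy => xt ty; rewrite -mulrA ler_piMr // mulrC ler_pdivrMr // mul1r.
    by rewrite ger0_norm ?subr_ge0 // lerD2r.
  have h2 : `|Psi t - Psi x| <= 2 * th ^+ n * C.
    apply: le_trans (ler_normB _ _) _.
    have := PsiC x; rewrite !lexx (ltW xy) => /(_ isT).
    by have := PsiC t txy; lra.
  lra.
Qed.

Lemma small_primW P K K' C x y : K <= K' -> small_prim P K C x y -> small_prim P K' C x y.
Proof.
move=> KK [r [br rK r0 rC]]; exists r; split => // t /rK h; exact: le_trans KK.
Qed.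

Lemma chain_small n x y : chain (lap n) x y -> a <= x -> y <= b ->
  exists2 K, 0 <= K & forall p C, bmeas a b p ->
    (forall t, a <= t <= b -> `|Int a t p| <= C) ->
    small_prim (fun t => p (iter n f t)) (K * C) (4 * th ^+ n * C) x y.
Proof.
elim=> [{}x {}y xy lxy ax yb|{}x z {}y c1 IH1 c2 IH2 ax yb]; first exact: lap_small.
have xz := chain_lt c1; have zy := chain_lt c2.
have [K1 K10 h1] := IH1 ax (le_trans (ltW zy) yb).
have [K2 K20 h2] := IH2 (le_trans ax (ltW xz)) yb.
exists (K1 + K2) => [|p C bp hp]; first exact: addr_ge0.
have C0 : 0 <= C.
  by apply: le_trans (hp a _); rewrite // lexx ltW // ex_ab.
apply: (@small_prim_cat _ _ _ _ _ z); rewrite ?ltW //.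
- exact: bmeasS (bmeas_iter n bp).
- by apply: small_primW (h1 p C bp hp); rewrite ler_wpM2r // lerDl.
- by apply: small_primW (h2 p C bp hp); rewrite ler_wpM2r // lerDr.
Qed.

(** Dual to var (L^n u) <= 4 th^n var u + K |u|_1: the part of [p o f^n] with small primitive is
    tested by the variation, the bounded error by the mass. [K] depends on [n] through the lengths
    of the laps. *)
Lemma Lasota_Yorke n : exists2 K, 0 <= K & forall T M V, func_lin a b T ->
  func_bd a b T M -> func_var a b T V ->
  func_var a b (fun q => T (fun t => q (iter n f t))) (4 * th ^+ n * V + K * M).
Proof.
have ab := ex_ab.
have [K K0 hK] := chain_small (lap_chain n (lexx a) (lexx b) ab) (lexx a) (lexx b).
exists K => // T M V lT bT vT p C bp hp.
have [r [br rK r0 rC]] := hK p C bp hp.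
have bi := bmeas_iter n bp.
rewrite (_ : T _ = T (fun t => p (iter n f t) - r t) + T r); last first.
  by rewrite -(funcD lT) //; [congr T; apply/funext => t; rewrite subrK|exact: bmeasB].
apply: le_trans (ler_normD _ _) _; rewrite mulrDl lerD //.
  have := vT _ _ (bmeasB bi br) rC.
  by rewrite mulrC (mulrAC _ _ V) => /le_trans; apply; rewrite mulrAC.
by have := bT _ _ br rK; rewrite mulrCA mulrA.
Qed.

End expanding.

(** * The spectral gap *)

Section minorization.
Context {R : realType}.
Implicit Types (x y z s t u v k K L C M N V : R) (q Q p P : R -> R) (n i j : nat).
Implicit Types (T : (R -> R) -> R).
Variables (a b : R).
Hypothesis ab : a < b.

Definition func_pos T := forall q, bmeas a b q ->
  (forall t, a <= t <= b -> 0 <= q t) -> 0 <= T q.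

Lemma func_pos_le T p q : func_lin a b T -> func_pos T -> bmeas a b p -> bmeas a b q ->
  (forall t, a <= t <= b -> p t <= q t) -> T p <= T q.
Proof.
move=> lT pT bp bq h; rewrite -subr_ge0 -(funcB lT) //.
by apply: pT => [|t ht]; [exact: bmeasB|rewrite subr_ge0 h].
Qed.

Lemma func_pos_bd T : func_lin a b T -> func_pos T -> func_bd a b T (T (fun=> 1)).
Proof.
move=> lT pT q K bq qK.
have b1 : bmeas a b (fun=> 1) by exact: bmeas_cst.
have e : T (fun=> K * 1) = T (fun=> 1) * K.
  by rewrite (funcZ K lT b1) mulrC.
have bK : bmeas a b (fun=> K * 1) by exact: bmeas_cst.
rewrite -e ler_norml; apply/andP; split; last first.
  by apply: func_pos_le => // t /qK h; rewrite mulr1; exact: le_trans (ler_norm _) h.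
rewrite -mulN1r -(funcZ _ lT) //.
apply: func_pos_le => //; first exact: bmeasZ.
by move=> t /qK; rewrite mulr1 mulN1r ler_norml => /andP[].
Qed.

Variables (T : (R -> R) -> R) (V m0 eta : R).
Hypotheses (lT : func_lin a b T) (pT : func_pos T) (vT : func_var a b T V).

(* [T >= m0 * Lebesgue] fails on [[x, y]]. *)
Definition deficient x y := exists q, [/\ bmeas a b q,
  forall t, a <= t <= b -> 0 <= q t & T q < m0 * Int x y q].

Definition thin x y := [/\ a <= x, y <= b, y - x <= eta & deficient x y].

(** The witness of each deficient cell is cut off outside of it and scaled to have the length of the
    cell as its integral. For the sum [s], the primitive of [1 - s] returns to zero at every node
    and so never exceeds the mesh [eta]. *)
Lemma deficient_chain x y : 0 <= m0 -> chain thin x y -> a <= x /\ y <= b /\ exists s : R -> R,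
  [/\ bmeas a b s, forall t, t < x \/ y <= t -> s t = 0,
      T s < m0 * (y - x), Int x y (fun t => 1 - s t) = 0 &
      forall t, x <= t <= y -> `|Int x t (fun t => 1 - s t)| <= eta].
Proof.
move=> m00; elim=> [{}x {}y xy [ax yb yx [q [bq q0 Tq]]]|{}x y' {}y c1 [ax [_ IH1]] c2 [_ [yb IH2]]].
  split => //; split => //.
  have iq : intg x y q by apply: intgS (bmeas_intg bq).
  have q0' t : x <= t <= y -> 0 <= q t.
    by move=> /andP[xt ty]; apply: q0; rewrite (le_trans ax) // (le_trans ty).
  have I0 : 0 < Int x y q.
    rewrite lt_neqAle Int_ge0 // andbT; apply/eqP => I0.
    by move: Tq; rewrite -I0 mulr0 ltNge pT.
  pose k := (y - x) / Int x y q.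
  have k0 : 0 < k by rewrite divr_gt0 // subr_gt0.
  (* The indicator of the half-open interval from [x] to [y], so that neighbouring cells meet
     without overlap. *)
  pose chi t : R := if t <= x then (if x <= t then 1 else 0) else (if y <= t then 0 else 1).
  have b01 z : bmeas a b (fun t => if z <= t then 0 else 1 : R).
    have [m [K hK]] := bmeas_if z (bmeas_cst a b (1 : R)) (bmeas_cst a b (0:R)).
    split; last by exists 1 => t _; case: ifP => _; rewrite ?normr0 ?normr1.
    apply: measurable_fun_if => //; exact: measurable_fun_ler.
  have b10 z : bmeas a b (fun t => if z <= t then 1 else 0 : R).
    split; last by exists 1 => t _; case: ifP => _; rewrite ?normr0 ?normr1.
    apply: measurable_fun_if => //; exact: measurable_fun_ler.
  have bchi : bmeas a b chi by apply: bmeas_if.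
  have chi01 t : 0 <= chi t <= 1 by rewrite /chi; do !case: ifP => _; rewrite ?lexx ?ler01.
  have chiE t : x < t < y -> chi t = 1.
    by move=> /andP[xt ty]; rewrite /chi [t <= x]leNgt xt [y <= t]leNgt ty.
  pose s t := k * (chi t * q t).
  have bs : bmeas a b s by apply: bmeasZ; exact: bmeasM.
  have Is t : x <= t <= y -> Int x t s = k * Int x t q.
    move=> /andP[xt ty]; rewrite -IntZ; last exact: intgS iq.
    by apply: Int_oo => u /andP[xu ut]; rewrite /s chiE ?mul1r // xu (lt_le_trans ut).
  have Iy : Int x y s = y - x.
    by rewrite Is ?lexx ?ltW // /k divfK // gt_eqF.
  have js : intg x y s by apply: intgS (bmeas_intg bs).
  have I1 t : x <= t <= y -> Int x t (fun t => 1 - s t) = t - x - Int x t s.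
    move=> /andP[xt ty]; rewrite IntB ?Int_cst ?mul1r //; first exact: intg_cst.
    exact: intgS js.
  exists s; split => //.
  - move=> t; rewrite /s /chi => -[tx|yt].
      by rewrite (ltW tx) leNgt tx mul0r mulr0.
    by rewrite leNgt (lt_le_trans xy yt) yt mul0r mulr0.
  - apply: (@le_lt_trans _ _ (k * T q)).
      rewrite -(funcZ _ lT) //; apply: func_pos_le => //; first exact: bmeasZ.
      move=> t abt; rewrite ler_pM2l // ler_piMl ?q0 //.
      by have /andP[] := chi01 t.
    by rewrite mulrC /k mulrA ltr_pdivrMr // mulrAC ltr_pM2r // subr_gt0.
  - by rewrite I1 ?lexx ?(ltW xy) // Iy subrr.
  - move=> t txy; rewrite I1 //; have /andP[xt ty] := txy.
    have s0 u : x <= u <= y -> 0 <= s u.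
      move=> ux; rewrite mulr_ge0 ?(ltW k0) // mulr_ge0 ?q0' //.
      by have /andP[] := chi01 u.
    have h1 : 0 <= Int x t s.
      by apply: Int_ge0 => u /andP[xu ut]; rewrite s0 // xu (le_trans ut).
    have h2 : 0 <= Int t y s.
      by apply: Int_ge0 => u /andP[xu ut]; rewrite s0 // ut (le_trans xt).
    have := @Int_cat _ t x y s xt ty js; rewrite Iy => h3.
    by rewrite ler_norml; apply/andP; split; lra.
case: IH1 => s1 [b1 z1 T1 I1 e1]; case: IH2 => s2 [b2 z2 T2 I2 e2].
have xy' := chain_lt c1; have y'y := chain_lt c2.
split => //; split => //.
pose s t := s1 t + s2 t.
have bs : bmeas a b s by exact: bmeasD.
have iss : intg x y (fun t => 1 - s t).
  by apply: bmeas_intg; apply: bmeasB; [exact: bmeas_cst|exact: bmeasS bs].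
have f1 t : x <= t -> t <= y' -> Int x t (fun t => 1 - s t) = Int x t (fun t => 1 - s1 t).
  move=> xt ty; apply: Int_oo => u /andP[_ ut].
  by rewrite /s (z2 u) ?addr0 //; left; exact: lt_le_trans ty.
have f2 t : y' <= t -> Int y' t (fun t => 1 - s t) = Int y' t (fun t => 1 - s2 t).
  move=> yt; apply: eq_Int => u /andP[ut _].
  by rewrite /s (z1 u) ?add0r //; right.
exists s; split => //.
- move=> t [tx|yt]; rewrite /s ?z1 ?z2 ?addr0 //; [by left; apply: lt_trans xy'|by left|by right|].
  by right; apply: le_trans yt; exact: ltW.
- by rewrite (funcD lT) //; move: T1 T2; rewrite !mulrBr; lra.
- by rewrite (@Int_cat _ y') ?(ltW xy') ?(ltW y'y) // f1 ?f2 ?I1 ?I2 ?addr0 // ltW.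
- move=> t /andP[xt ty]; have [ty'|y't] := leP t y'; first by rewrite f1 // e1 // xt.
  rewrite (@Int_cat _ y') ?(ltW xy') ?(ltW y't) //; last exact: intgS iss.
  by rewrite f1 ?f2 ?(ltW xy') ?(ltW y't) // I1 add0r e2 // (ltW y't).
Qed.

(** Otherwise [T 1 = T s + T (1 - s) < m0 * (b - a) + V * eta <= T 1]. *)
Lemma not_deficient : 0 <= m0 -> m0 * (b - a) <= T (fun=> 1) / 2 ->
  V * eta <= T (fun=> 1) / 2 -> ~ chain thin a b.
Proof.
move=> m00 h1 h2 /(deficient_chain m00)[_ [_ [s [bs _ Ts _ se]]]].
have b1 : bmeas a b (fun=> 1) by exact: bmeas_cst.
have := vT (bmeasB b1 bs) se; rewrite (funcB lT) // => h.
have := le_trans (ler_norm _) h; lra.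
Qed.

End minorization.

Section gap.
Context {R : realType}.
Implicit Types (x y z s t u v k K L C M N V : R) (q Q p P : R -> R) (n i j : nat).
Implicit Types (T : (R -> R) -> R) (e : bool).
Variables (a c b th : R) (f : R -> R) (w dw : bool -> R -> R).
Hypothesis ex : expanding a c b th f w dw.
Notation lo := (blo a c).
Notation hi := (bhi c b).

Let ab : a < b. Proof. exact: ex_ab ex. Qed.

Definition grid n i := a + i%:R * (b - a) / n.+1%:R.

Lemma grid_0 n : grid n 0 = a.
Proof. by rewrite /grid !mul0r addr0. Qed.

Lemma gridn n : grid n n.+1 = b.
Proof. by rewrite /grid mulrAC divff ?pnatr_eq0 // mul1r addrC subrK. Qed.

Lemma grid_step n i : grid n i.+1 - grid n i = (b - a) / n.+1%:R.
Proof. by rewrite /grid -(addn1 i) natrD; ring. Qed.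

Lemma grid_lt n i : grid n i < grid n i.+1.
Proof. by rewrite -subr_gt0 grid_step divr_gt0 // subr_gt0. Qed.

Lemma grid_ab n i : (i <= n.+1)%N -> a <= grid n i <= b.
Proof.
move=> ni; rewrite /grid lerDl divr_ge0 ?ler0n ?mulr_ge0 ?ler0n ?subr_ge0 ?(ltW ab) //=.
rewrite -lerBrDl ler_pdivrMr ?ltr0n // mulrC ler_pM2l ?subr_gt0 //.
by rewrite ler_nat.
Qed.

(** A positive functional dominates a multiple of Lebesgue measure on some cell of the grid. The
    admissible mesh depends only on the ratio of variation to mass, so one grid serves a whole
    [cone]. *)
Lemma minor n T V : func_lin a b T -> func_pos a b T -> func_var a b T V ->
  V * ((b - a) / n.+1%:R) <= T (fun=> 1) / 2 ->
  exists2 i, (i <= n)%N & forall q, bmeas a b q ->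
    (forall t, a <= t <= b -> 0 <= q t) ->
    T (fun=> 1) / (2 * (b - a)) * Int (grid n i) (grid n i.+1) q <= T q.
Proof.
move=> lT pT vT hV; have T1 : 0 <= T (fun=> 1) by apply: pT => //; exact: bmeas_cst.
pose m0 := T (fun=> 1) / (2 * (b - a)).
have m00 : 0 <= m0 by rewrite divr_ge0 // mulr_ge0 // subr_ge0 ltW.
apply: contrapT => H.
apply: (not_deficient lT pT vT m00 _ hV).
  by rewrite /m0 invfM mulrA mulfVK // gt_eqF // subr_gt0.
have D i : (i <= n)%N -> thin a b T m0 ((b - a) / n.+1%:R) (grid n i) (grid n i.+1).
  move=> ni; have /andP[ai ib] := grid_ab (leqW ni).
  have /andP[ai' ib'] := @grid_ab n i.+1 ni.
  split => //; first by rewrite grid_step.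
  apply: contrapT => nd; apply: H; exists i => // q bq q0.
  rewrite leNgt; apply/negP => h; apply: nd; exists q; split => //.
have ch i : (i <= n)%N -> chain (thin a b T m0 ((b - a) / n.+1%:R)) (grid n 0) (grid n i.+1).
  elim: i => [_|i IH ni]; first by apply: chain1; [exact: grid_lt|exact: D].
  apply: chainD (IH (ltnW ni)) _; apply: chain1; [exact: grid_lt|exact: D].
by have := ch n (leqnn n); rewrite grid_0 gridn.
Qed.

(** Substitution on one branch, with [dl] the inverse of an upper bound for [|f'|]. Iterated by
    [push], it turns the covering of an interval under [f^n] into a lower bound for the mass that
    arrives there. *)
Lemma push1 : exists2 dl, 0 < dl & forall x y, a <= x -> x <= y -> y <= b ->
  exists u v, [/\ a <= u, v <= b, forall t, x <= t <= y -> u <= f t <= v &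
  forall q, bmeas a b q -> (forall t, a <= t <= b -> 0 <= q t) ->
    dl * Int u v q <= Int x y (q \o f)].
Proof.
have [_ [D1 hD1]] := ex_bf ex true; have [_ [D2 hD2]] := ex_bf ex false.
pose D := `|D1| + `|D2| + 1.
have D0 : 0 < D by rewrite ltr_wpDl // addr_ge0.
have hD e t : lo e <= t <= hi e -> `|(w e t)^-1| <= D.
  case: e => [/hD1|/hD2] h; apply: le_trans h _; rewrite /D.
    by have := ler_norm D1; have := normr_ge0 D2; lra.
  by have := ler_norm D2; have := normr_ge0 D1; lra.
exists D^-1 => [|x y ax xy yb]; first by rewrite invr_gt0.
have one e x' y' : lo e <= x' -> x' <= y' -> y' <= hi e ->
    forall q, bmeas a b q -> (forall t, a <= t <= b -> 0 <= q t) ->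
    D^-1 * Int (flo e (f x') (f y')) (flo e (f y') (f x')) q <= Int x' y' (q \o f).
  move=> lx xy' yh q bq q0; have [la [hb _]] := ex_lohi ex e.
  have sub t : x' <= t <= y' -> lo e <= t <= hi e.
    by move=> /andP[xt ty]; rewrite (le_trans lx xt) (le_trans ty yh).
  have fab t : lo e <= t <= hi e -> a <= f t <= b.
    by move=> /andP[h1 h2]; apply: (ex_map ex); rewrite (le_trans la h1) (le_trans h2 hb).
  have mf := monotS lx yh (ex_mono ex e).
  have iq : intg (flo e (f x') (f y')) (flo e (f y') (f x')) q.
    apply: intgS (bmeas_intg bq).
      have /andP[h _] : a <= f x' <= b by apply: fab; apply: sub; rewrite lexx.
      have /andP[h' _] : a <= f y' <= b by apply: fab; apply: sub; rewrite lexx andbT.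
      by case: (e).
    have /andP[_ h] : a <= f x' <= b by apply: fab; apply: sub; rewrite lexx.
    have /andP[_ h'] : a <= f y' <= b by apply: fab; apply: sub; rewrite lexx andbT.
    by case: (e).
  have p0 t : x' <= t <= y' -> 0 <= sgb e (w e t)^-1 by move=> /sub /(ex_inv0 ex).
  rewrite (Int_subst xy' mf (ex_prim_f ex lx yh) p0 iq).
  have iqf : intg x' y' (q \o f).
    apply: bmeas_intg; apply: bmeasS (bmeas_comp_f ex bq).
      exact: le_trans la lx.
    exact: le_trans yh hb.
  rewrite mulrC ler_pdivrMr // mulrC -IntZ //.
  apply: le_Int; [exact: intg_subst mf (ex_prim_f ex lx yh) p0 iq|exact: intgZ|].
  move=> t xt; rewrite mulrC; apply: ler_wpM2r; first by apply: q0; apply: fab; exact: sub.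
  apply: le_trans (hD e t (sub t xt)).
  by rewrite -[X in X <= _](ger0_norm (p0 _ xt)); case: (e); rewrite /= ?normrN.
have gen x' y' q : x <= x' -> x' <= y' -> y' <= y -> bmeas a b q ->
    (forall t, a <= t <= b -> 0 <= q t) -> Int x' y' (q \o f) <= Int x y (q \o f).
  move=> xx xy' yy bq q0.
  have iq : intg x y (q \o f) by apply: bmeas_intg; apply: bmeasS (bmeas_comp_f ex bq).
  have z t : x <= t <= y -> 0 <= (q \o f) t.
    move=> /andP[xt ty]; apply: q0; apply: (ex_map ex).
    by rewrite (le_trans ax xt) (le_trans ty yb).
  rewrite (@Int_cat _ x' x y) //; last exact: le_trans yy.
  rewrite (@Int_cat _ y' x' y) //; last exact: intgS iq.
  have h1 : 0 <= Int x x' (q \o f).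
    by apply: Int_ge0 => t /andP[xt tx]; rewrite z // xt (le_trans tx (le_trans xy' yy)).
  have h2 : 0 <= Int y' y (q \o f).
    by apply: Int_ge0 => t /andP[xt tx]; rewrite z // tx (le_trans _ xt) // (le_trans xx).
  lra.
have /andP[ac cb] := ex_acb ex.
have fa t : a <= t -> t <= b -> a <= f t /\ f t <= b.
  by move=> at_ tb; apply/andP; apply: (ex_map ex); rewrite at_.
have [yc|cy] := leP y c.
  have mf := monotS (ax : lo true <= x) (yc : y <= hi true) (ex_mono ex true).
  exists (f x), (f y); split.
  - by have [] := fa x ax (le_trans xy yb).
  - by have [] := fa y (le_trans ax xy) yb.
  - by move=> t /(monot_itv mf).
  - exact: (one true).
have [cx|xc] := leP c x.
  have mf := monotS (cx : lo false <= x) (yb : y <= hi false) (ex_mono ex false).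
  exists (f y), (f x); split.
  - by have [] := fa y (le_trans ax xy) yb.
  - by have [] := fa x ax (le_trans xy yb).
  - by move=> t /(monot_itv mf).
  - exact: (one false).
have mf1 := monotS (ax : lo true <= x) (lexx c : c <= hi true) (ex_mono ex true).
have mf2 := monotS (lexx c : lo false <= c) (yb : y <= hi false) (ex_mono ex false).
have fac : a <= f c <= b by apply/andP; apply: fa; exact: ltW.
have fax : a <= f x <= b by apply/andP; apply: fa => //; exact: le_trans yb.
have fay : a <= f y <= b by apply/andP; apply: fa => //; exact: le_trans xy.
(* When [c] lies inside, the images of the two halves both end at [f c] and are therefore nested;
   the half with the longer image suffices. *)
have [fxy|fyx] := leP (f x) (f y).
  exists (f x), (f c); split; [by case/andP: fax|by case/andP: fac| |].
  - move=> t /andP[xt ty]; have [tc|ct] := leP t c.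
      by apply: (monot_itv mf1); rewrite xt.
    have /andP[h1 h2] : f y <= f t <= f c by apply: (monot_itv mf2); rewrite ltW.
    by rewrite h2 (le_trans fxy).
  - move=> q bq q0; apply: le_trans (gen x c q (lexx x) (ltW xc) (ltW cy) bq q0).
    exact: (one true x c ax (ltW xc) (lexx c) q bq q0).
exists (f y), (f c); split; [by case/andP: fay|by case/andP: fac| |].
- move=> t /andP[xt ty]; have [tc|ct] := leP t c.
    have /andP[h1 h2] : f x <= f t <= f c by apply: (monot_itv mf1); rewrite xt.
    by rewrite h2 (le_trans (ltW fyx)).
  by apply: (monot_itv mf2); rewrite ltW.
- move=> q bq q0; apply: le_trans (gen c y q (ltW xc) (ltW cy) (lexx y) bq q0).
  exact: (one false c y (lexx c) (ltW cy) yb q bq q0).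
Qed.

Definition covers n x y z0 z1 :=
  forall z, z0 <= z <= z1 -> exists2 t, x <= t <= y & iter n f t = z.

Lemma push n : exists2 dl, 0 < dl & forall x y z0 z1, a <= x -> x <= y -> y <= b ->
  a <= z0 -> z0 <= z1 -> z1 <= b -> covers n x y z0 z1 ->
  forall q, bmeas a b q -> (forall t, a <= t <= b -> 0 <= q t) ->
    dl * Int z0 z1 q <= Int x y (fun t => q (iter n f t)).
Proof.
elim: n => [|n [d d0 IH]].
  exists 1 => // x y z0 z1 ax xy yb az0 zz zb1 cov q bq q0; rewrite mul1r.
  have [|t1 /andP[xt1 _] /= e1] := cov z0; first by rewrite lexx.
  have [|t2 /andP[_ yt2] /= e2] := cov z1; first by rewrite lexx zz.
  move: xt1 yt2; rewrite e1 e2 => xz zy.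
  have iq : intg x y q by apply: bmeas_intg; apply: bmeasS bq.
  have z t : x <= t <= y -> 0 <= q t.
    by move=> /andP[xt ty]; apply: q0; rewrite (le_trans ax xt) (le_trans ty yb).
  rewrite (@Int_cat _ z0 x y) //; last exact: le_trans zy.
  rewrite (@Int_cat _ z1 z0 y) //; last exact: intgS iq.
  have h1 : 0 <= Int x z0 q.
    by apply: Int_ge0 => t /andP[xt tx]; rewrite z // xt (le_trans tx (le_trans zz zy)).
  have h2 : 0 <= Int z1 y q.
    by apply: Int_ge0 => t /andP[xt tx]; rewrite z // tx (le_trans _ xt) // (le_trans xz).
  lra.
have [d1 d10 h1] := push1.
exists (d1 * d) => [|x y z0 z1 ax xy yb az0 zz zb1 cov q bq q0]; first exact: mulr_gt0.
have [u [v [au vb uv hq]]] := h1 x y ax xy yb.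
have uv' : u <= v.
  by have /andP[h2 h3] : u <= f x <= v; [apply: uv; rewrite lexx|exact: le_trans h3].
have cov' : covers n u v z0 z1.
  move=> z zj; have [t txy tz] := cov z zj.
  by exists (f t); [exact: uv|rewrite -iterSr].
have bqn := bmeas_iter ex n bq.
have e : Int x y ((fun t => q (iter n f t)) \o f) = Int x y (fun t => q (iter n.+1 f t)).
  by apply: eq_Int => t _; rewrite /= -iterSr.
rewrite -e; apply: le_trans (hq _ bqn _); last by move=> t /(ex_iter ex n) /q0.
by rewrite -mulrA ler_pM2l //; exact: IH.
Qed.

Hypothesis topo : exists z0 z1, [/\ a <= z0, z0 < z1, z1 <= b &
  forall x y, a <= x -> x < y -> y <= b ->
    exists n0, forall n, (n0 <= n)%N -> covers n x y z0 z1].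

Lemma exp_small r k : 0 <= r < 1 -> 0 < k -> exists n, r ^+ n <= k.
Proof.
move=> /andP[r0 r1] e0.
have /cvgrPdist_le /(_ _ e0)[n _ h] : (r ^+ n)%R @[n --> \oo] --> (0 : R).
  by apply: cvg_expr; rewrite ger0_norm.
exists n; have := h n (leqnn n).
by rewrite sub0r normrN ger0_norm // exprn_ge0.
Qed.

Lemma lin_iter n T : func_lin a b T -> func_lin a b (fun q => T (fun t => q (iter n f t))).
Proof. by move=> lT h p q bp bq; rewrite -(lT h) //; exact: (bmeas_iter ex). Qed.

Lemma bd_iter n T M : func_bd a b T M -> func_bd a b (fun q => T (fun t => q (iter n f t))) M.
Proof.
move=> bT q K bq qK; apply: bT; first exact: (bmeas_iter ex).
by move=> t /(ex_iter ex n) /qK.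
Qed.

(** The contraction rate is at most 1/2, so the errors [K1 * M] form a geometric series with sum at
    most [2 * K1 * M]; the mass bound is preserved throughout. *)
Lemma iter_var n K1 : 4 * th ^+ n <= 1 / 2 -> 0 <= K1 ->
  (forall T M V, func_lin a b T -> func_bd a b T M -> func_var a b T V ->
    func_var a b (fun q => T (fun t => q (iter n f t))) (4 * th ^+ n * V + K1 * M)) ->
  forall i T M V, func_lin a b T -> func_bd a b T M -> func_var a b T V ->
    func_var a b (fun q => T (fun t => q (iter (i * n) f t)))
      ((1 / 2) ^+ i * V + 2 * K1 * M).
Proof.
move=> hn K10 LY i T M V lT bT vT.
have M0 := func_bd_ge0 bT; have V0 := func_var_ge0 vT.
have KM0 : 0 <= K1 * M by rewrite mulr_ge0.
elim: i => [|i IH].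
  apply: func_varW vT => //; rewrite expr0; lra.
have := LY _ _ _ (lin_iter (i * n) lT) (bd_iter (i * n) bT) IH.
have -> : (fun q => T (fun t => q (iter n f (iter (i * n) f t)))) =
          (fun q => T (fun t => q (iter (i.+1 * n) f t))).
  by apply/funext => q; congr T; apply/funext => t; rewrite mulSn iterD.
apply: func_varW => //.
set W := _ + 2 * K1 * M.
have W0 : 0 <= W.
  by rewrite addr_ge0 ?mulr_ge0 // exprn_ge0 //; lra.
have : 4 * th ^+ n * W <= 1 / 2 * W by rewrite ler_wpM2r.
by move=> h; apply: le_trans (lerD h (lexx _)) _; rewrite /W exprS; lra.
Qed.

Definition cone K m T :=
  [/\ func_lin a b T, func_pos a b T, T (fun=> 1) = m & func_var a b T (K * m)].

(** Doeblin's argument: after [N] steps every functional of the cone dominates the same multiple,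
    relative to its mass, of Lebesgue measure on [[z0, z1]]. Removing this part leaves a functional
    of the same cone with a smaller mass. *)
Lemma cone_step : exists K (N : nat) rho z0 z1 dl, [/\ 2 / (b - a) <= K, (0 < N)%N, 0 < rho < 1 &
  forall m T, cone K m T ->
    cone K (rho * m) (fun q => T (fun t => q (iter N f t)) - dl * m * Int z0 z1 q)].
Proof.
have [z0 [z1 [az0 zz zb1 cov]]] := topo.
have /andP[th0 th1] := ex_th ex.
have ba0 : 0 < b - a by rewrite subr_gt0.
have [n0 hn0] : exists n, th ^+ n <= 1 / 8 by apply: exp_small; rewrite ?(ltW th0) //; lra.
have n0P : (0 < n0)%N by case: n0 hn0 => //; rewrite expr0; lra.
have hn : 4 * th ^+ n0 <= 1 / 2 by lra.
have [K1 K10 LY] := Lasota_Yorke ex n0.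
(* At most half of [K * m] survives the iteration, and at least three quarters are allowed
   afterwards. The remaining quarter must absorb [2 * K1 * m] from the iteration and [2 * m] from
   the removed part. The last summand admits the comparison functionals of [spectral_gap]. *)
pose K := 8 * K1 + 8 + 2 / (b - a).
have i2 : 0 <= 2 / (b - a) by rewrite divr_ge0 // ltW.
have K0 : 0 < K by rewrite /K; lra.
have K8 : 8 * K1 + 8 <= K by rewrite /K; lra.
have K2 : 2 / (b - a) <= K by rewrite /K; lra.
clearbody K.
pose np := Num.bound (2 * K * (b - a)).
have hnp : K * ((b - a) / np.+1%:R) <= 1 / 2.
  rewrite mulrA ler_pdivrMr ?ltr0n //.
  have : 2 * K * (b - a) < np%:R.
    by have := @archi_boundP R (2 * K * (b - a)); apply; rewrite mulr_ge0 ?mulr_ge0 // ltW.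
  rewrite -[2 * K * _]mulrA mul1r [2^-1 * _]mulrC ler_pdivlMr // [_ * 2]mulrC => h.
  by apply: le_trans (ltW h) _; rewrite ler_nat.
have /choice[g hg] : forall i, exists n1, (i <= np)%N -> forall n, (n1 <= n)%N ->
    covers n (grid np i) (grid np i.+1) z0 z1.
  move=> i; have [ni|ni] := leqP i np; last by exists 0%N.
  have /andP[h1 _] := grid_ab (leqW ni); have /andP[_ h2] := @grid_ab np i.+1 ni.
  by have [n1 hn1] := cov _ _ h1 (grid_lt np i) h2; exists n1 => _.
pose M := \max_(i < np.+1) g i.
(* A positive multiple of [n0], for the contraction of the variation, and at least every covering
   time [g i], for all cells at once. *)
pose N := (M.+1 * n0)%N.
have [d0 d00 hd] := push N.
(* The three bounds serve the variation of the removed part, the positivity of what remains, and a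
   loss of at most a quarter of the mass. *)
pose dl := Num.min 1 (Num.min (d0 / (2 * (b - a))) (1 / (4 * (z1 - z0)))).
have z10 : 0 < z1 - z0 by rewrite subr_gt0.
have dl0 : 0 < dl by rewrite !lt_min ltr01 !divr_gt0 // mulr_gt0.
have dl1 : dl <= 1 by rewrite ge_min lexx.
have dl2 : dl <= d0 / (2 * (b - a)) by rewrite !ge_min lexx orbT.
have dl3 : dl * (z1 - z0) <= 1 / 4.
  have : dl <= 1 / (4 * (z1 - z0)) by rewrite !ge_min lexx !orbT.
  by rewrite ler_pdivlMr ?mulr_gt0 //; lra.
have dl4 : 0 < dl * (z1 - z0) by rewrite mulr_gt0.
clearbody dl.
pose rho := 1 - dl * (z1 - z0).
exists K, N, rho, z0, z1, dl; split.
- by [].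
- by rewrite muln_gt0.
- by rewrite /rho; lra.
move=> m T [lT pT T1 vT].
have m0 : 0 <= m by rewrite -T1; apply: pT => //; exact: bmeas_cst.
have iz q : bmeas a b q -> intg z0 z1 q by move=> bq; apply: intgS (bmeas_intg bq).
have bT : func_bd a b T m by rewrite -T1; exact: func_pos_bd.
split.
- move=> k p q bp bq; rewrite (lin_iter N lT) // IntD; [|exact: intgZ (iz _ bp)|exact: iz].
  by rewrite IntZ; [ring|exact: iz].
- move=> q bq q0; have [|i ni hi_] := @minor np T _ lT pT vT.
    rewrite T1 [K * m]mulrC -mulrA; apply: le_trans (ler_wpM2l m0 hnp) _.
    by rewrite mul1r.
  have bqN := bmeas_iter ex N bq.
  have qN0 t : a <= t <= b -> 0 <= q (iter N f t) by move=> /(ex_iter ex N) /q0.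
  have h1 := hi_ _ bqN qN0.
  have gN : (g i <= N)%N.
    have gM : (g i <= M)%N by exact: (@leq_bigmax _ (fun j : 'I_np.+1 => g j) (Ordinal (ni : (i < np.+1)%N))).
    apply: leq_trans gM _; apply: leq_trans (leqnSn M) _.
    by rewrite /N leq_pmulr.
  have /andP[g1 _] := grid_ab (leqW ni); have /andP[_ g2] := @grid_ab np i.+1 ni.
  have h2 := hd _ _ _ _ g1 (ltW (grid_lt np i)) g2 az0 (ltW zz) zb1 (hg i ni N gN) q bq q0.
  rewrite subr_ge0; apply: le_trans h1; rewrite T1.
  have mm : 0 <= m / (2 * (b - a)) by rewrite divr_ge0 // mulr_ge0 // ltW.
  apply: le_trans (ler_wpM2l mm h2).
  have I0 : 0 <= Int z0 z1 q.
    by apply: Int_ge0 => t /andP[zt tz]; apply: q0; rewrite (le_trans az0) // (le_trans tz).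
  rewrite mulrA ler_wpM2r // [dl * m]mulrC -mulrA ler_wpM2l //.
  by rewrite [X in _ <= X]mulrC.
- by rewrite T1 Int_cst ?ltW // /rho; ring.
- have v1 := iter_var hn K10 LY (M.+1) lT bT vT.
  move=> p C bp hp; have C0 : 0 <= C by apply: le_trans (hp a _); rewrite // lexx ltW.
  apply: le_trans (ler_normB _ _) _.
  have /= h1 := v1 p C bp hp.
  have h2 : `|Int z0 z1 p| <= 2 * C.
    have az1 : a <= z1 := le_trans az0 (ltW zz).
    have e := @Int_cat _ z0 a z1 p az0 (ltW zz) (intgS (lexx a) zb1 (bmeas_intg bp)).
    have -> : Int z0 z1 p = Int a z1 p - Int a z0 p by rewrite e; ring.
    apply: le_trans (ler_normB _ _) _.
    have := hp z1; rewrite az1 zb1 => /(_ isT); have := hp z0.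
    by rewrite az0 (le_trans (ltW zz) zb1) => /(_ isT); lra.
  have h3 : `|dl * m * Int z0 z1 p| <= m * (2 * C).
    rewrite normrM ger0_norm ?(mulr_ge0 (ltW dl0)) //; apply: ler_pM => //.
      by rewrite mulr_ge0 // ltW.
    by rewrite ler_piMl.
  have h4 : (1 / 2) ^+ M.+1 * (K * m) <= 1 / 2 * (K * m).
    rewrite ler_wpM2r ?mulr_ge0 ?(ltW K0) // exprS ler_piMr //.
    by rewrite exprn_ile1 //; lra.
  apply: le_trans (lerD h1 h3) _; rewrite [m * (2 * C)]mulrA -mulrDl ler_wpM2r //.
  have h5 : K * (rho * m) >= K * m * (3 / 4).
    have r34 : 3 / 4 <= rho by rewrite /rho; lra.
    have -> : K * (rho * m) = K * m * rho by ring.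
    by rewrite ler_wpM2l ?mulr_ge0 ?(ltW K0).
  apply: le_trans _ h5.
  have : m * (8 * K1 + 8) <= m * K by rewrite ler_wpM2l.
  by move: h4; lra.
Qed.

(** Functionals of equal mass have the same part removed by [cone_step], so it cancels in their
    difference and the mass that is left bounds the rest. *)
Lemma coupling K (N : nat) rho z0 z1 dl : 0 < rho < 1 ->
  (forall m T, cone K m T ->
    cone K (rho * m) (fun q => T (fun t => q (iter N f t)) - dl * m * Int z0 z1 q)) ->
  forall i m T1 T2 q C, cone K m T1 -> cone K m T2 -> bmeas a b q ->
    (forall t, a <= t <= b -> `|q t| <= C) ->
    `|T1 (fun t => q (iter (i * N) f t)) - T2 (fun t => q (iter (i * N) f t))|
      <= 2 * rho ^+ i * m * C.
Proof.
move=> rho01 step; elim=> [|i IH] m T1 T2 q C c1 c2 bq qC.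
  have [l1 p1 m1 _] := c1; have [l2 p2 m2 _] := c2.
  have := func_pos_bd l1 p1 bq qC; have := func_pos_bd l2 p2 bq qC.
  rewrite m1 m2 expr0 mul0n => h1 h2; apply: le_trans (ler_normB _ _) _.
  by apply: le_trans (lerD h2 h1) _; lra.
have := IH _ _ _ q C (step _ _ c1) (step _ _ c2) bq qC.
have e T : T (fun t => q (iter (i * N) f (iter N f t))) = T (fun t => q (iter (i.+1 * N) f t)).
  by congr T; apply/funext => t; rewrite mulSn addnC iterD.
rewrite -(e T1) -(e T2) exprSr => h; rewrite [X in X <= _](_ : _ =
  `|T1 (fun t => q (iter (i * N) f (iter N f t))) - dl * m * Int z0 z1 (fun t => q (iter (i * N) f t)) -
    (T2 (fun t => q (iter (i * N) f (iter N f t))) - dl * m * Int z0 z1 (fun t => q (iter (i * N) f t)))|).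
  by apply: le_trans h _; rewrite le_eqVlt; apply/orP; left; apply/eqP; ring.
by congr (`| _ |); ring.
Qed.

Lemma bernoulli_ineq x n : 0 <= x <= 1 -> 1 - n%:R * x <= (1 - x) ^+ n.
Proof.
move=> /andP[x0 x1]; elim: n => [|n IH]; first by rewrite mul0r subr0 expr0.
rewrite exprS; have h : 0 <= 1 - x by lra.
apply: le_trans (ler_wpM2l h IH); rewrite -natr1.
have : 0 <= n%:R * x * x by rewrite !mulr_ge0.
by lra.
Qed.

(** A functional of zero mass is the difference of [T + V * Int] and [V * Int], two elements of the
    cone with the same mass, to which [coupling] applies. *)
Lemma spectral_gap : exists C r, [/\ 0 <= C, 0 < r < 1 &
  forall T N, func a b N T -> T (fun=> 1) = 0 -> forall n q K, bmeas a b q ->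
    (forall t, a <= t <= b -> `|q t| <= K) ->
    `|T (fun t => q (iter n f t))| <= C * N * r ^+ n * K].
Proof.
have [K [N [rho [z0 [z1 [dl [hK N0 rho01 step]]]]]]] := cone_step.
have /andP[rho0 rho1] := rho01.
have ba0 : 0 < b - a by rewrite subr_gt0.
have Nn : 0 < N%:R :> R by rewrite ltr0n.
have N1 : 1 <= N%:R :> R by rewrite ler1n.
(* The Bernoulli inequality gives [rho <= (1 - x) ^+ N], so [1 - x] can replace the [N]-th root of
   [rho] as a rate per single step. *)
pose x := (1 - rho) / N%:R.
have x0 : 0 < x by rewrite divr_gt0 // subr_gt0.
have x1 : x < 1 by rewrite ltr_pdivrMr // mul1r; lra.
pose r := 1 - x.
have rN : rho <= r ^+ N.
  have := @bernoulli_ineq x N; rewrite (ltW x0) (ltW x1) => /(_ isT).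
  by rewrite /x mulrCA divff ?gt_eqF // mulr1 opprB addrC subrK.
have r0 : 0 < r by rewrite subr_gt0.
exists (2 * (b - a) / r ^+ N), r; split.
- by rewrite divr_ge0 ?exprn_ge0 ?mulr_ge0 ?ltW.
- by rewrite r0 /r; lra.
move=> T V [lT bT vT] T1 n q Q bq qQ.
have V0 := func_var_ge0 vT.
have iq p : bmeas a b p -> intg a b p by move=> bp; exact: bmeas_intg.
pose T2 p := V * Int a b p.
have l2 : func_lin a b T2.
  move=> k p p' bp bp'; rewrite /T2 IntD; [|exact/intgZ/iq|exact: iq].
  by rewrite IntZ; [ring|exact: iq].
have c2 : cone K (V * (b - a)) T2.
  split => //.
  - by move=> p bp p0; rewrite mulr_ge0 // Int_ge0.
  - by rewrite /T2 Int_cst ?ltW // mul1r.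
  - move=> p C bp hp; rewrite /T2 normrM ger0_norm // mulrCA -mulrA.
    rewrite ler_wpM2l //; have h := hp b; rewrite lexx ltW // in h.
    apply: le_trans (h isT) _; rewrite ler_peMl //; last first.
      have := hK; rewrite ler_pdivrMr // => ?; lra.
    by apply: le_trans (hp a _); rewrite // lexx ltW.
pose S p := T p + T2 p.
have cS : cone K (V * (b - a)) S.
  split.
  - by move=> k p p' bp bp'; rewrite /S lT // l2 //; ring.
  - move=> p bp p0; rewrite /S.
    pose I := Int a b p.
    have I0 : 0 <= I by exact: Int_ge0.
    pose m := I / (b - a).
    have m0 : 0 <= m by rewrite divr_ge0 // ltW.
    have bm : bmeas a b (fun=> m) by exact: bmeas_cst.
    (* Positivity of [S]: as [T] kills constants, [p] may be replaced by [p - m], whose primitive is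
       at most [I] for [p >= 0]. Hence [T p >= - V * I]. *)
    have e : T p = T (fun t => p t - m).
      rewrite (funcB lT) // (_ : T (fun=> m) = 0) ?subr0 //.
      have := funcZ m lT (bmeas_cst a b 1); rewrite T1 mulr0 => <-.
      by congr T; apply/funext => t; rewrite mulr1.
    have := vT (fun t => p t - m) I (bmeasB bp bm) => /(_ _)/le_trans h.
    rewrite e /T2 -/I -[V * I]opprK subr_ge0 lerNl.
    apply: le_trans (ler_norm _) _; rewrite normrN; apply: vT; first exact: bmeasB.
    move=> t /andP[at_ tb]; rewrite IntB; [|exact: intgS (iq _ bp)|exact: intg_cst].
    rewrite Int_cst //.
    have p1 u : a <= u <= b -> 0 <= p u := p0 u.
    have h1 : 0 <= Int a t p.
      by apply: Int_ge0 => u /andP[au ut]; rewrite p0 // au (le_trans ut).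
    have h2 : 0 <= Int t b p.
      by apply: Int_ge0 => u /andP[au ut]; rewrite p0 // ut (le_trans at_).
    have := @Int_cat _ t a b p at_ tb (iq _ bp); rewrite -/I => h3.
    have h4 : m * (t - a) <= I.
      rewrite /m mulrAC ler_pdivrMr // ler_wpM2l // lerD2r //.
    have h5 : 0 <= m * (t - a) by rewrite mulr_ge0 // subr_ge0.
    by rewrite ler_norml; apply/andP; split; lra.
  - by rewrite /S T1 add0r /T2 Int_cst ?ltW // mul1r.
  - move=> p C bp hp; rewrite /S; apply: le_trans (ler_normD _ _) _.
    have C0 : 0 <= C by apply: le_trans (hp a _); rewrite // lexx ltW.
    have h1 := vT p C bp hp.
    have h2 : `|T2 p| <= V * C.
      rewrite /T2 normrM ger0_norm // ler_wpM2l //.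
      by have := hp b; rewrite lexx ltW // => ->.
    apply: le_trans (lerD h1 h2) _.
    have : 2 * (V * C) <= K * (b - a) * (V * C).
      rewrite ler_wpM2r ?mulr_ge0 // -ler_pdivrMr //.
    by lra.
pose i := (n %/ N)%N; pose j := (n %% N)%N.
have bqj := bmeas_iter ex j bq.
have qj t : a <= t <= b -> `|q (iter j f t)| <= Q by move=> /(ex_iter ex j) /qQ.
have := coupling rho01 step i cS c2 bqj qj.
have e p : (fun t => p (iter j f (iter (i * N) f t))) = (fun t => p (iter n f t)) :> (R -> R).
  by apply/funext => t; rewrite -iterD addnC -divn_eq.
rewrite e /S addrK => /le_trans; apply.
have Q0 : 0 <= Q by apply: le_trans (qQ a _); rewrite // lexx ltW.
rewrite ler_wpM2r //.
have h1 : rho ^+ i * r ^+ N <= r ^+ n.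
  rewrite [X in _ <= r ^+ X](divn_eq n N) -/i -/j exprD mulnC exprM ler_pM ?exprn_ge0 ?(ltW rho0) ?(ltW r0) //.
    by rewrite lerXn2r ?nnegrE ?exprn_ge0 ?(ltW rho0) ?(ltW r0).
  rewrite ler_wiXn2l ?(ltW r0) //; last by rewrite ltnW // ltn_mod.
  by rewrite /r; lra.
have rNp : 0 < r ^+ N by rewrite exprn_gt0.
rewrite -ler_pdivlMr // in h1.
apply: (@le_trans _ _ (2 * (r ^+ n / r ^+ N) * (V * (b - a)))).
  by rewrite ler_wpM2r ?mulr_ge0 ?(ltW ba0) // ler_wpM2l.
by rewrite le_eqVlt; apply/orP; left; apply/eqP; field; rewrite gt_eqF.
Qed.

End gap.

(** * Branches, covering and transfer operator *)

Section derivatives.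
Context {R : realType}.
Implicit Types (A : set R) (f g d : R -> R) (x y t l e : R).

(** Differentiability as a first-order expansion. The point [t] itself is allowed, which avoids
    punctured neighbourhoods and makes restriction to a smaller set immediate. *)
Definition hasd A g t l := forall e, 0 < e -> exists2 dl, 0 < dl &
  forall y, A y -> `|y - t| < dl -> `|g y - g t - l * (y - t)| <= e * `|y - t|.

Lemma hasdS A B g t l : A `<=` B -> hasd B g t l -> hasd A g t l.
Proof. by move=> AB h e /h[dl dl0 hd]; exists dl => // y /AB; exact: hd. Qed.

Lemma eq_hasd A g g' t l : A t -> (forall y, A y -> g y = g' y) ->
  hasd A g t l -> hasd A g' t l.
Proof.
move=> At gg h e /h[dl dl0 hd]; exists dl => // y Ay.
by rewrite -!gg //; exact: hd.
Qed.

Lemma cvg_hasd A g t : cvg (quot_in A g t) -> hasd A g t (deriv_in A g t).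
Proof.
move=> h e e0; rewrite /deriv_in; move: h; rewrite /quot_in.
set l := lim _ => /cvgrPdist_le /(_ _ e0).
rewrite near_withinE /dnbhs near_withinE => /nbhs_ballP[dl /= dl0 hd].
exists dl => // y Ay yt; have [->|nyt] := eqVneq y t.
  by rewrite !subrr mulr0 subrr normr0 mulr0.
have yt0 : y - t != 0 by rewrite subr_eq0.
have := hd y; rewrite /ball /= distrC => /(_ yt nyt Ay) h.
rewrite -ler_pdivrMr ?normr_gt0 // -normfV -normrM mulrBl mulfK // distrC.
exact: h.
Qed.

Lemma hasd_deriv A g t l : (forall e, 0 < e -> exists y, [/\ A y, y != t & `|y - t| < e]) ->
  hasd A g t l -> deriv_in A g t = l.
Proof.
move=> acc h.
have PF : ProperFilter (within A t^').
  apply: Build_ProperFilter.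
  rewrite /within /dnbhs /= => /nbhs_ballP[e /= e0 he].
  have [y [Ay yt ye]] := acc _ e0.
  by apply: (he y) => //; rewrite /ball /= distrC.
rewrite /deriv_in /quot_in; apply: cvg_lim => //.
apply/cvgrPdist_le => e /h[dl dl0 hd].
rewrite near_withinE /dnbhs near_withinE; apply/nbhs_ballP; exists dl => // y /= ty yt Ay.
have yt0 : y - t != 0 by rewrite subr_eq0.
have := hd y Ay; rewrite distrC => /(_ ty) {}h.
rewrite distrC -(mulfK yt0 l) -mulrBl normrM normfV ler_pdivrMr ?normr_gt0 //.
by rewrite (distrC y t).
Qed.

Lemma hasd_cont A g t l : hasd A g t l -> forall e, 0 < e -> exists2 dl, 0 < dl &
  forall y, A y -> `|y - t| < dl -> `|g y - g t| <= e.
Proof.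
move=> h e e0; have [dl dl0 hd] := h 1 ltr01.
have l1 : 0 < `|l| + 1 by rewrite ltr_wpDl.
exists (Num.min dl (e / (`|l| + 1))); first by rewrite lt_min dl0 divr_gt0.
move=> y Ay; rewrite lt_min => /andP[h1 h2].
have := hd y Ay h1; rewrite mul1r => h3.
rewrite ltr_pdivlMr // in h2; apply: le_trans (ltW h2).
rewrite -[g y - g t](subrK (l * (y - t))); apply: le_trans (ler_normD _ _) _.
by rewrite normrM; lra.
Qed.

Lemma hasd_within A g d : (forall t, A t -> hasd A g t (d t)) -> {within A, continuous g}.
Proof.
move=> h; apply/subspace_continuousP => t At.
apply/cvgrPdist_le => e e0; have [dl dl0 hd] := hasd_cont (h t At) e0.
rewrite near_withinE; apply/nbhs_ballP; exists dl => // y /= ty Ay.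
by rewrite distrC; apply: hd => //; rewrite distrC.
Qed.

(** By [Cousin], with one-sided derivatives at the two ends: on a short interval around [u], both
    the increment of [g] and the integral of [d] are close to [d u] times the length. *)
Lemma hasd_prim x y g d : (forall t, x <= t <= y -> hasd `[x, y]%classic g t (d t)) ->
  {within `[x, y], continuous d} -> prim x y g d.
Proof.
move=> h cd; have bd := within_bmeas cd; have id := bmeas_intg bd.
split => // s t xs st ty.
pose E s t := x <= s -> t <= y -> forall e, 0 < e -> `|g t - g s - Int s t d| <= e * (t - s).
suff : forall e, 0 < e -> `|g t - g s - Int s t d| <= e * (t - s).
  move=> H; apply/eqP; rewrite -subr_eq0 -normr_eq0; apply/eqP/le_anti.
  rewrite normr_ge0 andbT; apply/ler_addgt0Pr => e e0; rewrite add0r.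
  have ts0 : 0 < t - s + 1 by rewrite ltr_wpDl // subr_ge0.
  apply: le_trans (H (e / (t - s + 1)) _) _; first by rewrite divr_gt0.
  by rewrite mulrAC ler_pdivrMr // ler_pM2l // lerDl.
suff : E s t by apply.
move=> _ _ e e0.
pose E' s t := x <= s -> t <= y -> `|g t - g s - Int s t d| <= e * (t - s).
suff : E' s t by apply.
apply: (@Cousin _ E') => // [s' u' t' su ut Esu Eut xs' ty'|u /andP[su ut]].
  rewrite (@Int_cat _ u' s' t') //; last exact: intgS id.
  have -> : g t' - g s' - (Int s' u' d + Int u' t' d) =
    (g u' - g s' - Int s' u' d) + (g t' - g u' - Int u' t' d) by ring.
  have -> : e * (t' - s') = e * (u' - s') + e * (t' - u') by ring.
  apply: le_trans (ler_normD _ _) (lerD (Esu xs' _) (Eut _ ty')).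
    exact: le_trans ty'.
  exact: le_trans su.
have uxy : x <= u <= y by rewrite (le_trans xs su) (le_trans ut ty).
have e3 : 0 < e / 2 by rewrite divr_gt0.
have [d1 d10 h1] := h u uxy _ e3.
have /subspace_continuousP /(_ u) := cd; rewrite /= in_itv /= => /(_ uxy).
move/cvgrPdist_le => /(_ _ e3); rewrite near_withinE => /nbhs_ballP[d2 /= d20 h2].
exists (Num.min d1 d2); first by rewrite lt_min d10.
move=> s' t' ss' tt' us' s'u ut' t'u xs' t'y.
have near v : s' <= v <= t' -> `|v - u| < Num.min d1 d2.
  move=> /andP[sv vt]; rewrite ltr_norml; apply/andP; split.
    by rewrite ltrBrDl; exact: lt_le_trans sv.
  by rewrite ltrBlDl; exact: le_lt_trans t'u.
have hv v : s' <= v <= t' -> x <= v <= y /\ `|d v - d u| <= e / 2.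
  move=> svt; have vxy : x <= v <= y.
    by case/andP: svt => p q; rewrite (le_trans xs' p) (le_trans q t'y).
  split => //; have := near _ svt; rewrite lt_min => /andP[_ n2].
  by rewrite distrC; apply: (h2 v); rewrite /ball /= ?in_itv // distrC.
have s't' : s' <= t' by exact: le_trans ut'.
have hg v : s' <= v <= t' -> `|g v - g u - d u * (v - u)| <= e / 2 * `|v - u|.
  move=> svt; have [vxy _] := hv v svt.
  by apply: h1; rewrite /= ?in_itv //; have := near _ svt; rewrite lt_min => /andP[].
have i1 : intg s' t' d by exact: intgS id.
have I1 : `|Int s' t' d - d u * (t' - s')| <= e / 2 * (t' - s').
  rewrite -Int_cst // -IntB //; last exact: intg_cst.
  apply: Int_bound => //; first by apply: intgB => //; exact: intg_cst.
  by move=> v /hv[].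
have st1 : s' <= s' <= t' by rewrite lexx.
have st2 : s' <= t' <= t' by rewrite lexx s't'.
have -> : g t' - g s' - Int s' t' d = (g t' - g u - d u * (t' - u))
   - (g s' - g u - d u * (s' - u)) - (Int s' t' d - d u * (t' - s')) by ring.
apply: le_trans (ler_normB _ _) _; apply: le_trans (lerD (ler_normB _ _) I1) _.
have := hg _ st1; have := hg _ st2; rewrite (ger0_norm (_ : 0 <= t' - u)) ?subr_ge0 //.
rewrite (ler0_norm (_ : s' - u <= 0)) ?subr_le0 //; lra.
Qed.

Lemma hasd_inv A g t l : (forall y, A y -> 1 <= `|g y|) -> A t -> hasd A g t l ->
  hasd A (fun y => (g y)^-1) t (- l * (g t)^-1 * (g t)^-1).
Proof.
move=> g1 At h e e0.
have e2 : 0 < e / 2 by rewrite divr_gt0.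
have [d1 d10 h1] := h _ e2.
have l1 : 0 < `|l| + 1 by rewrite ltr_wpDl.
have e3 : 0 < e / 2 / (`|l| + 1) by rewrite divr_gt0.
have [d2 d20 h2] := hasd_cont h e3.
exists (Num.min d1 d2); first by rewrite lt_min d10.
move=> y Ay; rewrite lt_min => /andP[n1 n2].
have gy := g1 y Ay; have gt_ := g1 t At.
have gy0 : g y != 0 by rewrite -normr_gt0 (lt_le_trans ltr01).
have gt0 : g t != 0 by rewrite -normr_gt0 (lt_le_trans ltr01).
have -> : (g y)^-1 - (g t)^-1 - - l * (g t)^-1 * (g t)^-1 * (y - t) =
  (- (g y - g t - l * (y - t)) + l * (y - t) * ((g y - g t) / g t)) / (g y * g t).
  by field; rewrite gy0 gt0.
have gg : 1 <= `|g y * g t| by rewrite normrM mulr_ege1.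
have gg0 : 0 < `|g y * g t| by exact: lt_le_trans gg.
rewrite normrM normfV ler_pdivrMr //.
apply: (@le_trans _ _ (e * `|y - t|)); last by rewrite ler_peMr // mulr_ge0 // ltW.
apply: le_trans (ler_normD _ _) _; rewrite normrN.
have b1 := h1 y Ay n1.
have b2 : `|l * (y - t) * ((g y - g t) / g t)| <= e / 2 * `|y - t|.
  rewrite !normrM normfV.
  have q1 : `|g y - g t| / `|g t| <= e / 2 / (`|l| + 1).
    rewrite ler_pdivrMr ?(lt_le_trans ltr01) //.
    by apply: le_trans (h2 y Ay n2) _; rewrite ler_peMr // ltW.
  apply: le_trans (ler_wpM2l _ q1) _; first by rewrite mulr_ge0.
  have -> : `|l| * `|y - t| * (e / 2 / (`|l| + 1)) = e / 2 * `|y - t| * (`|l| / (`|l| + 1)).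
    by field; rewrite gt_eqF.
  rewrite ler_piMr ?mulr_ge0 ?(ltW e0) //.
  by rewrite ler_pdivrMr // mul1r lerDl.
lra.
Qed.

Lemma itv_acc x y t : x < y -> x <= t <= y ->
  forall e, 0 < e -> exists z, [/\ `[x, y]%classic z, z != t & `|z - t| < e].
Proof.
move=> xy /andP[xt ty] e e0.
have [tly|] := ltP t y.
  pose z := Num.min y (t + e / 2).
  have tz : t < z by rewrite lt_min tly ltrDl divr_gt0.
  exists z; split.
  - by rewrite /= in_itv /= (le_trans xt (ltW tz)) ge_min lexx.
  - by rewrite gt_eqF.
  - rewrite gtr0_norm ?subr_gt0 // ltrBlDl.
    have : z <= t + e / 2 by rewrite ge_min lexx orbT.
    by move/le_lt_trans; apply; rewrite ltrD2l ltr_pdivrMr // mulr_natr mulr2n ltrDl.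
move=> yt; have ytE : t = y by apply/eqP; rewrite eq_le ty yt.
pose z := Num.max x (t - e / 2).
have zt : z < t by rewrite gt_max ytE xy gtrBl divr_gt0.
exists z; split.
- by rewrite /= in_itv /= le_max lexx (le_trans (ltW zt)).
- by rewrite lt_eqF.
- rewrite ltr0_norm ?subr_lt0 // opprB ltrBlDl -ltrBlDr.
  have : t - e / 2 <= z by rewrite le_max lexx orbT.
  by apply: lt_le_trans; rewrite ltrD2l ltrN2 ltr_pdivrMr // mulr_natr mulr2n ltrDl.
Qed.

Lemma Ck_on1_prim x y g : Ck_on 1 `[x, y]%classic g ->
  prim x y g (deriv_in `[x, y]%classic g).
Proof.
move=> [h c]; apply: hasd_prim => // t txy; apply: cvg_hasd; apply: h.
by rewrite /= in_itv.
Qed.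

Lemma Ck_on2_prim x y g : Ck_on 2 `[x, y]%classic g ->
  prim x y g (deriv_in `[x, y]%classic g) /\
  exists2 d2, prim x y (deriv_in `[x, y]%classic g) d2 & bmeas x y d2.
Proof.
move=> [h [h' c]]; split; last first.
  exists (deriv_in `[x, y]%classic (deriv_in `[x, y]%classic g)).
    by apply: Ck_on1_prim; split.
  exact: within_bmeas.
apply: hasd_prim => [t txy|]; first by apply: cvg_hasd; apply: h; rewrite /= in_itv.
apply: (@hasd_within _ _ (deriv_in `[x, y]%classic (deriv_in `[x, y]%classic g))) => t txy.
by apply: cvg_hasd; exact: h'.
Qed.

End derivatives.

(** The expansion hypothesis bounds only [|f'|]; the sign of [f'] is read off from one increment. A
    slope [D] below -1 would force [dt] and [h] to have opposite signs, the error being only half of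
    [|h|]. *)
Lemma slope_lower_bound (R : realType) (D dt h L : R) : h != 0 -> 0 < dt * h ->
  `|dt - D * h| <= 1 / 2 * `|h| -> 1 < L -> L <= `|D| -> L <= D.
Proof.
move=> h0 dh hd L1 LD; have [D0|D0] := leP 0 D; first by rewrite -(ger0_norm D0).
move: LD; rewrite ltr0_norm // => LD; exfalso.
move: h0; rewrite neq_lt => /orP[hn|hp].
  move: dh hd; rewrite nmulr_lgt0 // (ltr0_norm hn) ler_norml => d0 /andP[q1 q2].
  have : (- D) * (- h) >= 1 * (- h) by rewrite ler_wpM2r //; lra.
  rewrite mulrNN; lra.
move: dh hd; rewrite pmulr_lgt0 // (gtr0_norm hp) ler_norml => d0 /andP[q1 q2].
have : (- D) * h >= 1 * h by rewrite ler_wpM2r //; lra.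
rewrite mulNr; lra.
Qed.

(** * Branch data of a unimodal map *)

Section extraction.
Context {R : realType}.
Implicit Types (A : set R) (g d : R -> R) (x y t l : R) (e : bool).
Variables (a c b : R) (f : R -> R).
Hypothesis hf : unimodal_expanding 3 a c b f.

Let sgI e : set R := `[blo a c e, bhi c b e]%classic.

Lemma branch_data e : exists l F1 F2 F3, [/\ 1 < l,
  forall t, blo a c e <= t <= bhi c b e -> hasd (sgI e) f t (F1 t) /\ l <= `|F1 t|,
  forall t, blo a c e <= t <= bhi c b e -> hasd (sgI e) F1 t (F2 t),
  forall t, blo a c e <= t <= bhi c b e -> hasd (sgI e) F2 t (F3 t) &
  {within sgI e, continuous F3}].
Proof.
have [/andP[ac cb] _ _ _ /(_ (sgI e))] := hf.
have lh : blo a c e < bhi c b e by case: e.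
have sgIE : sgI e = `[a, c]%classic \/ sgI e = `[c, b]%classic.
  by rewrite /sgI; case: (e); [left|right].
move=> /(_ sgIE)[[U [g [oU AU gf [d1 [d2 [d3 cF3]]]]]] hinf].
pose F1 := deriv_in U g; pose F2 := deriv_in U F1; pose F3 := deriv_in U F2.
have inI t : blo a c e <= t <= bhi c b e -> sgI e t by rewrite /sgI /= in_itv.
have h1 t : blo a c e <= t <= bhi c b e -> hasd (sgI e) f t (F1 t).
  move=> /inI It; apply: (@eq_hasd _ _ g) => //.
  by apply: (hasdS AU); apply: cvg_hasd; apply: d1; exact: AU.
have e1 t : blo a c e <= t <= bhi c b e -> deriv_in (sgI e) f t = F1 t.
  by move=> It; apply: hasd_deriv (h1 t It); exact: itv_acc.
exists (inf [set `|deriv_in (sgI e) f x| | x in sgI e]), F1, F2, F3; split => //.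
- move=> t It; split; first exact: h1.
  apply: ge_inf; first by exists 0 => _ [x _ <-].
  by exists t; [exact: inI|rewrite e1].
- move=> t /inI It; apply: (hasdS AU); apply: cvg_hasd; apply: d2; exact: AU.
- move=> t /inI It; apply: (hasdS AU); apply: cvg_hasd; apply: d3; exact: AU.
- exact: continuous_subspaceW AU cF3.
Qed.

(** Three derivatives are needed because [dw], which contains f'', later acts as a multiplier on
    functionals of bounded variation, and [func_mult] asks for a bounded derivative [ddw]. *)
Lemma extraction : exists th w dw ddw, [/\ expanding a c b th f w dw,
  forall e, prim (blo a c e) (bhi c b e) (dw e) (ddw e),
  forall e, bmeas (blo a c e) (bhi c b e) (ddw e) &
  forall e t, a <= t <= b -> t != c -> (if e then t < c else c < t) ->
    deriv_in `[a, b] f t = (w e t)^-1].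
Proof.
have [/andP[ac cb] [cf map] [inc dec] [fa fb] _] := hf.
have lh e : blo a c e < bhi c b e by case: e.
have ab : a < b := lt_trans ac cb.
have /choice[l /choice[F1 /choice[F2 /choice[F3 H]]]] :
  forall e, exists l F1 F2 F3, [/\ 1 < l,
  forall t, blo a c e <= t <= bhi c b e -> hasd (sgI e) f t (F1 t) /\ l <= `|F1 t|,
  forall t, blo a c e <= t <= bhi c b e -> hasd (sgI e) F1 t (F2 t),
  forall t, blo a c e <= t <= bhi c b e -> hasd (sgI e) F2 t (F3 t) &
  {within sgI e, continuous F3}] by exact: branch_data.
pose L := Num.min (l true) (l false).
have L1 : 1 < L.
  by rewrite lt_min; have [-> _ _ _ _] := H true; have [-> _ _ _ _] := H false.
have L0 : 0 < L by exact: lt_trans L1.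
have Ll e : L <= l e by case: e; rewrite ge_min lexx ?orbT.
have inI e t : blo a c e <= t <= bhi c b e -> sgI e t by rewrite /sgI /= in_itv.
have inI' e t : sgI e t -> blo a c e <= t <= bhi c b e by rewrite /sgI /= in_itv.
have mono e : monot e (blo a c e) (bhi c b e) f.
  case: e => s t as_ st tc /=.
    by apply: inc => //; rewrite in_itv /= ?as_ ?tc ?(le_trans (ltW st)) ?(le_trans as_ (ltW st)).
  by apply: dec => //; rewrite in_itv /= ?as_ ?tc ?(le_trans (ltW st)) ?(le_trans as_ (ltW st)).
have F1L e t : blo a c e <= t <= bhi c b e -> L <= `|F1 e t|.
  by move=> It; have [_ /(_ t It)[_ h] _ _ _] := H e; exact: le_trans (Ll e) h.
have F1s e t : blo a c e <= t <= bhi c b e -> L <= sgb e (F1 e t).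
  move=> It; have [_ /(_ t It)[hd _] _ _ _] := H e.
  have FL := F1L e t It.
  have [dl dl0 hdl] := hd (1 / 2) ltac:(lra).
  have [z [Iz zt ztd]] := itv_acc (lh e) It dl0.
  have hz := hdl z Iz ztd; move: (Iz) => /inI' /andP[z1 z2]; move/andP: It => [t1 t2].
  have zt0 : z - t != 0 by rewrite subr_eq0.
  have sgn : 0 < sgb e (f z - f t) * (z - t).
    have := mono e; case: (e) z1 z2 t1 t2 => /= z1 z2 t1 t2 m; move: zt; rewrite neq_lt => /orP[h|h].
    - by rewrite nmulr_rgt0 ?subr_lt0 // m.
    - by rewrite pmulr_rgt0 ?subr_gt0 // m.
    - by rewrite opprB nmulr_rgt0 ?subr_lt0 ?subr_lt0 // m.
    - by rewrite opprB pmulr_rgt0 ?subr_gt0 // m.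
  apply: (@slope_lower_bound R _ (sgb e (f z - f t)) (z - t) L) => //.
  - case: (e) hz => //= hz; rewrite -normrN.
    by have -> : - (- (f z - f t) - - F1 false t * (z - t)) = f z - f t - F1 false t * (z - t) by ring.
  - by case: (e) FL => //=; rewrite normrN.
have F10 e t : blo a c e <= t <= bhi c b e -> F1 e t != 0.
  by move=> It; rewrite -normr_gt0; exact: lt_le_trans (F1L e t It).
pose w e t := (F1 e t)^-1.
pose dw e t := - F2 e t * w e t * w e t.
pose ddw e t := (- F3 e t * w e t + - F2 e t * dw e t) * w e t + - F2 e t * w e t * dw e t.
have wd e t : blo a c e <= t <= bhi c b e -> hasd (sgI e) (w e) t (dw e t).
  move=> It; have [_ _ h2 _ _] := H e; apply: hasd_inv (h2 t It); last exact: inI.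
  by move=> y /inI' Iy; apply: le_trans (F1L e y Iy); exact: ltW.
have cw e : {within sgI e, continuous (w e)}.
  by apply: hasd_within => t /inI'; exact: wd.
have cF2 e : {within sgI e, continuous (F2 e)}.
  by have [_ _ _ h3 _] := H e; apply: hasd_within => t /inI'; exact: h3.
have cF1 e : {within sgI e, continuous (F1 e)}.
  by have [_ _ h2 _ _] := H e; apply: hasd_within => t /inI'; exact: h2.
have cdw e : {within sgI e, continuous (dw e)}.
  apply/subspace_continuousP => t It.
  have /subspace_continuousP/(_ t It) h1 := cw e.
  have /subspace_continuousP/(_ t It) h2 := cF2 e.
  by apply: cvgM => //; apply: cvgM => //; exact: cvgN.
have pw e : prim (blo a c e) (bhi c b e) (w e) (dw e) by apply: hasd_prim; [exact: wd|exact: cdw].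
have pF2 e : prim (blo a c e) (bhi c b e) (F2 e) (F3 e).
  by have [_ _ _ h3 c3] := H e; apply: hasd_prim; [exact: h3|exact: c3].
have pdw e : prim (blo a c e) (bhi c b e) (dw e) (ddw e).
  exact: primM (primM (primN (pF2 e)) (pw e)) (pw e).
have bddw e : bmeas (blo a c e) (bhi c b e) (ddw e).
  have [_ _ _ _ /within_bmeas b3] := H e.
  have bF2 := within_bmeas (cF2 e); have bw := within_bmeas (cw e); have bdw := within_bmeas (cdw e).
  rewrite /ddw; apply: bmeasD; apply: bmeasM => //; last by apply: bmeasM => //; exact: bmeasN.
  by apply: bmeasD; apply: bmeasM => //; exact: bmeasN.
exists L^-1, w, dw, ddw; split => //; last first.
  move=> e t /andP[at_ tb] tc te; rewrite /w invrK.
  have It : blo a c e <= t <= bhi c b e.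
    by case: (e) te => /= te; rewrite ?at_ ?tb ?(ltW te).
  have [_ /(_ t It)[hd _] _ _ _] := H e.
  apply: (hasd_deriv (itv_acc ab _)); first by rewrite at_.
  move=> k /hd[dl dl0 hdl].
  (* Keeps [y] on the side of [c] where [t] lies, so that the derivative on [[a, b]] is that of the
     branch. *)
  exists (Num.min dl `|t - c|); first by rewrite lt_min dl0 normr_gt0 subr_eq0.
  move=> y; rewrite /= in_itv /= => /andP[ay yb]; rewrite lt_min => /andP[y1 y2].
  apply: hdl => //; apply: inI; move: y2; case: (e) te => /= te.
    rewrite (ltr0_norm (_ : t - c < 0)) ?subr_lt0 // ay /= => h.
    by have := le_lt_trans (ler_norm _) h; rewrite opprB ltrD2r => /ltW.
  rewrite (gtr0_norm (_ : 0 < t - c)) ?subr_gt0 // yb andbT distrC => h.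
  by have := le_lt_trans (ler_norm _) h; rewrite ltrD2l ltrN2 => /ltW.
split => //.
- by rewrite ac.
- by rewrite invr_gt0 L0 invf_lt1.
- move=> e; have [_ h1 _ _ _] := H e.
  apply: (@eq_prim _ _ _ f (F1 e)) => // [t _|]; first by rewrite /w invrK.
  by apply: hasd_prim => [t It|]; [have [] := h1 t It|exact: cF1].
- move=> e; apply: (@eq_bmeas _ _ _ (F1 e)) => [t _|]; first by rewrite /w invrK.
  by apply: within_bmeas; exact: cF1.
- by move=> e; apply: within_bmeas; exact: cdw.
- move=> e t It; have h := F1s e t It; have h0 := lt_le_trans L0 h.
  rewrite /w; have -> : sgb e (F1 e t)^-1 = (sgb e (F1 e t))^-1 by case: (e) => //=; rewrite invrN.
  by rewrite invr_gt0 h0 lef_pV2.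
Qed.

End extraction.

(** * Covering from expansion and mixing *)

Section topology.
Context {R : realType}.
Implicit Types (x y z s t u v k K L C M N V : R) (n i j : nat) (e : bool).
Variables (a c b th : R) (f : R -> R) (w dw : bool -> R -> R).
Hypothesis ex : expanding a c b th f w dw.
Hypotheses (fa : f a = a) (fb : f b = a).
Notation lo := (blo a c).
Notation hi := (bhi c b).

Let ac : a < c. Proof. by have /andP[] := ex_acb ex. Qed.
Let cb : c < b. Proof. by have /andP[] := ex_acb ex. Qed.
Let ab : a < b. Proof. exact: ex_ab ex. Qed.
Let th0 : 0 < th. Proof. by have /andP[] := ex_th ex. Qed.
Let th1 : th < 1. Proof. by have /andP[] := ex_th ex. Qed.

Lemma ex_expand e x y : lo e <= x -> x <= y -> y <= hi e ->
  y - x <= th * sgb e (f y - f x).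
Proof.
move=> lx xy yh; have [i h] := ex_prim_f ex lx yh.
have i' : intg x y (fun t => sgb e (w e t)^-1) by exact: intg_sgb.
have -> : sgb e (f y - f x) = Int x y (fun t => sgb e (w e t)^-1).
  by rewrite h //; case: (e) i' i => //= _ i; rewrite IntN.
have : Int x y (fun=> th^-1) <= Int x y (fun t => sgb e (w e t)^-1).
  apply: le_Int => //; first exact: intg_cst.
  move=> t /andP[xt ty]; have := ex_w0 ex (e := e) (t := t).
  rewrite (le_trans lx xt) (le_trans ty yh) => /(_ isT)/andP[w0 wt].
  have -> : sgb e (w e t)^-1 = (sgb e (w e t))^-1 by case: (e) => //=; rewrite invrN.
  by rewrite lef_pV2.
by rewrite Int_cst // -(ler_pM2l th0) mulrA divff ?gt_eqF // mul1r.
Qed.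

Lemma ex_cont x y : a <= x -> y <= b -> {within `[x, y], continuous f}.
Proof.
move=> ax yb; pose F t := if t < c then (w true t)^-1 else (w false t)^-1.
apply: (@prim_within _ _ _ _ F); apply: (@primS _ a b) => //.
apply: (@prim_cat _ c); rewrite ?ltW //.
  apply: prim_oo (ex_f ex true) => // t /andP[_ /= tc]; by rewrite /F tc.
apply: prim_oo (ex_f ex false) => // t /andP[/= ct _]; by rewrite /F ltNge ltW.
Qed.

Lemma iter_IVT n x y z : a <= x -> x <= y -> y <= b ->
  iter n f x <= z <= iter n f y \/ iter n f y <= z <= iter n f x ->
  exists2 s, x <= s <= y & iter n f s = z.
Proof.
move=> ax xy yb; elim: n z => [|n IH] z /=.
  case=> h; first by exists z.
  by exists x; [rewrite lexx xy|apply/le_anti; case/andP: h => h1 h2; rewrite (le_trans xy h1) h2].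
have xab : a <= x <= b by rewrite ax (le_trans xy).
have yab : a <= y <= b by rewrite yb (le_trans ax).
have /andP[a1 b1] := ex_iter ex n xab; have /andP[a2 b2] := ex_iter ex n yab.
move=> h; have [h12|h12] := leP (iter n f x) (iter n f y).
  have [|s] := @IVT R f _ _ z h12 (ex_cont a1 b2).
    by rewrite ge_min le_max; case: h => /andP[-> ->]; rewrite ?orbT.
  rewrite in_itv /= => hs fs; have [|t ht tE] := IH s; first by left.
  by exists t => //; rewrite tE.
have [|s] := @IVT R f _ _ z (ltW h12) (ex_cont a2 b1).
  by rewrite ge_min le_max; case: h => /andP[-> ->]; rewrite ?orbT.
rewrite in_itv /= => hs fs; have [|t ht tE] := IH s; first by right.
by exists t => //; rewrite tE.
Qed.

Lemma crit_lt : c < f c.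
Proof.
have := @ex_expand true a c (lexx a) (ltW ac) (lexx c); rewrite /= fa => h.
have : th * (f c - a) < f c - a; last lra.
rewrite gtr_pMl // subr_gt0 -{1}fa.
by apply: (ex_mono ex true).
Qed.

Lemma crit_max t : a <= t <= b -> f t <= f c.
Proof.
move=> /andP[at_ tb]; have [tc|ct] := leP t c.
  by apply: (incr_le (ex_mono ex true)).
by apply: (decr_le (ex_mono ex false)) => //=; exact: ltW.
Qed.

Lemma crit_ab : a <= f c <= b.
Proof. by apply: (ex_map ex); rewrite !ltW. Qed.

(** Otherwise [[f (f c), f c]] lies in the decreasing branch. Its image starts at [f (f c)] and
    stays below the maximum [f c], so it is no longer than the interval itself, against
    expansion. *)
Lemma crit2_lt : f (f c) < c.
Proof.
rewrite ltNge; apply/negP => h; have /andP[a1 b1] := crit_ab.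
have c12 : f (f c) <= f c by apply: crit_max; exact: crit_ab.
have := @ex_expand false (f (f c)) (f c) h c12 b1 => /= h1.
have m2 : f (f (f c)) <= f c.
  by apply: crit_max; apply: (ex_map ex); exact: crit_ab.
have d1 : f (f c) < f c.
  by apply: (ex_mono ex false) => //=; exact: crit_lt.
have : th * - (f (f c) - f (f (f c))) < f c - f (f c); last by lra.
apply: (@le_lt_trans _ _ (th * (f c - f (f c)))).
  by rewrite ler_pM2l //; lra.
by rewrite gtr_pMl // subr_gt0.
Qed.

(** As long as no image has [c] in its interior, the images lie in single branches and their lengths
    grow by the factor [1 / th]. *)
Lemma covers_crit x y n : a <= x -> x < y -> y <= b ->
  (exists i u v, [/\ a <= u, v <= b, u < c < v & covers f i x y u v]) \/
  (exists u v, [/\ a <= u, v <= b, covers f n x y u v & y - x <= th ^+ n * (v - u)]).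
Proof.
move=> ax xy yb; elim: n => [|n [IH|[u [v [au vb cov h]]]]]; [|by left|].
  right; exists x, y; split => //; last by rewrite expr0 mul1r.
  by move=> z hz; exists z.
have uv : u < v.
  rewrite -subr_gt0 -(pmulr_rgt0 _ (exprn_gt0 n th0)); apply: lt_le_trans h.
  by rewrite subr_gt0.
have [ucv|] := boolP (u < c < v); first by left; exists n, u, v; split.
rewrite negb_and -!leNgt => hc; right.
have [e [lu vh]] : exists e, lo e <= u /\ v <= hi e.
  by case/orP: hc => hc; [exists false|exists true].
have [h1 h2 h3] := ex_image ex lu vh uv.
exists (flo e (f u) (f v)), (flo e (f v) (f u)); split => //.
  move=> z hz.
  have [|s hs fs] := @iter_IVT 1 u v z au (ltW uv) vb.
    by case: (e) hz => /= hz; [left|right].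
  have [t ht tE] := cov s hs; exists t => //=; by rewrite tE.
apply: le_trans h _; rewrite exprSr -mulrA ler_pM2l ?exprn_gt0 //.
have := ex_expand lu (ltW uv) vh; case: (e) => //=; lra.
Qed.

Hypothesis hmix : mixing c f.

(** Mixing is known only on [[f (f c), f c]]. Some image of the given interval contains a
    neighbourhood of [c], a point of that set. Mixing sends points of this neighbourhood into both
    outer thirds at every late time, and the intermediate value theorem then covers the middle
    third. *)
Lemma mixing_covers : exists z0 z1, [/\ a <= z0, z0 < z1, z1 <= b &
  forall x y, a <= x -> x < y -> y <= b ->
    exists n0, forall n, (n0 <= n)%N -> covers f n x y z0 z1].
Proof.
pose d := (f c - f (f c)) / 3.
have c2c := crit2_lt; have c1c := crit_lt.
have d0 : 0 < d by rewrite /d divr_gt0 // subr_gt0 (lt_trans c2c).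
have dE : f c = f (f c) + 3 * d by rewrite /d; field.
have /andP[a1 b1] := crit_ab; have /andP[a2 b2] := ex_map ex crit_ab.
pose p := f (f c) + d; pose q := f (f c) + 2 * d.
exists p, q; split; rewrite /p /q; try lra.
move=> x y ax xy yb.
(* So large that an interval which avoided [c] for [n] steps would become longer than [[a, b]]. *)
have [n hn] : exists n, th ^+ n <= (y - x) / (2 * (b - a)).
  apply: exp_small; first by rewrite ltW.
  by rewrite divr_gt0 ?mulr_gt0 ?subr_gt0.
have [[i [u [v [au vb /andP[uc cv] cov]]]]|[u [v [au vb _ h]]]] := @covers_crit x y n ax xy yb; last first.
  exfalso; have ba0 : 0 < b - a by rewrite subr_gt0.
  have : th ^+ n * (v - u) <= (y - x) / (2 * (b - a)) * (b - a).
    apply: (@le_trans _ _ (th ^+ n * (b - a))).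
      by rewrite ler_pM2l ?exprn_gt0 //; lra.
    by rewrite ler_pM2r.
  have -> : (y - x) / (2 * (b - a)) * (b - a) = (y - x) / 2 by field; rewrite gt_eqF.
  lra.
have UK : `]u, v[%classic `&` `[f (f c), f c]%classic !=set0.
  exists c; split; rewrite /= in_itv /=; first by rewrite uc.
  by rewrite !ltW.
have V1 : `]f (f c) - 1, p[%classic `&` `[f (f c), f c]%classic !=set0.
  by exists (f (f c)); split; rewrite /= in_itv /= /p; apply/andP; split; lra.
have V2 : `]q, (f c + 1)[%classic `&` `[f (f c), f c]%classic !=set0.
  by exists (f c); split; rewrite /= in_itv /= /q; apply/andP; split; lra.
have oo (s t : R) : open `]s, t[%classic by exact: interval_open.
have [n1 _ h1] := hmix (oo _ _) (oo _ _) UK V1.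
have [n2 _ h2] := hmix (oo _ _) (oo _ _) UK V2.
exists (maxn n1 n2 + i)%N => m hm z /andP[pz zq].
have mE : m = ((m - i) + i)%N by rewrite subnK // (leq_trans _ hm) // leq_addl.
have hm1 : (maxn n1 n2 <= m - i)%N by rewrite leq_subRL ?[(i + _)%N]addnC // (leq_trans _ hm) // leq_addl.
have [_ [[t1 [t1u _] <-] [t1p _]]] := h1 (m - i)%N (leq_trans (leq_maxl _ _) hm1).
have [_ [[t2 [t2u _] <-] [t2q _]]] := h2 (m - i)%N (leq_trans (leq_maxr _ _) hm1).
move: t1u t1p t2u t2q; rewrite /= !in_itv /= => /andP[ut1 t1v] /andP[_ t1p] /andP[ut2 t2v] /andP[t2q _].
have z1 : iter (m - i) f t1 <= z by apply: le_trans (ltW t1p) pz.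
have z2 : z <= iter (m - i) f t2 by apply: le_trans zq (ltW t2q).
have [s us sE] : exists2 s, u <= s <= v & iter (m - i) f s = z.
  have [t12|t21] := leP t1 t2.
    have [|s /andP[hs1 hs2] sE] := @iter_IVT (m - i) t1 t2 z
      (le_trans au (ltW ut1)) t12 (le_trans (ltW t2v) vb); first by left; rewrite z1.
    by exists s => //; rewrite (le_trans (ltW ut1)) // (le_trans hs2) // ltW.
  have [|s /andP[hs1 hs2] sE] := @iter_IVT (m - i) t2 t1 z
    (le_trans au (ltW ut2)) (ltW t21) (le_trans (ltW t1v) vb); first by right; rewrite z1.
  by exists s => //; rewrite (le_trans (ltW ut2)) // (le_trans hs2) // ltW.
have [t xty tE] := cov s us; exists t => //.
by rewrite mE iterD tE.
Qed.

End topology.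

(** * Integration by parts against a function controlled off a null set *)

Section parts.
Context {R : realType}.
Notation mu := (@lebesgue_measure R).
Implicit Types (x y z s t u k K L C M V : R) (n i j : nat) (e : bool).

Lemma negligible_pick (N : set R) s t : mu.-negligible N -> s < t ->
  exists2 u, s < u < t & ~ N u.
Proof.
move=> [A [mA A0 NA]] st; apply: contrapT => H.
have : (mu `]s, t[%classic <= mu A)%E.
  apply: le_measure; rewrite ?inE //.
  move=> u; rewrite /= in_itv /= => su; apply: NA.
  by apply: contrapT => nu; apply: H; exists u.
by rewrite A0 lebesgue_measure_itv /= lte_fin st -EFinB lee_fin leNgt subr_gt0 st.
Qed.

(* Integration by parts over a fine partition with nodes off the null set. *)
Lemma parts_ineq (N : set R) x y (d v psi p : R -> R) C : mu.-negligible N ->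
  bmeas x y d -> prim x y psi p -> bmeas x y p ->
  (forall t, x <= t <= y -> `|psi t| <= C) ->
  (forall s t, x <= s -> s < t -> t <= y -> ~ N s -> ~ N t -> `|d t - d s| <= v t - v s) ->
  ~ N x -> ~ N y -> x < y ->
  `|d y * psi y - d x * psi x - Int x y (fun t => d t * p t)| <= C * (v y - v x).
Proof.
move=> hN bd pp bp psiC dv nx ny xy; have [_ [B0 hB0]] := bp.
pose B := `|B0|; have hB t : x <= t <= y -> `|p t| <= B.
  by move=> /hB0/le_trans; apply; exact: ler_norm.
have B_ge0 : 0 <= B by rewrite normr_ge0.
pose err s t := `|d t * psi t - d s * psi s - Int s t (fun t => d t * p t)|.
have local s t : x <= s -> s < t -> t <= y -> ~ N s -> ~ N t ->
    err s t <= (C + B * (t - s)) * (v t - v s).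
  move=> xs st ty ns nt; have st' := ltW st.
  have V0 : 0 <= v t - v s by apply: le_trans (dv s t _ _ _ _ _).
  have i1 : intg s t (fun t => d t * p t) by apply: (intgS xs ty); apply/bmeas_intg/bmeasM.
  have i2 : intg s t p by apply: (intgS xs ty); exact: bmeas_intg.
  have -> : err s t = `|(d t - d s) * psi t - Int s t (fun u => (d u - d s) * p u)|.
    congr `|_|; rewrite (@eq_Int _ s t (fun u => (d u - d s) * p u)
      (fun u => d u * p u - d s * p u)) => [|u _]; last by ring.
    rewrite IntB //; last exact: intgZ.
    rewrite IntZ // -(pp.2 s t) //; ring.
  apply: le_trans (ler_normB _ _) _; rewrite [X in _ <= X]mulrDl; apply: lerD.
    rewrite normrM mulrC ler_pM ?psiC ?dv // ty andbT; exact: le_trans xs st'.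
  rewrite mulrAC.
  pose q u := if u \in N then 0 else (d u - d s) * p u.
  have E : Int s t (fun u => `|(d u - d s) * p u|) = Int s t (fun u => `|q u|).
    apply: (Int_ae hN) => u _ nu; rewrite /q; case: ifP => //; by rewrite inE.
  apply: le_trans (norm_Int _) _.
    by apply/bmeas_intg/bmeasM; [apply: bmeasB; [exact: bmeasS bd|exact: bmeas_cst]|exact: bmeasS bp].
  rewrite -Int_cst //.
  have i3 : intg s t (fun u => `|(d u - d s) * p u|).
    apply: intg_norm.
    by apply/bmeas_intg/bmeasM; [apply: bmeasB; [exact: bmeasS bd|exact: bmeas_cst]|exact: bmeasS bp].
  (* The integrand is bounded by this constant only off [N]; the truncation changes it on a null set
     and makes the bound hold everywhere. *)
  pose q' u := Num.min (B * (v t - v s)) `|(d u - d s) * p u|.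
  have -> : Int s t (fun u => `|(d u - d s) * p u|) = Int s t q'.
    apply: (Int_ae hN) => u /andP[su ut] nu; rewrite /q' min_r //.
    have xuy : x <= u <= y by rewrite (le_trans xs su) (le_trans ut ty).
    rewrite normrM mulrC ler_pM ?hB //.
    move: su; rewrite le_eqVlt => /predU1P[<-|su]; first by rewrite subrr normr0.
    apply: le_trans (dv s u xs su _ ns nu) _; first by case/andP: xuy.
    rewrite lerD2r -subr_ge0.
    move: ut; rewrite le_eqVlt => /predU1P[->|ut]; first by rewrite subrr.
    by apply: le_trans (dv u t _ ut ty nu nt) => //; case/andP: xuy.
  have iq' : intg s t q'.
    apply: (le_intg _ _ i3) => [|u _].
      by apply: measurable_minr => //; exact: intg_meas i3.
    rewrite normr_id /q' ger0_norm ?ge_min ?lexx ?orbT //.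
    by rewrite le_min normr_ge0 mulr_ge0.
  apply: le_Int => //; first exact: intg_cst.
  by move=> u _; rewrite /q' ge_min lexx.
have cat s u t : x <= s -> s <= u -> u <= t -> t <= y -> err s t <= err s u + err u t.
  move=> xs su ut ty; apply: le_trans (ler_normD _ _); rewrite le_eqVlt; apply/orP; left.
  apply/eqP; congr `|_|; rewrite (@Int_cat _ u s t) //; first ring.
  by apply: (intgS xs ty); apply/bmeas_intg/bmeasM.
have mesh dl n s t : 0 < dl -> x <= s -> s < t -> t <= y -> ~ N s -> ~ N t ->
    t - s <= n%:R * (dl / 2) -> err s t <= (C + B * dl) * (v t - v s).
  move=> dl0; elim: n s t => [|n IH] s t xs st ty ns nt.
    by rewrite mul0r => h; exfalso; lra.
  have V0 s' t' : x <= s' -> s' < t' -> t' <= y -> ~ N s' -> ~ N t' -> 0 <= v t' - v s'.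
    by move=> *; apply: le_trans (dv s' t' _ _ _ _ _).
  have [small _|big hts] := leP (t - s) dl.
    apply: le_trans (local _ _ xs st ty ns nt) _; apply: ler_wpM2r; first exact: V0.
    by rewrite lerD2l ler_wpM2l.
  (* The last cell gets a length between [dl / 2] and [dl]: short enough for the local estimate,
     long enough for the induction on [n] to end. *)
  have [|u /andP[h1 h2] nu] := @negligible_pick N (t - dl) (t - dl / 2) hN; first by lra.
  have su : s < u by lra.
  have ut : u < t by lra.
  apply: le_trans (cat s u t xs (ltW su) (ltW ut) ty) _.
  have -> : v t - v s = (v u - v s) + (v t - v u) by ring.
  rewrite mulrDr lerD //.
    apply: IH => //; first exact: le_trans (ltW ut) ty.
    by move: hts; rewrite -natr1; lra.
  apply: le_trans (local _ _ (le_trans xs (ltW su)) ut ty nu nt) _.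
  apply: ler_wpM2r; first by apply: V0 => //; exact: le_trans xs (ltW su).
  by rewrite lerD2l ler_wpM2l //; lra.
have V0 : 0 <= v y - v x by apply: le_trans (dv x y _ _ _ _ _).
apply/ler_addgt0Pr => k k0.
pose W := B * (v y - v x) + 1.
have W0 : 0 < W by rewrite /W ltr_wpDl // mulr_ge0.
pose dl := k / W; have dl0 : 0 < dl by rewrite divr_gt0.
have [n hn] : exists n, y - x <= n%:R * (dl / 2).
  exists (Num.bound ((y - x) / (dl / 2))).
  rewrite -ler_pdivrMr ?divr_gt0 // ltW //.
  by apply: archi_boundP; rewrite divr_ge0 ?subr_ge0 ?divr_ge0 // ltW.
apply: le_trans (mesh dl n x y dl0 (lexx x) xy (lexx y) nx ny hn) _.
rewrite mulrDl lerD2l mulrAC /dl mulrA ler_pdivrMr // mulrC ler_pM2l //.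
by rewrite /W lerDl.
Qed.

End parts.

(** * Operations that preserve bounded variation of functionals *)

Section multipliers.
Context {R : realType}.
Implicit Types (x y z s t u v k K L C M N V : R) (q Q p P : R -> R) (n i j : nat) (e : bool).
Variables (a c b th : R) (f : R -> R) (w dw : bool -> R -> R).
Hypothesis ex : expanding a c b th f w dw.
Notation lo := (blo a c).
Notation hi := (bhi c b).

Let ac : a < c. Proof. by have /andP[] := ex_acb ex. Qed.
Let cb : c < b. Proof. by have /andP[] := ex_acb ex. Qed.
Let ab : a < b. Proof. exact: ex_ab ex. Qed.

Definition glue (v : bool -> R -> R) t := if t <= c then v true t else v false t.

Lemma glue_oo (v : bool -> R -> R) e t : lo e < t < hi e -> glue v t = v e t.
Proof.
by case: e => /andP[h1 h2]; rewrite /glue /=; [rewrite ltW|rewrite leNgt h1].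
Qed.

Lemma bmeas_glue (v : bool -> R -> R) : (forall e, bmeas (lo e) (hi e) (v e)) -> bmeas a b (glue v).
Proof. by move=> bv; apply: bmeas_cat (bv true) (bv false); exact: ltW. Qed.

(** Dual to replacing a density u by [tr (v * u)]. With [P] the primitive of the test function,
    [v * (p o f)] is the derivative of [v * w * (P o f)] on each branch up to a bounded error. Two
    branches with two boundary terms each give the factor 4. *)
Lemma func_mult (v dv : bool -> R -> R) :
  (forall e, prim (lo e) (hi e) (v e) (dv e)) -> (forall e, bmeas (lo e) (hi e) (dv e)) ->
  exists2 L, 0 <= L & forall T N, func a b N T ->
    func a b (L * N) (fun q => T (fun t => glue v t * q (f t))).
Proof.
move=> pv bdv; have bg := bmeas_glue (fun e => prim_bmeas (pv e)).
have bw e : bmeas (lo e) (hi e) (w e) := prim_bmeas (ex_w ex e).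
have bv e : bmeas (lo e) (hi e) (v e) := prim_bmeas (pv e).
have [_ [A hA]] := bg.
pose vw e t := v e t * w e t; pose dvw e t := dv e t * w e t + v e t * dw e t.
have bdvw e : bmeas (lo e) (hi e) (dvw e).
  by apply: bmeasD; apply: bmeasM => //; [exact: ex_dw ex e].
have pvw e : prim (lo e) (hi e) (vw e) (dvw e) := primM (pv e) (ex_w ex e).
have [_ [B hB]] := bmeas_glue bdvw.
have bvw e : bmeas (lo e) (hi e) (vw e) := prim_bmeas (pvw e).
have [D hD] : exists D, forall e t, lo e <= t <= hi e -> `|vw e t| <= D.
  have [_ [D1 h1]] := bvw true; have [_ [D2 h2]] := bvw false.
  exists (`|D1| + `|D2|) => -[] t ht.
    by apply: le_trans (h1 t ht) _; apply: le_trans (ler_norm _) _; rewrite lerDl.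
  by apply: le_trans (h2 t ht) _; apply: le_trans (ler_norm _) _; rewrite lerDr.
exists (`|A| + (4 * `|D| + `|B|)) => [|T N fT]; first by rewrite !addr_ge0 // mulr_ge0.
have [lT bT vT] := fT.
have N0 : 0 <= N by exact: func_bd_ge0 bT.
have bmul q : bmeas a b q -> bmeas a b (fun t => glue v t * q (f t)).
  by move=> bq; apply: bmeasM => //; exact: (bmeas_comp_f ex).
split.
- move=> k p q bp bq; rewrite -(lT k); [|exact: bmul|exact: bmul].
  by congr T; apply/funext => t; ring.
- apply: (@func_bdW _ _ _ ab _ (`|A| * N)).
    by rewrite ler_wpM2r // lerDl addr_ge0 // mulr_ge0.
  move=> q K bq qK; have := bT _ (`|A| * K) (bmul _ bq).
  rewrite mulrCA mulrA; apply.
  move=> t tab; rewrite normrM ler_pM ?qK ?(ex_map ex) //.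
  by apply: le_trans (hA _ tab) (ler_norm _).
- apply: (@func_varW _ _ _ ab _ ((4 * `|D| + `|B|) * N)).
    by rewrite ler_wpM2r // lerDr.
  move=> p C bp hp.
  have C0 : 0 <= C by apply: le_trans (hp a _); rewrite // lexx ltW.
  pose P x := Int a x p.
  have pP : prim a b P p by exact: prim_Int (bmeas_intg bp).
  have bP := prim_bmeas pP.
  pose r t := - (glue dvw t * P (f t)).
  have br : bmeas a b r by apply/bmeasN/bmeasM; [exact: bmeas_glue|exact: (bmeas_comp_f ex)].
  have rB t : a <= t <= b -> `|r t| <= `|B| * C.
    move=> tab; rewrite normrN normrM ler_pM ?hp ?(ex_map ex) //.
    exact: le_trans (hB _ tab) (ler_norm _).
  have bm := bmul p bp; have bmr := bmeasB bm br; have imr := bmeas_intg bmr.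
  have seg e x y : lo e <= x -> x <= y -> y <= hi e ->
      `|Int x y (fun t => glue v t * p (f t) - r t)| <= 2 * (`|D| * C).
    move=> lx xy yh; have [la [hb _]] := ex_lohi ex e.
    have pPf : prim x y (P \o f) (fun t => p (f t) * (w e t)^-1).
      apply: (prim_mono ex lx yh xy).
      have [xy'|] := ltP x y; last first.
        move=> yx; have -> : x = y by apply/le_anti; rewrite xy yx.
        have /andP[fy1 fy2] : a <= f y <= b.
          by apply: (ex_map ex); rewrite (le_trans yh hb) (le_trans la (le_trans lx xy)).
        by case: (e); apply: primS pP.
      by have [h1 h2 _] := ex_image ex lx yh xy'; exact: primS pP.
    have pr := primM (primS lx yh (pvw e)) pPf.
    have -> : Int x y (fun t => glue v t * p (f t) - r t) =
        vw e y * P (f y) - vw e x * P (f x).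
      rewrite (pr.2 x y) //; apply: Int_oo => t /andP[xt ty].
      have loh : lo e < t < hi e by rewrite (le_lt_trans lx xt) (lt_le_trans ty yh).
      have loh' : lo e <= t <= hi e by case/andP: loh => /ltW -> /ltW ->.
      have := ex_w_neq0 ex loh'; rewrite /r !(glue_oo _ loh) /vw /dvw /= => w0.
      by field.
    have bnd t : lo e <= t <= hi e -> `|vw e t * P (f t)| <= `|D| * C.
      move=> ht; have tab : a <= t <= b by case/andP: ht => h1 h2; rewrite (le_trans la h1) (le_trans h2 hb).
      rewrite normrM ler_pM ?hp ?(ex_map ex) //; exact: le_trans (hD _ _ ht) (ler_norm _).
    apply: le_trans (ler_normB _ _) _.
    have := bnd x; rewrite lx (le_trans xy yh) => /(_ isT).
    have := bnd y; rewrite yh (le_trans lx xy) => /(_ isT); lra.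
  have tot x : a <= x <= b -> `|Int a x (fun t => glue v t * p (f t) - r t)| <= 4 * `|D| * C.
    move=> /andP[ax xb]; have DC : 0 <= `|D| * C by rewrite mulr_ge0.
    have [xc|cx] := leP x c.
      by apply: le_trans (@seg true a x (lexx a) ax xc) _; lra.
    rewrite (@Int_cat _ c a x) ?(ltW ac) ?(ltW cx) //; last exact: intgS imr.
    apply: le_trans (ler_normD _ _) _.
    have := @seg true a c (lexx a) (ltW ac) (lexx c).
    have := @seg false c x (lexx c) (ltW cx) xb; lra.
  have -> : T (fun t => glue v t * p (f t)) =
      T (fun t => glue v t * p (f t) - r t) + T r.
    by rewrite -(funcD lT) //; congr T; apply/funext => t; rewrite subrK.
  apply: le_trans (ler_normD _ _) _.
  have := vT _ _ bmr tot; have := bT _ _ br rB; lra.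
Qed.

(** The jump created at [y] is harmless: up to the error term [r], the primitive of the truncated
    product is [X * P] up to [y] and constant from there on. *)
Lemma func_trunc X dX y : a <= y <= b -> prim a y X dX -> bmeas a y dX ->
  exists2 L, 0 <= L & forall T N, func a b N T ->
    func a b (L * N) (fun q => T (fun t => (if t <= y then X t else 0) * q t)).
Proof.
move=> /andP[ay yb] pX bdX; have bX := prim_bmeas pX.
pose Xt t := if t <= y then X t else 0.
pose dXt t := if t <= y then dX t else 0.
have bXt : bmeas a b Xt by apply: bmeas_cat => //; exact: bmeas_cst.
have bdXt : bmeas a b dXt by apply: bmeas_cat => //; exact: bmeas_cst.
have [_ [A hA]] := bXt; have [_ [B hB]] := bdXt.
exists (`|A| + (`|A| + `|B|)) => [|T N fT]; first by rewrite !addr_ge0.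
have [lT bT vT] := fT.
have N0 : 0 <= N by exact: func_bd_ge0 bT.
have bmul q : bmeas a b q -> bmeas a b (fun t => Xt t * q t) by exact: bmeasM.
split.
- move=> k p q bp bq; rewrite -(lT k); [|exact: bmul|exact: bmul].
  by congr T; apply/funext => t; rewrite -/(Xt t); ring.
- apply: (@func_bdW _ _ _ ab _ (`|A| * N)).
    by rewrite ler_wpM2r // lerDl addr_ge0.
  move=> q K bq qK; have := bT _ (`|A| * K) (bmul _ bq).
  rewrite mulrCA mulrA; apply.
  move=> t tab; rewrite normrM ler_pM ?qK //.
  by apply: le_trans (hA _ tab) (ler_norm _).
- apply: (@func_varW _ _ _ ab _ ((`|A| + `|B|) * N)).
    by rewrite ler_wpM2r // lerDr.
  move=> p C bp hp.
  have C0 : 0 <= C by apply: le_trans (hp a _); rewrite // lexx ltW.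
  pose P x := Int a x p.
  have pP : prim a b P p by exact: prim_Int (bmeas_intg bp).
  pose r t := - (dXt t * P t).
  have br : bmeas a b r by apply/bmeasN/bmeasM => //; exact: prim_bmeas pP.
  have rB t : a <= t <= b -> `|r t| <= `|B| * C.
    move=> tab; rewrite normrN normrM ler_pM ?hp //.
    exact: le_trans (hB _ tab) (ler_norm _).
  have bm := bmul p bp; have bmr := bmeasB bm br; have imr := bmeas_intg bmr.
  have low x : a <= x -> x <= y -> Int a x (fun t => Xt t * p t - r t) = X x * P x.
    move=> ax xy; have pr := primM (primS (lexx a) xy pX) (primS (lexx a) (le_trans xy yb) pP).
    have := pr.2 a x (lexx a) ax (lexx x); rewrite /P Intxx mulr0 subr0 => ->.
    apply: eq_Int => t /andP[_ tx]; rewrite /r /Xt /dXt (le_trans tx xy) /P; ring.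
  have bnd x : a <= x -> x <= y -> `|X x * P x| <= `|A| * C.
    move=> ax xy; have xab : a <= x <= b by rewrite ax (le_trans xy yb).
    rewrite normrM ler_pM ?hp //; apply: le_trans _ (ler_norm _).
    by have := hA x xab; rewrite /Xt xy.
  have tot x : a <= x <= b -> `|Int a x (fun t => Xt t * p t - r t)| <= `|A| * C.
    move=> /andP[ax xb]; have [xy|yx] := leP x y; first by rewrite low ?bnd.
    rewrite (@Int_cat _ y a x) ?(ltW yx) //; last exact: intgS imr.
    rewrite low // (@Int_oo _ y x _ (fun=> 0)).
      by rewrite Int_cst ?(ltW yx) // mul0r addr0 bnd.
    by move=> t /andP[yt _]; rewrite /r /Xt /dXt leNgt yt /=; ring.
  have -> : T (fun t => Xt t * p t) = T (fun t => Xt t * p t - r t) + T r.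
    by rewrite -(funcD lT) //; congr T; apply/funext => t; rewrite subrK.
  apply: le_trans (ler_normD _ _) _.
  have := vT _ _ bmr tot; have := bT _ _ br rB; lra.
Qed.

(** Integration by parts with an empty exceptional set. Primitives of test functions vanish at [a]
    but not at [b], hence the term from [d b] in the bound. *)
Lemma func_density (d v : R -> R) : bmeas a b d ->
  (forall s t, a <= s -> s < t -> t <= b -> `|d t - d s| <= v t - v s) ->
  exists N, func a b N (fun q => Int a b (fun t => d t * q t)).
Proof.
move=> bd dv; have [_ [A hA]] := bd.
have V0 : 0 <= v b - v a by apply: le_trans (dv a b _ _ _).
exists (`|A| * (b - a) + (`|A| + (v b - v a))).
have ba0 : 0 <= b - a by rewrite subr_ge0 ltW.
split.
- move=> k p q bp bq.
  have ip : intg a b (fun t => d t * p t) by exact/bmeas_intg/bmeasM.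
  have iq : intg a b (fun t => d t * q t) by exact/bmeas_intg/bmeasM.
  rewrite -IntZ // -IntD //; last exact: intgZ.
  by apply: eq_Int => t _; ring.
- apply: (@func_bdW _ _ _ ab _ (`|A| * (b - a))).
    by rewrite lerDl addr_ge0.
  move=> q K bq qK; rewrite mulrAC.
  apply: Int_bound; [exact: ltW|exact/bmeas_intg/bmeasM|].
  move=> t tab; rewrite normrM ler_pM ?qK //.
  by apply: le_trans (hA _ tab) (ler_norm _).
- apply: (@func_varW _ _ _ ab _ (`|A| + (v b - v a))).
    by rewrite lerDr mulr_ge0.
  move=> p C bp hp.
  pose P x := Int a x p.
  have pP : prim a b P p by exact: prim_Int (bmeas_intg bp).
  have h := @parts_ineq R set0 a b d v P p C (negligible_set0 _) bd pP bp hp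
     (fun s t h1 h2 h3 _ _ => dv s t h1 h2 h3) id id ab.
  have : `|d b * P b| <= `|A| * C.
    rewrite normrM ler_pM ?hp ?lexx ?(ltW ab) //.
    by apply: le_trans (hA b _) (ler_norm _); rewrite lexx ltW.
  move: h; rewrite {2}/P Intxx mulr0 subr0 => h h2.
  rewrite -[Int a b _](subKr (d b * P b)); apply: le_trans (ler_normB _ _) _.
  by rewrite [X in _ <= X]mulrDl; apply: lerD => //; rewrite [X in _ <= X]mulrC.
Qed.

End multipliers.

(** * The transfer operator through inverse branches *)

Section transfer_operator.
Context {R : realType}.
Notation mu := (@lebesgue_measure R).
Implicit Types (x y z s t k K L C M V : R) (u v q Q p P : R -> R) (n i j : nat) (e : bool).
Variables (a c b th : R) (f : R -> R) (w dw : bool -> R -> R).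
Hypothesis ex : expanding a c b th f w dw.
Hypotheses (fa : f a = a) (fb : f b = a).
Notation lo := (blo a c).
Notation hi := (bhi c b).

Let ac : a < c. Proof. by have /andP[] := ex_acb ex. Qed.
Let cb : c < b. Proof. by have /andP[] := ex_acb ex. Qed.
Let ab : a < b. Proof. exact: ex_ab ex. Qed.
Let afc : a <= f c. Proof. by have /andP[] := crit_ab ex. Qed.
Let fcb : f c <= b. Proof. by have /andP[] := crit_ab ex. Qed.

Definition ibr e x := xget (lo e) [set t | lo e <= t <= hi e /\ f t = x].

Lemma f_lohi e : flo e (f (lo e)) (f (hi e)) = a /\ flo e (f (hi e)) (f (lo e)) = f c.
Proof. by case: e. Qed.

Lemma ibrP e x : a <= x <= f c -> lo e <= ibr e x <= hi e /\ f (ibr e x) = x.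
Proof.
move=> /andP[ax xc]; have [_ [_ lh]] := ex_lohi ex e.
suff h : exists t, lo e <= t <= hi e /\ f t = x.
  exact: (@xgetPex _ (lo e) [set t | lo e <= t <= hi e /\ f t = x] h).
have [|t] := @IVT R f (lo e) (hi e) x (ltW lh) (prim_within (ex_f ex e)).
  by rewrite ge_min le_max; case: (e); rewrite /= ?fa ?fb ax xc ?orbT.
by rewrite in_itv /= => ht ft; exists t.
Qed.

Lemma ex_inj e s t : lo e <= s <= hi e -> lo e <= t <= hi e -> f s = f t -> s = t.
Proof.
move=> /andP[h1 h2] /andP[h3 h4] fst; have := ex_mono ex e.
have [st|ts|//] := ltgtP s t.
  by case: (e) h1 h4 => /= h1 h4 m; have := m s t h1 st h4; rewrite fst ltxx.
by case: (e) h3 h2 => /= h3 h2 m; have := m t s h3 ts h2; rewrite fst ltxx.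
Qed.

Lemma ex_le_crit e t : lo e <= t <= hi e -> a <= f t <= f c.
Proof.
by move=> ht; have := monot_itv (ex_mono ex e) ht; have [-> ->] := f_lohi e.
Qed.

Lemma ibrK e t : lo e <= t <= hi e -> ibr e (f t) = t.
Proof.
by move=> ht; have [h1 h2] := ibrP e (ex_le_crit ht); exact: (ex_inj h1 ht h2).
Qed.

Lemma ibr_mono e : monot e a (f c) (ibr e).
Proof.
have H s t : a <= s -> s < t -> t <= f c -> ~~ (flo e (ibr e t) (ibr e s) <= flo e (ibr e s) (ibr e t)).
  move=> as_ st tc; apply/negP => h.
  have /(ibrP e)[/andP[l1 h1] e1] : a <= s <= f c by rewrite as_ (le_trans (ltW st)).
  have /(ibrP e)[/andP[l2 h2] e2] : a <= t <= f c by rewrite tc (le_trans as_ (ltW st)).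
  have := ex_mono ex e; suff : monot e (lo e) (hi e) f -> t <= s by move=> H /H; rewrite leNgt st.
  rewrite -[X in X <= _]e2 -[X in _ <= X]e1.
  move: h l1 h1 l2 h2; case: (e) => /= h l1 h1 l2 h2 m.
    exact: (incr_le m).
  exact: (decr_le m).
by case: e H => H s t as_ st tc; have := H s t as_ st tc; rewrite /= -ltNge.
Qed.

Lemma ibr_crit e : ibr e (f c) = c.
Proof. by apply: ibrK; case: e; rewrite /= ?lexx ?ltW. Qed.

Lemma ibr_fix : ibr true a = a /\ ibr false a = b.
Proof. by split; [rewrite -{1}fa|rewrite -{1}fb]; apply: ibrK; rewrite /= lexx ltW. Qed.

Lemma meas_ibr e q : measurable_fun `[lo e, hi e] q -> measurable_fun `[a, f c] (q \o ibr e).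
Proof.
move=> mq; apply: (measurable_comp (F := `[lo e, hi e]%classic)) => //.
  by move=> _ [x /=] + <-; rewrite !in_itv => /(ibrP e)[].
(* Clamping extends the inverse branch to a monotone, hence measurable, function on the line. *)
pose cl x := Num.min (f c) (Num.max a x).
have clE x : a <= x <= f c -> cl x = x.
  by move=> /andP[h1 h2]; rewrite /cl max_r // min_r.
have clab x : a <= cl x <= f c.
  by rewrite /cl le_min afc ge_min lexx le_max lexx.
have clm x y : x <= y -> cl x <= cl y.
  by move=> xy; rewrite /cl le_min ge_min lexx /= ge_min ge_max !le_max lexx xy !orbT.
apply: (@eq_measurable_fun _ _ _ _ _ (ibr e \o cl)) => [x|].
  by rewrite inE /= in_itv /= => /clE ->.
have im := ibr_mono e; case: (e) im => im.
  apply: nondecreasing_measurable => // x y /clm h /=.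
  by case/andP: (clab x) => h1 _; case/andP: (clab y) => _ h2; exact: (incr_le im).
apply: nonincreasing_measurable => // x y /clm h /=.
by case/andP: (clab x) => h1 _; case/andP: (clab y) => _ h2; exact: (decr_le im).
Qed.

(* [sgb e (w e _)] is the absolute value of [1 / f'] on the branch [e]. *)
Definition brt e u x :=
  if a <= x <= f c then u (ibr e x) * sgb e (w e (ibr e x)) else 0.

Lemma meas_brt e u : measurable_fun `[lo e, hi e] u -> measurable_fun `[a, f c] (brt e u).
Proof.
move=> mu_; have mw : measurable_fun `[lo e, hi e] (fun t => u t * sgb e (w e t)).
  by apply: measurable_funM => //; case: (bmeas_sgb e (prim_bmeas (ex_w ex e))).
apply: eq_measurable_fun (meas_ibr mw) => x.
by rewrite inE /= in_itv /= /brt => ->.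
Qed.

Lemma brt_f e u t : lo e <= t <= hi e -> brt e u (f t) * sgb e (w e t)^-1 = u t.
Proof.
move=> ht; rewrite /brt (ex_le_crit ht) ibrK // -mulrA.
have w0 := ex_w_neq0 ex ht; case: (e) w0 => w0 /=; first by rewrite divff ?mulr1.
by rewrite mulrNN divff ?mulr1.
Qed.

Lemma intg_brt e u : intg (lo e) (hi e) u -> intg a (f c) (brt e u).
Proof.
move=> iu; have [_ [_ lh]] := ex_lohi ex e.
have mb := meas_brt (intg_meas iu).
apply/integrableP; split; first exact/measurable_EFinP.
have := @ge0_subst R e (lo e) (hi e) f (fun t => (w e t)^-1) (fun t => `|brt e u t|)
  (ltW lh) (ex_mono ex e) (ex_f ex e) (@ex_inv0 _ _ _ _ _ _ _ _ ex e).
have [-> ->] := f_lohi e => h.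
rewrite [X in (X < _)%E](_ : _ = \int[mu]_(t in `[a, f c]) (`|brt e u t|)%:E)%E //.
rewrite {}h //; last exact: measurableT_comp.
have -> : (\int[mu]_(t in `[lo e, hi e]) (`|brt e u (f t)| * sgb e (w e t)^-1)%:E =
  \int[mu]_(t in `[lo e, hi e]) `|(EFin \o u) t|)%E; last by have /integrableP[] := iu.
apply: eq_integral.
move=> t; rewrite inE /= in_itv /= => ht; congr (_%:E).
have s0 := ex_inv0 ex ht; rewrite -[in RHS](brt_f u ht) normrM; congr (_ * _).
by rewrite ger0_norm.
Qed.

Lemma Int_brt e u q x y : intg (lo e) (hi e) u -> bmeas a b q ->
  a <= x -> x <= y -> y <= f c ->
  Int x y (fun t => brt e u t * q t) =
  Int (flo e (ibr e x) (ibr e y)) (flo e (ibr e y) (ibr e x)) (fun t => u t * q (f t)).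
Proof.
move=> iu bq ax xy yc; have yb := le_trans yc fcb.
have /(ibrP e)[/andP[l1 h1] e1] : a <= x <= f c by rewrite ax (le_trans xy).
have /(ibrP e)[/andP[l2 h2] e2] : a <= y <= f c by rewrite yc (le_trans ax).
set P := flo e _ _; set Q := flo e (ibr e y) _.
have lP : lo e <= P by rewrite /P; case: (e) l1 l2.
have Qh : Q <= hi e by rewrite /Q; case: (e) h1 h2.
have PQ : P <= Q.
  by have := ibr_mono e; rewrite /P /Q; case: (e) => m /=; [exact: (incr_le m)|exact: (decr_le m)].
have eP : flo e (f P) (f Q) = x by rewrite /P /Q; case: (e) e1 e2.
have eQ : flo e (f Q) (f P) = y by rewrite /P /Q; case: (e) e1 e2.
have sub t : P <= t <= Q -> lo e <= t <= hi e.
  by move=> /andP[h3 h4]; rewrite (le_trans lP h3) (le_trans h4 Qh).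
have := @Int_subst R e P Q f (fun t => (w e t)^-1) (fun t => brt e u t * q t) PQ
  (monotS lP Qh (ex_mono ex e)) (ex_prim_f ex lP Qh).
rewrite eP eQ => ->.
- by apply: eq_Int => t /sub ht; rewrite mulrAC brt_f.
- by move=> t /sub; exact: (ex_inv0 ex).
- apply: (eq_intg (p := fun t => q t * brt e u t)) => [t _|]; first by rewrite mulrC.
  by apply: intgM; [exact: bmeasS bq|exact: intgS (intg_brt iu)].
Qed.

(** The working version of [transfer]: it uses the one-sided slopes [w e] at [c], so that identities
    between integrals and iterates need no exception there. *)
Definition tr u x := brt true u x + brt false u x.

Let sub_intg e u : intg a b u -> intg (lo e) (hi e) u.
Proof. by have [h1 [h2 _]] := ex_lohi ex e; exact: intgS. Qed.

Lemma tr_out u x : f c < x -> tr u x = 0.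
Proof. by move=> h; rewrite /tr /brt [x <= _]leNgt h andbF addr0. Qed.

Lemma intg_tr u : intg a b u -> intg a b (tr u).
Proof.
move=> iu; apply: (@intg_cat _ (f c)) => //.
  by apply: intgD; apply: intg_brt; exact: sub_intg.
by apply: (intg_oo (p := fun=> 0)) (intg_cst _ _ _) => t /andP[h _]; rewrite tr_out.
Qed.

Lemma Int_tr_seg u q x y : intg a b u -> bmeas a b q -> a <= x -> x <= y -> y <= f c ->
  Int x y (fun t => tr u t * q t) =
  Int (ibr true x) (ibr true y) (fun t => u t * q (f t)) +
  Int (ibr false y) (ibr false x) (fun t => u t * q (f t)).
Proof.
move=> iu bq ax xy yc; have yb := le_trans yc fcb.
have i e : intg x y (fun t => brt e u t * q t).
  apply: (eq_intg (p := fun t => q t * brt e u t)) => [t _|]; first by rewrite mulrC.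
  by apply: intgM; [exact: bmeasS bq|apply: intgS (intg_brt (sub_intg e iu))].
rewrite -(@Int_brt true) // -?(@Int_brt false) //; try exact: sub_intg.
by rewrite -IntD //; apply: eq_Int => t _; rewrite mulrDl.
Qed.

Lemma Int_tr u q : intg a b u -> bmeas a b q ->
  Int a b (fun t => tr u t * q t) = Int a b (fun t => u t * q (f t)).
Proof.
move=> iu bq.
have i1 : intg a b (fun t => tr u t * q t).
  apply: (eq_intg (p := fun t => q t * tr u t)) => [t _|]; first by rewrite mulrC.
  by apply: intgM => //; exact: intg_tr.
have i2 : intg a b (fun t => u t * q (f t)).
  apply: (eq_intg (p := fun t => q (f t) * u t)) => [t _|]; first by rewrite mulrC.
  by apply: intgM => //; exact: (bmeas_comp_f ex).
rewrite (@Int_cat _ (f c)) // Int_tr_seg // [X in _ + X](@Int_oo _ _ _ _ (fun=> 0)); last first.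
  by move=> t /andP[h _]; rewrite tr_out // mul0r.
rewrite Int_cst // mul0r addr0 !ibr_crit; have [-> ->] := ibr_fix.
by rewrite -Int_cat // ltW.
Qed.

Lemma tr_norm u t : `|tr u t| <= tr (fun t => `|u t|) t.
Proof.
apply: le_trans (ler_normD _ _) _; have H e : `|brt e u t| <= brt e (fun t => `|u t|) t.
  rewrite /brt; case: ifP => [h|_]; last by rewrite normr0.
  have [hi_ _] := ibrP e h; have /andP[w0 _] := ex_w0 ex hi_.
  by rewrite normrM (gtr0_norm w0).
exact: lerD.
Qed.

Lemma Int_tr_norm u : intg a b u -> Int a b (fun t => `|tr u t|) <= Int a b (fun t => `|u t|).
Proof.
move=> iu; have := Int_tr (intg_norm iu) (bmeas_cst a b 1).
rewrite (@eq_Int _ _ _ (fun t => `|u t| * 1) (fun t => `|u t|)) => [<-|t _]; last by rewrite mulr1.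
apply: le_Int; first by apply: intg_norm; exact: intg_tr.
  by apply: eq_intg (intg_tr (intg_norm iu)) => t _; rewrite mulr1.
by move=> t _; rewrite mulr1; exact: tr_norm.
Qed.

Lemma intg_iter_tr n u : intg a b u -> intg a b (iter n tr u).
Proof. by move=> iu; elim: n => //= n; exact: intg_tr. Qed.

Lemma Int_iter_tr n u q : intg a b u -> bmeas a b q ->
  Int a b (fun t => iter n tr u t * q t) = Int a b (fun t => u t * q (iter n f t)).
Proof.
move=> iu; elim: n q => // n IH q bq.
rewrite iterS Int_tr //; last exact: intg_iter_tr.
by rewrite (IH (fun t => q (f t))) //; exact: (bmeas_comp_f ex).
Qed.

Lemma eq_tr u v x : (forall e, a <= x <= f c -> u (ibr e x) = v (ibr e x)) -> tr u x = tr v x.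
Proof.
by move=> h; rewrite /tr /brt; case: ifP => // hx; rewrite !h.
Qed.

(** [B e] consists of the points whose preimage under the branch [e] lies in [A]; after substitution
    its indicator is supported in the null set [A]. *)
Lemma negligible_fwd (N : set R) : mu.-negligible N ->
  mu.-negligible (f @` (N `&` `[a, b])).
Proof.
move=> [A [mA A0 NA]].
pose B e := `[a, f c]%classic `&` (ibr e @^-1` A).
have mI e : measurable_fun `[a, f c] (ibr e) by apply: (@meas_ibr e id); exact: measurable_id.
have mB e : measurable (B e) by apply: mI.
have B0 e : mu (B e) = 0%E.
  have [_ [_ lh]] := ex_lohi ex e.
  have := @ge0_subst R e (lo e) (hi e) f (fun t => (w e t)^-1) (\1_(B e))
    (ltW lh) (ex_mono ex e) (ex_f ex e) (@ex_inv0 _ _ _ _ _ _ _ _ ex e).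
  have [-> ->] := f_lohi e => h.
  have E1 : (\int[mu]_(t in `[a, f c]) (\1_(B e) t)%:E = mu (B e))%E.
    transitivity (mu (B e `&` `[a, f c])); first by rewrite integral_indic; [by []|exact: measurable_itv|exact: mB].
    by congr (mu _); apply/setIidPl => t [].
  rewrite -E1 {}h //.
  have mF : measurable_fun `[lo e, hi e] (fun t => (\1_(B e) (f t) * sgb e (w e t)^-1)%:E).
    apply/measurable_EFinP; apply: measurable_funM; last exact: intg_meas (intg_sgb e (ex_f ex e).1).
    apply: meas_comp_mono (ex_mono ex e) (ex_f ex e) _; have [-> ->] := f_lohi e.
    exact: measurable_indic.
  rewrite integral_mkcond; rewrite (@integral_off_null R A _ (fun=> 0%E)) //; first exact: integral0.
  move=> t At; rewrite /patch; case: ifPn => //; rewrite inE /= in_itv /= => ht.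
  by rewrite indicE memNset ?mul0r // => -[_ /=]; rewrite ibrK.
have nB : mu.-negligible (B true `|` B false).
  have nB e : mu.-negligible (B e) by exists (B e); split; [exact: (mB e)|exact: B0|move=> ?].
  exact: negligibleU.
apply: negligibleS nB => y [t [Nt]]; rewrite /= in_itv /= => /andP[at_ tb] <-.
have [tc|ct] := leP t c.
  left; split; rewrite /= ?in_itv /=; first by apply: (@ex_le_crit true); rewrite /= at_.
  by rewrite (@ibrK true) ?(at_, tc) //; exact: NA.
right; split; rewrite /= ?in_itv /=; first by apply: (@ex_le_crit false); rewrite /= tb ltW.
by rewrite (@ibrK false) ?(ltW ct, tb) //; exact: NA.
Qed.

(** Once a null set is forward invariant, a point outside of it has all its preimages outside as
    well, so an identity valid off the set survives every iterate of [tr]. *)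
Lemma negligible_saturate (N : set R) : mu.-negligible N -> exists N' : set R,
  [/\ mu.-negligible N', N `<=` N' & forall t, a <= t <= b -> N' t -> N' (f t)].
Proof.
move=> hN; pose F n := iter n (fun A : set R => f @` (A `&` `[a, b])) N.
exists (\bigcup_n F n); split.
- by apply: negligible_bigcup; elim=> //= n; exact: negligible_fwd.
- by move=> t Nt; exists 0%N.
- move=> t tab [n _ Ft]; exists n.+1 => //=; by exists t.
Qed.

End transfer_operator.

(** * Comparison with the operator of the statement *)

Section raw_transfer.
Context {R : realType}.
Notation mu := (@lebesgue_measure R).
Implicit Types (x y z s t k K L C M V : R) (u v q Q p P : R -> R) (n i j : nat) (e : bool).
Variables (a c b th : R) (f : R -> R) (w dw : bool -> R -> R).
Hypothesis ex : expanding a c b th f w dw.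
Hypotheses (fa : f a = a) (fb : f b = a).
Hypothesis fw : forall e t, a <= t <= b -> t != c -> (if e then t < c else c < t) ->
  deriv_in `[a, b] f t = (w e t)^-1.
Notation lo := (blo a c).
Notation hi := (bhi c b).
Notation tr := (tr a c b f w).
Notation ibr := (ibr a c b f).

Let ac : a < c. Proof. by have /andP[] := ex_acb ex. Qed.
Let cb : c < b. Proof. by have /andP[] := ex_acb ex. Qed.

Lemma ibr_neq e x : a <= x <= f c -> x != f c -> ibr e x != c.
Proof.
by move=> h; apply: contra_neq => E; have [_ <-] := ibrP ex fa fb e h; rewrite E.
Qed.

(** Below [f c] there are two distinct preimages, both different from [c], where the derivative on
    [[a, b]] is that of a branch. At [f c] they merge into [c]. *)
Lemma transferE u x : x != f c -> transfer a b f u x = tr u x.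
Proof.
move=> xc; rewrite /transfer /tr /brt.
case: ifPn => h; last first.
  rewrite (_ : [set y | y \in `[a, b] /\ f y = x] = set0) ?fsbig_set0 ?addr0 //.
  apply/seteqP; split => // t [/=]; rewrite in_itv /= => /andP[at_ tb] ft.
  case/negP: h; rewrite -ft; have [tc|ct] := leP t c.
    by apply: (@ex_le_crit _ _ _ _ _ _ _ _ ex fa fb true); rewrite /= at_.
  by apply: (@ex_le_crit _ _ _ _ _ _ _ _ ex fa fb false); rewrite /= tb ltW.
have [/andP[l1 h1] f1] := ibrP ex fa fb true h.
have [/andP[l2 h2] f2] := ibrP ex fa fb false h.
have n1 := ibr_neq true h xc; have n2 := ibr_neq false h xc.
have t1 : ibr true x < c by rewrite lt_neqAle n1.
have t2 : c < ibr false x by rewrite lt_neqAle eq_sym n2.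
rewrite (_ : [set y | y \in `[a, b] /\ f y = x] = [set ibr true x] `|` [set ibr false x]); last first.
  apply/seteqP; split => [t [/=]|t /= [->|->]]; rewrite ?in_itv /=.
  - move=> /andP[at_ tb] ft; have [tc|ct] := leP t c.
      by left; rewrite -ft (ibrK ex fa fb) //= at_.
    by right; rewrite -ft (ibrK ex fa fb) //= tb ltW.
  - by split => //; rewrite l1 (le_trans h1) // ltW.
  - by split => //; rewrite h2 (le_trans _ l2) // ltW.
rewrite fsbigU //=; last by move=> t [/= -> E]; move: t1; rewrite E ltNge (ltW t2).
rewrite !fsbig_set1; have H e : lo e <= ibr e x <= hi e ->
    `|deriv_in `[a, b] f (ibr e x)|^-1 = sgb e (w e (ibr e x)).
  move=> hi_; have [h3 [h4 _]] := ex_lohi ex e; rewrite (@fw e).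
  - have /andP[w0 _] := ex_w0 ex hi_.
    rewrite normfV invrK; move: w0; case: (e) => /= w0; first by rewrite gtr0_norm.
    by rewrite ltr0_norm // -oppr_gt0.
  - by case/andP: hi_ => h5 h6; rewrite (le_trans h3 h5) (le_trans h6 h4).
  - exact: ibr_neq.
  - by case: (e).
by rewrite !H // ?l1 ?l2.
Qed.

Lemma iter_transferE n u x : (forall i, (i < n)%N -> x != iter i.+1 f c) ->
  iter n (transfer a b f) u x = iter n tr u x.
Proof.
elim: n x => // n IH x hx; rewrite !iterS transferE; last exact: (hx 0%N).
apply: eq_tr => e h; apply: IH => i ni; apply: contra_neq (hx i.+1 ni) => E.
by have [_ <-] := ibrP ex fa fb e h; rewrite E.
Qed.

Lemma iter_tr_off (N : set R) u v n x :
  (forall t, a <= t <= b -> N t -> N (f t)) ->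
  (forall t, a <= t <= b -> ~ N t -> u t = v t) ->
  a <= x <= b -> ~ N x -> iter n tr u x = iter n tr v x.
Proof.
move=> sat uv; elim: n x => [|n IH] x xab nx; first exact: uv.
rewrite !iterS; apply: eq_tr => e h; have [hi_ E] := ibrP ex fa fb e h.
have [h3 [h4 _]] := ex_lohi ex e.
have tab : a <= ibr e x <= b.
  by case/andP: hi_ => h5 h6; rewrite (le_trans h3 h5) (le_trans h6 h4).
by apply: IH => // Nt; apply: nx; rewrite -E; exact: sat.
Qed.

End raw_transfer.

(** * Exponentially decaying sequences *)

Section L1_series.
Context {R : realType}.
Notation mu := (@lebesgue_measure R).
Implicit Types (x y s t K C : R) (q : R -> R) (n i j : nat).

Lemma cvgn_norm_le (u : nat -> R) s K : u n @[n --> \oo] --> s ->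
  (forall n, `|u n| <= K) -> `|s| <= K.
Proof.
move=> /cvgrPdist_le h uK; apply/ler_addgt0Pr => e e0; have [n _ hn] := h e e0.
have := hn n (leqnn n); have := uK n; have := ler_normD (s - u n) (u n); rewrite /= subrK; lra.
Qed.

(** The sum of the [|h n|] is integrable, hence finite off a null set, and dominates all partial
    sums. The limit is pointwise because [resolvent1] is a pointwise limit. *)
Lemma L1_series x y (h : nat -> R -> R) C s : x <= y -> 0 <= s < 1 ->
  (forall n, intg x y (h n)) -> (forall n, Int x y (fun t => `|h n t|) <= C * s ^+ n) ->
  exists N H, [/\ mu.-negligible N, intg x y H,
    forall t, x <= t <= y -> ~ N t -> series (h^~ t) n @[n --> \oo] --> H t &
    forall q, bmeas x y q ->
      series (fun n => Int x y (fun t => h n t * q t)) n @[n --> \oo] -->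
        Int x y (fun t => H t * q t)].
Proof.
move=> xy /andP[s0 s1] ih hC.
have mD : measurable (`[x, y]%classic : set (measurableTypeR R)) by exact: measurable_itv.
have mn n : measurable_fun `[x, y] (fun t => `|h n t|).
  by apply: measurableT_comp => //; exact: intg_meas.
pose g t := (\sum_(0 <= n <oo) (`|h n t|)%:E)%E.
have Eint n : (\int[mu]_(t in `[x, y]) (`|h n t|)%:E = (Int x y (fun t => `|h n t|))%:E)%E.
  rewrite /Int /Rintegral fineK //; apply: integrable_fin_num => //; exact: intg_norm.
have gfin : (\int[mu]_(t in `[x, y]) g t < +oo)%E.
  rewrite integral_nneseries; [|exact: mD|by move=> n; exact: ((measurable_EFinP _ _).2 (mn n))|by move=> n t _; rewrite lee_fin].
  apply: (@le_lt_trans _ _ (C / (1 - s))%:E); last exact: ltry.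
  apply: lime_le; first by apply: is_cvg_nneseries => n _ _; rewrite Eint lee_fin Int_ge0.
  apply: nearW => n; under eq_bigr do rewrite Eint.
  rewrite sumEFin lee_fin.
  apply: (@le_trans _ _ (\sum_(0 <= i < n) C * s ^+ i)); first exact: ler_sum.
  have C0 : 0 <= C by have := hC 0%N; rewrite expr0 mulr1; apply: le_trans; exact: Int_ge0.
  rewrite -mulr_sumr ler_wpM2l // big_mkord.
  have /(congr1 (fun z => z / (1 - s))) := subrX1 s n.
  have s1' : 1 - s != 0 by rewrite subr_eq0 gt_eqF.
  move=> E; have -> : \sum_(i < n) s ^+ i = (1 - s ^+ n) / (1 - s).
    apply: (mulIf s1'); rewrite divfK //.
    have := subrX1 s n; lra.
  rewrite ler_pdivrMr ?subr_gt0 // mulVf // gerBl.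
  by rewrite exprn_ge0.
have mg : measurable_fun `[x, y] g.
  by apply: ge0_emeasurable_sum => [n t _ _|n _]; [rewrite lee_fin|exact/measurable_EFinP].
have g0 t : (0 <= g t)%E by apply: nneseries_ge0 => n _ _; rewrite lee_fin.
have ig : mu.-integrable `[x, y] g.
  apply/integrableP; split => //.
  by under eq_integral => t _ do rewrite gee0_abs //.
have [A [mA A0 NA]] := integrable_ae mD ig.
have gA t : x <= t <= y -> ~ A t -> g t \is a fin_num.
  move=> txy At; apply: contrapT => ngt; apply: At; apply: NA => /= k.
  by apply: ngt; apply: k; rewrite /= in_itv.
(* Setting the sum to 0 on the exceptional set makes it an everywhere limit of the measurable
   [S n]. *)
pose H t := if t \in A then 0 else limn (series (h^~ t)).
have bnd t n : x <= t <= y -> ~ A t -> \sum_(0 <= i < n) `|h i t| <= fine (g t).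
  move=> txy At; rewrite -lee_fin fineK ?gA // -sumEFin.
  by apply: nneseries_lim_ge => i _ _; rewrite lee_fin.
have cv t : x <= t <= y -> ~ A t -> cvgn (series (h^~ t)).
  move=> txy At; apply: normed_cvg; apply: nondecreasing_is_cvgn.
    by apply/nondecreasing_seqP => n; rewrite /= seriesSr lerDl.
  by exists (fine (g t)) => _ [n _ <-]; exact: bnd.
have Hcv t : x <= t <= y -> ~ A t -> series (h^~ t) n @[n --> \oo] --> H t.
  by move=> txy At; rewrite /H memNset //; exact: cv.
pose S n t := if t \in A then 0 else series (h^~ t) n.
have mser n : measurable_fun `[x, y] (fun t => series (h^~ t) n).
  by rewrite /series /=; apply: measurable_sum => i; exact: intg_meas.
have mS n : measurable_fun `[x, y] (S n).
  apply: measurable_fun_if => //.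
  - apply: (@measurable_fun_bool _ _ _ _ true) => //; rewrite (_ : _ @^-1` _ = A) //.
      exact: measurableI.
    by apply/seteqP; split => t /= At; [exact: set_mem At|exact: mem_set].
  - by apply: measurable_funS (mser n) => // t [].
have SH t : x <= t <= y -> S n t @[n --> \oo] --> H t.
  move=> txy; rewrite /S; have [At|/negP At] := boolP (t \in A); first by rewrite /H At; exact: cvg_cst.
  apply: Hcv => //; by move=> /mem_set.
have mH : measurable_fun `[x, y] H.
  by apply: (measurable_fun_cvg mS) => t; rewrite /= in_itv /=; exact: SH.
have SB t n : x <= t <= y -> `|S n t| <= fine (g t).
  move=> txy; rewrite /S; case: ifPn => [_|/negP At]; first by rewrite normr0 fine_ge0.
  apply: le_trans (ler_norm_sum _ _ _) _; apply: bnd => //; by move=> /mem_set.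
have HA t : x <= t <= y -> ((`|H t|)%:E <= g t)%E.
  move=> txy; have [At|/negP At] := boolP (t \in A); first by rewrite /H At normr0.
  have At' : ~ A t by move=> /mem_set.
  rewrite -[g t]fineK ?gA // lee_fin.
  exact: cvgn_norm_le (SH t txy) (fun n => SB t n txy).
have iH : intg x y H.
  apply: (le_integrable mD _ _ ig); first exact/measurable_EFinP.
  by move=> t; rewrite /= in_itv /= => txy; rewrite (gee0_abs (g0 t)) HA.
have nA : mu.-negligible A by exists A; split; [exact: mA|exact: A0|by move=> ?].
exists A, H; split => //.
move=> q bq; have [mq [K hK]] := bq.
have ihq n : intg x y (fun t => h n t * q t).
  by apply: (eq_intg _ (intgM bq (ih n))) => t _; rewrite mulrC.
have iSq n : intg x y (fun t => series (h^~ t) n * q t).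
  apply: (eq_intg (p := fun t => \sum_(0 <= i < n) (h i t * q t))) => [t _|].
    by rewrite /series /= mulr_suml.
  elim: n => [|n IH]; first by apply: (eq_intg _ (intg_cst x y 0)) => t _; rewrite big_geq.
  by apply: (eq_intg _ (intgD IH (ihq n))) => t _; rewrite big_nat_recr.
have E n : series (fun n => Int x y (fun t => h n t * q t)) n = Int x y (fun t => S n t * q t).
  rewrite (@Int_ae _ x y A _ (fun t => series (h^~ t) n * q t)) //; last first.
    by move=> t _ At; rewrite /S memNset.
  elim: n => [|n IH].
    rewrite /series /= big_geq // (@eq_Int _ _ _ _ (fun=> 0)) ?Int_cst ?mul0r // => t _.
    by rewrite big_geq // mul0r.
  rewrite seriesSr IH -IntD //.
  by apply: eq_Int => t _; rewrite seriesSr mulrDl.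
rewrite (_ : series _ = fun n => Int x y (fun t => S n t * q t)); last exact/funext.
have igK : mu.-integrable `[x, y] (fun t => (`|K|%:E * g t)%E) by exact: integrableZl.
have [||_ _] := @dominated_convergence _ _ R mu _ mD
  (fun n t => (S n t * q t)%:E) (fun t => (H t * q t)%:E) (fun t => (`|K|%:E * g t)%E)
  (fun n => (measurable_EFinP _ _).2 (measurable_funM (mS n) mq))
  ((measurable_EFinP _ _).2 (measurable_funM mH mq)) _ igK _.
- apply: aeW => t; rewrite /= in_itv /= => txy; apply: cvg_EFin; first exact: nearW.
  by apply: cvgMl; exact: SH.
- apply: aeW => t n; rewrite /= in_itv /= => txy; rewrite normrM EFinM muleC.
  apply: lee_pmul; rewrite ?lee_fin //; first exact: le_trans (hK t txy) (ler_norm _).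
  rewrite /S; case: ifPn => [_|/negP At]; first by rewrite normr0.
  have At' : ~ A t by move=> /mem_set.
  rewrite -[g t]fineK ?gA // lee_fin; apply: le_trans (ler_norm_sum _ _ _) _; exact: bnd.
move=> h1; have iHq : intg x y (fun t => H t * q t).
  by apply: (eq_intg _ (intgM bq iH)) => t _; rewrite mulrC.
apply: (@fine_cvg _ _ _ _ (fun n => \int[mu]_(t in `[x, y]) (S n t * q t)%:E)%E).
by rewrite /Int /Rintegral fineK //; apply: integrable_fin_num.
Qed.

End L1_series.

Section exponential_sequences.
Context {R : realType}.
Implicit Types (u v p A t : nat -> R) (C D K L s r x y z : R) (n i j m N : nat).

Definition expb C s u := forall n, `|u n| <= C * s ^+ n.

Lemma sum_geo s n : 0 <= s < 1 -> \sum_(i < n) s ^+ i <= (1 - s)^-1.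
Proof.
move=> /andP[s0 s1]; have s1' : 0 < 1 - s by rewrite subr_gt0.
rewrite -[X in X <= _](mulfK (lt0r_neq0 s1')) ler_pdivrMr // mulVf ?gt_eqF //.
have := subrX1 s n; have := exprn_ge0 n s0; lra.
Qed.

Lemma cvg_squeeze0 u v : (forall n, `|u n| <= v n) -> v n @[n --> \oo] --> 0 ->
  u n @[n --> \oo] --> 0.
Proof.
move=> uv /cvgrPdist_le h; apply/cvgrPdist_le => e e0.
apply: filterS (h e e0) => n; rewrite !sub0r !normrN.
by move=> /(le_trans (ler_norm _)); apply: le_trans.
Qed.

Lemma cvg_pow s C : 0 <= s < 1 -> C * s ^+ n @[n --> \oo] --> 0.
Proof.
move=> /andP[s0 s1]; rewrite -[X in _ --> X](mulr0 C); apply: cvgMr.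
by apply: cvg_expr; rewrite ger0_norm.
Qed.

(** The witness is the sequence of tails, t n being the sum of u i over i >= n. *)
Lemma expb_tail u C s : 0 <= s < 1 -> expb C s u ->
  exists t, [/\ forall n, u n = t n - t n.+1, expb (C / (1 - s)) s t &
    series u n @[n --> \oo] --> t 0%N].
Proof.
move=> s01 hu; have /andP[s0 s1] := s01; have s1' : 0 < 1 - s by rewrite subr_gt0.
have C0 : 0 <= C by have := hu 0%N; rewrite expr0 mulr1; exact: le_trans.
have B n m : `|series u (m + n)%N - series u n| <= C / (1 - s) * s ^+ n.
  have -> : series u (m + n)%N - series u n = \sum_(i < m) u (n + i)%N.
    by elim: m => [|m IH]; rewrite ?big_ord0 ?subrr // big_ord_recr /= -IH addSn seriesSr addnC; ring.
  apply: le_trans (ler_norm_sum _ _ _) _.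
  apply: (@le_trans _ _ (\sum_(i < m) C * s ^+ n * s ^+ i)).
    by apply: ler_sum => i _; rewrite -mulrA -exprD.
  by rewrite -mulr_sumr [X in _ <= X]mulrAC ler_wpM2l ?sum_geo ?mulr_ge0 ?exprn_ge0.
have cv : cvgn (series u).
  apply: normed_cvg; apply: nondecreasing_is_cvgn.
    by apply/nondecreasing_seqP => n; rewrite /= seriesSr lerDl.
  exists (C / (1 - s)) => _ [n _ <-].
  rewrite /= /series /= big_mkord.
  apply: (@le_trans _ _ (\sum_(i < n) C * s ^+ i)); first by apply: ler_sum => i _.
  by rewrite -mulr_sumr ler_wpM2l // sum_geo.
exists (fun n => limn (series u) - series u n); split.
- by move=> n; rewrite seriesSr; ring.
- move=> n; apply: (@cvgn_norm_le R (fun m => series u (m + n)%N - series u n)) => //.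
  by apply: cvgB; [rewrite cvg_shiftn|exact: cvg_cst].
- by rewrite /series /= big_geq // subr0.
Qed.

Lemma expb_conv u p C s K : 0 <= s < 1 -> expb C s u -> (forall n, `|p n| <= K) ->
  forall n, exists2 L, series (fun i => u i * p (n + i)%N) m @[m --> \oo] --> L &
    `|L| <= C * K / (1 - s).
Proof.
move=> s01 hu pK n; have C0 : 0 <= C by have := hu 0%N; rewrite expr0 mulr1; exact: le_trans.
have [|t [_ ht cv]] := @expb_tail (fun i => u i * p (n + i)%N) (C * K) s s01.
  by move=> i; rewrite normrM mulrAC ler_pM.
by exists (t 0%N) => //; have := ht 0%N; rewrite expr0 mulr1.
Qed.

Definition conv u p n := limn (series (fun i => u i * p (n + i)%N)).

Lemma cvg_conv u p C s K n : 0 <= s < 1 -> expb C s u -> (forall n, `|p n| <= K) ->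
  series (fun i => u i * p (n + i)%N) m @[m --> \oo] --> conv u p n.
Proof.
move=> s01 hu pK; have [L h _] := expb_conv s01 hu pK n.
by rewrite /conv (cvg_lim _ h).
Qed.

Lemma conv_le u p C s K n : 0 <= s < 1 -> expb C s u -> (forall n, `|p n| <= K) ->
  `|conv u p n| <= C * K / (1 - s).
Proof.
move=> s01 hu pK; have [L h hL] := expb_conv s01 hu pK n.
by rewrite /conv (cvg_lim _ h).
Qed.

(** If the total sum is zero, a partial sum is minus a tail. *)
Lemma expb_series u C s : 0 <= s < 1 -> expb C s u -> series u n @[n --> \oo] --> 0 ->
  forall n, `|series u n| <= C / (1 - s) * s ^+ n.
Proof.
move=> s01 hu u0 n; have [t [ut ht cv]] := expb_tail s01 hu.
have t0 : t 0%N = 0 by apply: cvg_unique cv u0.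
suff -> : series u n = - t n by rewrite normrN.
elim: n => [|n IH]; first by rewrite /series /= big_geq // t0 oppr0.
by rewrite seriesSr IH ut; ring.
Qed.

(** Summation by parts: [u i] is the increment of the partial sums, and the boundary term vanishes
    because a zero total makes them decay. This can be repeated if the partial sums again have zero
    sum. *)
Lemma conv_diff u p C s K n : 0 <= s < 1 -> expb C s u ->
  series u n @[n --> \oo] --> 0 -> (forall n, `|p n| <= K) ->
  conv u p n = conv (fun i => series u i.+1) p n - conv (fun i => series u i.+1) p n.+1.
Proof.
move=> s01 hu u0 pK; have /andP[s0 s1] := s01.
have hA := expb_series s01 hu u0.
have C0 : 0 <= C by have := hu 0%N; rewrite expr0 mulr1; exact: le_trans.
have K0 : 0 <= K by exact: le_trans (pK 0%N).
have hA' : expb (C / (1 - s)) s (fun i => series u i.+1).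
  move=> i; apply: le_trans (hA _) _; rewrite exprS mulrCA ler_piMl //.
    by rewrite mulr_ge0 ?exprn_ge0 // divr_ge0 // subr_ge0 ltW.
  exact: ltW.
have E m : series (fun i => u i * p (n + i)%N) m =
  series (fun i => series u i.+1 * p (n + i)%N) m -
  series (fun i => series u i.+1 * p (n.+1 + i)%N) m + series u m * p (n + m)%N.
  elim: m => [|m IH]; first by rewrite /series /= !big_geq //; ring.
  rewrite (seriesSr _ m) IH (seriesSr (fun i => _ * p (n + i)%N)) (seriesSr (fun i => _ * p (n.+1 + i)%N)).
  by rewrite !seriesSr addSnnS; ring.
suff h2 : series (fun i => u i * p (n + i)%N) m @[m --> \oo] -->
    conv (fun i => series u i.+1) p n - conv (fun i => series u i.+1) p n.+1.
  by rewrite {1}/conv; exact: (cvg_lim (@Rhausdorff R) h2).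
rewrite (funext E) -[X in _ --> X]addr0; apply: cvgD.
  by apply: cvgB; exact: cvg_conv s01 hA' pK.
apply: (@cvg_squeeze0 _ (fun m => C / (1 - s) * K * s ^+ m)); last exact: cvg_pow.
by move=> m; rewrite normrM mulrAC ler_pM.
Qed.

Lemma mul_pow_le s n : 0 <= s < 1 -> n%:R * s ^+ n <= (1 - s)^-1.
Proof.
move=> s01; have /andP[s0 s1] := s01; apply: le_trans (sum_geo n s01).
rewrite -[X in X%:R](card_ord n) mulr_natl -sumr_const; apply: ler_sum => i _.
by apply: ler_wiXn2l; [exact: s0|exact: ltW|exact: ltnW].
Qed.

Lemma cvg_mul_pow s C : 0 <= s < 1 -> C * (n%:R * s ^+ n) @[n --> \oo] --> 0.
Proof.
(* A rate strictly between [s] and 1 absorbs the linear factor. *)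
move=> /andP[s0 s1]; pose r := (1 + s) / 2.
have r0 : 0 < r by rewrite /r; lra.
have r1 : r < 1 by rewrite /r; lra.
have sr : 0 <= s / r < 1 by rewrite divr_ge0 ?(ltW r0) //= ltr_pdivrMr // mul1r /r; lra.
apply: (@cvg_squeeze0 _ (fun n => `|C| * (1 - s / r)^-1 * r ^+ n)); last first.
  by apply: cvg_pow; rewrite ltW.
move=> n; rewrite normrM -mulrA ler_wpM2l // normrM !ger0_norm ?exprn_ge0 //.
have -> : s ^+ n = (s / r) ^+ n * r ^+ n by rewrite -exprMn divfK ?gt_eqF.
by rewrite mulrA ler_wpM2r ?exprn_ge0 ?(ltW r0) // mul_pow_le.
Qed.

(** Exchanging the order of summation, the sum of the first n partial sums is n times the n-th
    partial sum minus the truncated first moment. This translates the additional hypothesis into a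
    second zero sum. *)
Lemma cvg_series_series u C s : 0 <= s < 1 -> expb C s u ->
  series u n @[n --> \oo] --> 0 ->
  series (fun i => i%:R * u i) n @[n --> \oo] --> 0 ->
  series (fun i => series u i.+1) n @[n --> \oo] --> 0.
Proof.
move=> s01 hu u0 u1; have hA := expb_series s01 hu u0.
have E n : series (fun i => series u i.+1) n = n%:R * series u n - series (fun i => i%:R * u i) n.
  elim: n => [|n IH]; first by rewrite /series /= !big_geq // mul0r subr0.
  by rewrite seriesSr IH !seriesSr -natr1; ring.
rewrite (funext E) -[X in _ --> X]subr0; apply: cvgB => //.
apply: (@cvg_squeeze0 _ (fun m => C / (1 - s) * (m%:R * s ^+ m))); last exact: cvg_mul_pow.
by move=> m; rewrite normrM mulrCA ger0_norm // ler_wpM2l.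
Qed.

(* Twofold Abel summation: [delta] need not converge. *)
Lemma abel_second_difference delta D z (a : nat -> R) : 0 < z < 1 ->
  (forall n, `|delta n| <= D) ->
  (forall n, a n = (delta n - delta n.+1) - (delta n.+1 - delta n.+2)) ->
  `|limn (series (fun n => z ^+ n * a n)) - (delta 0%N - delta 1%N)| <= 3 * D * (1 - z).
Proof.
move=> /andP[z0 z1] dD aE.
have D0 : 0 <= D by exact: le_trans (dD 0%N).
pose g n := delta n - delta n.+1.
pose Q n := series (fun n => z ^+ n * delta n.+2) n.
pose P n := series (fun n => z ^+ n * g n.+1) n.
have EP n : P n = delta 1%N - (1 - z) * Q n - z ^+ n * delta n.+1.
  elim: n => [|n IH]; first by rewrite /P /Q /series /= !big_geq // expr0; ring.
  by rewrite /P /Q !seriesSr -/(P n) -/(Q n) IH /g exprS; ring.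
have EA n : series (fun n => z ^+ n * a n) n - g 0%N = - (1 - z) * P n - z ^+ n * g n.
  elim: n => [|n IH]; first by rewrite /P /series /= !big_geq // expr0; ring.
  by rewrite /P !seriesSr -/(P n) addrAC IH aE -/(g n) -/(g n.+1) exprS; ring.
have QD n : (1 - z) * `|Q n| <= D.
  have : `|Q n| <= \sum_(i < n) z ^+ i * D.
    rewrite /Q /series /= big_mkord; apply: le_trans (ler_norm_sum _ _ _) _.
    apply: ler_sum => i _; rewrite normrM (ger0_norm (exprn_ge0 _ (ltW z0))).
    by rewrite ler_wpM2l // exprn_ge0 // ltW.
  rewrite -mulr_suml => h.
  have z10 : 0 < 1 - z by rewrite subr_gt0.
  rewrite -ler_pdivlMl //; apply: le_trans h _; rewrite ler_wpM2r //.
  by apply: sum_geo; rewrite ltW.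
have zn n : 0 <= z ^+ n <= 1 by rewrite exprn_ge0 ?exprn_ile1 // ltW.
(* The three terms of [EP] contribute [D] each; the geometric sum in [Q] is compensated by the
   factor [1 - z]. *)
have PD n : `|P n| <= 3 * D.
  rewrite EP; have := ler_normB (delta 1%N - (1 - z) * Q n) (z ^+ n * delta n.+1).
  have := ler_normB (delta 1%N) ((1 - z) * Q n); rewrite !normrM.
  have z10 : 0 <= 1 - z by rewrite subr_ge0 ltW.
  have /andP[p0 p1] := zn n.
  rewrite (ger0_norm z10) (ger0_norm p0); have := QD n; have := dD 1%N.
  have : z ^+ n * `|delta n.+1| <= 1 * D by exact: ler_pM.
  lra.
have gD n : `|g n| <= 2 * D.
  have := ler_normB (delta n) (delta n.+1); have := dD n; have := dD n.+1; rewrite /g; lra.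
have [||t [_ _ cv]] := @expb_tail (fun n => z ^+ n * a n) (4 * D) z.
- by rewrite ltW.
- move=> n; rewrite normrM mulrC ler_pM //; last by rewrite ger0_norm //; case/andP: (zn n).
  by rewrite aE -/(g n) -/(g n.+1); have := ler_normB (g n) (g n.+1); have := gD n; have := gD n.+1; lra.
rewrite (cvg_lim _ cv) //; apply/ler_addgt0Pr => k k0.
have k2 : 0 < k / 2 by rewrite divr_gt0.
have /cvgrPdist_le /(_ _ k2)[n1 _ h1] := cv.
have z01 : 0 <= z < 1 by rewrite ltW.
have /cvgrPdist_le /(_ _ k2)[n2 _ h2] := cvg_pow (2 * D) z01.
pose n := maxn n1 n2; have := h1 n (leq_maxl _ _); have := h2 n (leq_maxr _ _).
rewrite /= sub0r normrN ger0_norm; last by rewrite mulr_ge0 ?exprn_ge0 ?mulr_ge0 // ltW.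
have := EA n; set S := series _ n; clearbody S => e1 h3 h4.
have -> : t 0%N - (delta 0%N - delta 1%N) = (t 0%N - S) + (- (1 - z) * P n - z ^+ n * g n).
  by rewrite -e1 /g; ring.
have q1 : `|- (1 - z) * P n| <= (1 - z) * (3 * D).
  rewrite mulNr normrN normrM ger0_norm ?subr_ge0 ?(ltW z1) //.
  by rewrite ler_wpM2l // subr_ge0 ltW.
have q2 : `|z ^+ n * g n| <= z ^+ n * (2 * D).
  by have /andP[p0 p1] := zn n; rewrite normrM ger0_norm // ler_wpM2l.
have := ler_normD (t 0%N - S) (- (1 - z) * P n - z ^+ n * g n).
have := ler_normB (- (1 - z) * P n) (z ^+ n * g n); lra.
Qed.

End exponential_sequences.

(** * Bounded variation and differentiation *)

Section bounded_variation.
Context {R : realType}.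
Notation mu := (@lebesgue_measure R).
Implicit Types (x y s t u a b : R) (f v : R -> R).

(** Bounded variation enters later only as a majorant [v] of increments, here the total variation
    from [a]. Measurability and one-sided limits follow by writing [f] as the difference of the
    monotone functions [f + v] and [v]. *)
Lemma bv_control a b f : a <= b -> bounded_variation a b f ->
  exists v, forall s t, a <= s -> s <= t -> t <= b -> `|f t - f s| <= v t - v s.
Proof.
move=> ab bv; exists (fun x => fine (total_variation a x f)) => s t as_ st tb.
have fin x y : a <= x -> x <= y -> y <= b -> total_variation x y f \is a fin_num.
  move=> ax xy yb; apply/bounded_variationP => //.
  exact: (bounded_variationr ax xy (bounded_variationl (le_trans ax xy) yb bv)).
rewrite (total_variationD f as_ st) fineD ?fin // ?(le_trans st) // addrAC subrr add0r.
rewrite -lee_fin fineK ?fin //; exact: total_variation_ge.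
Qed.

Lemma mono_bmeas a b v : a <= b -> (forall s t, a <= s -> s <= t -> t <= b -> v s <= v t) ->
  bmeas a b v.
Proof.
move=> ab vm; split; last first.
  exists (`|v a| + `|v b|) => t /andP[at_ tb]; rewrite ler_norml.
  have := vm a t (lexx a) at_ tb; have := vm t b at_ tb (lexx b).
  have := ler_norm (v b); have := ler_norm (- v a); rewrite normrN.
  have := normr_ge0 (v a); have := normr_ge0 (v b).
  move=> *; apply/andP; split; lra.
pose cl x := Num.min b (Num.max a x).
have clm x y : x <= y -> cl x <= cl y.
  by move=> xy; rewrite /cl le_min ge_min lexx /= ge_min ge_max !le_max lexx xy !orbT.
have clab x : a <= cl x <= b by rewrite /cl le_min ab ge_min lexx le_max lexx.
apply: (@eq_measurable_fun _ _ _ _ _ (v \o cl)) => [x|].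
  by rewrite inE /= in_itv /= => /andP[ax xb]; rewrite /= /cl max_r // min_r.
apply: nondecreasing_measurable => // x y /clm h /=.
by case/andP: (clab x) => h1 _; case/andP: (clab y) => _ h2; exact: vm.
Qed.

Lemma control_bmeas a b f v : a <= b ->
  (forall s t, a <= s -> s <= t -> t <= b -> `|f t - f s| <= v t - v s) -> bmeas a b f.
Proof.
move=> ab h; apply: (@eq_bmeas _ _ _ (fun t => (f t + v t) - v t)) => [t _|]; first by ring.
have h' s t : a <= s -> s <= t -> t <= b -> - (v t - v s) <= f t - f s /\ f t - f s <= v t - v s.
  by move=> as_ st tb; have := h s t as_ st tb; rewrite ler_norml => /andP[].
apply: bmeasB; apply: mono_bmeas => // s t as_ st tb; have [] := h' s t as_ st tb; lra.
Qed.

Lemma control_right a b f v u : a <= u -> u < b ->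
  (forall s t, a <= s -> s <= t -> t <= b -> `|f t - f s| <= v t - v s) ->
  exists l : R, f y @[y --> u^'+] --> l.
Proof.
move=> au ub h.
have mono (g : R -> R) : (forall s t, a <= s -> s <= t -> t <= b -> g s <= g t) -> cvg (g y @[y --> u^'+]).
  move=> gm; apply/cvg_ex; eexists.
  apply: (@nondecreasing_at_right_cvgr _ g u (BRight b)); first by rewrite bnd_simp.
    move=> s t; rewrite !in_itv /= => /andP[us sb] /andP[ut tb] st.
    by apply: gm => //; exact: le_trans au (ltW us).
  exists (g u) => z [s]; rewrite /= in_itv /= => /andP[us sb] <-.
  by apply: gm => //; exact: ltW.
have h' s t : a <= s -> s <= t -> t <= b -> - (v t - v s) <= f t - f s /\ f t - f s <= v t - v s.
  by move=> as_ st tb; have := h s t as_ st tb; rewrite ler_norml => /andP[].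
have c1 : cvg ((fun y => f y + v y) y @[y --> u^'+]).
  by apply: mono => s t as_ st tb; have [] := h' s t as_ st tb; lra.
have c2 : cvg (v y @[y --> u^'+]).
  by apply: mono => s t as_ st tb; have [] := h' s t as_ st tb; lra.
exists (lim ((fun y => f y + v y) y @[y --> u^'+]) - lim (v y @[y --> u^'+])).
by apply: cvg_trans (cvgB c1 c2); apply: near_eq_cvg; apply: nearW => y /=; rewrite addrK.
Qed.

Lemma control_left a b f v u : a < u -> u <= b ->
  (forall s t, a <= s -> s <= t -> t <= b -> `|f t - f s| <= v t - v s) ->
  exists l : R, f y @[y --> u^'-] --> l.
Proof.
move=> au ub h.
have [|||l hl] := @control_right (- b) (- a) (f \o -%R) (fun t => - v (- t)) (- u).
- by rewrite lerN2.
- by rewrite ltrN2.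
-  move=> s t bs st ta /=; have := h (- t) (- s) ltac:(lra) ltac:(lra) ltac:(lra).
  by rewrite distrC; lra.
by exists l; apply/cvg_at_leftNP.
Qed.

(** Lebesgue differentiation, after extending the density by 0 to the line. It converts the
    [derive1] in [Psi] and in [source] into densities. *)
Lemma prim_derive x y f v : x < y -> prim x y f v -> exists2 N : set R, mu.-negligible N &
  forall t, x < t < y -> ~ N t -> derive1 f t = v t.
Proof.
move=> xy [iv hv]; pose q := v \_ `[x, y].
have iq : mu.-integrable setT (EFin \o q).
  rewrite -restrict_EFin.
  apply/(iffLR (@integrable_mkcond _ _ R mu `[x, y]%classic (EFin \o v) (measurable_itv _))).
  exact: iv.
have [N nN hN] : exists2 N : set R, mu.-negligible N & forall t, ~ N t ->
   x < t -> derive1 (fun y => \int[mu]_(t in `[x, y]) q t) t = q t.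
  have i1 y' : mu.-integrable [set` Interval (BLeft x) (BRight y')] (EFin \o q).
    by apply: integrableS iq => //; exact: measurable_itv.
  have i2 : locally_integrable setT q by apply: open_integrable_locally iq; exact: openT.
  have [A [mA A0 hA]] := FTC1 i1 i2.
  exists A; first by exists A; split; [exact: mA|exact: A0|by move=> ?].
  move=> t nt xt; apply: contrapT => H; apply: nt; apply: hA => /= K.
  by have [|] := K _; rewrite ?lte_fin.
exists N => // t /andP[xt ty] nt.
have -> : v t = q t by rewrite /q patchE mem_set //= in_itv /= !ltW.
rewrite -hN //.
pose d := Num.min (t - x) (y - t).
have d0 : 0 < d by rewrite lt_min !subr_gt0 xt.
have E s : x <= s <= y -> f s = \int[mu]_(t in `[x, s]) q t + f x.
  move=> /andP[xs sy]; have -> : \int[mu]_(t in `[x, s]) q t = Int x s v.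
    apply: eq_Int => r /andP[xr rs]; rewrite /q patchE mem_set //= in_itv /= xr.
    exact: le_trans rs sy.
  by rewrite -hv // subrK.
rewrite /derive1; congr (lim _); rewrite eqEsubset; split; apply: near_eq_cvg;
  rewrite /dnbhs near_withinE; apply/nbhs_ballP; exists d => // h;
  rewrite /ball /= sub0r normrN => hd _ ; rewrite (E t) ?(ltW xt) ?(ltW ty) // (E (h + t)).
- by congr (_ *: _); ring.
- move: hd; rewrite lt_min ltr_norml => /andP[/andP[h1 h2]]; rewrite ltr_norml => /andP[h3 h4].
  by apply/andP; split; lra.
- by congr (_ *: _); ring.
- move: hd; rewrite lt_min ltr_norml => /andP[/andP[h1 h2]]; rewrite ltr_norml => /andP[h3 h4].
  by apply/andP; split; lra.
Qed.

End bounded_variation.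

Lemma cvgn_unique (R : realType) (u : nat -> R) (s t : R) :
  u n @[n --> \oo] --> s -> u n @[n --> \oo] --> t -> s = t.
Proof. by move=> h1 h2; apply: cvg_unique h1 h2. Qed.

(** * The structure of the invariant density *)

Section structure.
Context {R : realType}.
Notation mu := (@lebesgue_measure R).
Implicit Types (x y z s t k C V : R) (u v q Q p P : R -> R) (n i j K : nat) (e : bool).
Variables (a c b th : R) (f : R -> R) (w dw : bool -> R -> R).
Hypothesis ex : expanding a c b th f w dw.
Hypotheses (fa : f a = a) (fb : f b = a).
Notation lo := (blo a c).
Notation hi := (bhi c b).
Notation tr := (tr a c b f w).
Notation ibr := (ibr a c b f).
Notation orb i := (iter i f (f c)).

Let ac : a < c. Proof. by have /andP[] := ex_acb ex. Qed.
Let cb : c < b. Proof. by have /andP[] := ex_acb ex. Qed.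
Let ab : a < b. Proof. exact: ex_ab ex. Qed.
Let afc : a <= f c. Proof. by have /andP[] := crit_ab ex. Qed.
Let fcb : f c <= b. Proof. by have /andP[] := crit_ab ex. Qed.
Let th0 : 0 < th. Proof. by have /andP[] := ex_th ex. Qed.
Let th1 : th < 1. Proof. by have /andP[] := ex_th ex. Qed.

Definition wv t := if t < c then w true t else if c < t then w false t else 0.

(* The weight vanishes after the first passage at [c], since [wv c = 0]. *)
Fixpoint sg kappa n : R := if n is i.+1 then sg kappa i * wv (orb i) else kappa.

(** The sum of the first [K] steps along the orbit of [f c]. It differs from the normalization of
    [step_fun] only at orbit points, which belong to the exceptional set. A point visited several
    times carries several steps. *)
Definition sal kappa K t := - \sum_(i < K) (if t < orb i then sg kappa i else 0).

Lemma orb_ab i : a <= orb i <= b.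
Proof. exact: (ex_iter ex i (crit_ab ex)). Qed.

Lemma orb_le i : orb i <= f c.
Proof. by case: i => // i; rewrite iterS; apply: crit_max ex _ (orb_ab i). Qed.

Lemma wv_le t : a <= t <= b -> `|wv t| <= th.
Proof.
move=> /andP[at_ tb]; rewrite /wv; case: ltP => [tc|ct].
  by apply: (ex_w_le ex); rewrite /= at_ ltW.
by case: ltP => _; [apply: (ex_w_le ex); rewrite /= ct|rewrite normr0 ltW].
Qed.

Lemma sg_le kappa n : `|sg kappa n| <= `|kappa| * th ^+ n.
Proof.
elim: n => [|n IH]; first by rewrite mulr1.
by rewrite /= normrM exprSr mulrA ler_pM // wv_le // orb_ab.
Qed.

Lemma crit_unique t : a <= t <= b -> f t = f c -> t = c.
Proof.
move=> /andP[at_ tb] E; have [tc|ct|//] := ltgtP t c.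
  by have m : incr a c f := ex_mono ex true; have := m t c at_ tc (lexx c); rewrite E ltxx.
by have m : decr c b f := ex_mono ex false; have := m c t (lexx c) ct tb; rewrite E ltxx.
Qed.

Lemma sg_crit kappa i : orb i.+1 = f c -> sg kappa i.+1 = 0.
Proof.
by move=> /(crit_unique (orb_ab i)) /= ->; rewrite /wv ltxx mulr0.
Qed.

Lemma glue_w_le t : a <= t <= b -> `|glue c w t| <= th.
Proof.
move=> /andP[at_ tb]; rewrite /glue; case: (leP t c) => h.
  by apply: (ex_w_le ex); rewrite /= at_.
by apply: (ex_w_le ex); rewrite /= tb ltW.
Qed.

(** Integration by parts for [w] against a single step: besides the integral of [dw], the jump at
    [z] contributes the value of [w] there. *)
Lemma step_parts e x y z : lo e <= x -> x < y -> y <= hi e -> z != x -> z != y ->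
  (if y < z then w e y else 0) - (if x < z then w e x else 0) =
  Int x y (fun t => if t < z then dw e t else 0) - (if x < z < y then w e z else 0).
Proof.
move=> lx xy yh zx zy; have [id hd] := primS lx yh (ex_w ex e).
have [zx'|xz|E] := ltgtP z x; last by rewrite E eqxx in zx.
  rewrite ltNge (ltW (lt_trans zx' xy)) /= subrr subr0.
  rewrite (@Int_oo _ _ _ _ (fun=> 0)) ?Int_cst ?mul0r ?(ltW xy) // => t /andP[xt _].
  by rewrite ltNge (ltW (lt_trans zx' xt)).
have [zy'|yz|E] := ltgtP z y; last by rewrite E eqxx in zy.
- rewrite /= sub0r; have i1 : intg x y (fun t => if t < z then dw e t else 0).
    apply: bmeas_intg; apply: (@eq_bmeas _ _ _ (fun t => if z <= t then 0 else dw e t)).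
      by move=> t _; rewrite leNgt; case: ltP.
    have [m [D hD]] := bmeasS lx yh (ex_dw ex e); split; last first.
      exists `|D| => t /hD h; case: ifP; rewrite ?normr0 // => _; exact: le_trans h (ler_norm _).
    apply: measurable_fun_if => //; first exact: measurable_fun_ler.
    by apply: measurable_funS m => // t [].
  rewrite (@Int_cat _ z) ?(ltW xz) ?(ltW zy') //.
  rewrite (@Int_oo _ x z _ (dw e)) => [|t /andP[_ ->]//].
  rewrite (@Int_oo _ z y _ (fun=> 0)) => [|t /andP[zt _]]; last by rewrite ltNge ltW.
  by rewrite -hd ?(ltW xz) ?(ltW zy') // Int_cst ?(ltW zy') // mul0r; ring.
- rewrite (@Int_oo _ x y _ (dw e)) => [|t /andP[_ ty]]; last by rewrite (lt_trans ty yz).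
  by rewrite -hd ?(ltW xy) //= subr0.
Qed.

Lemma bmeas_sal kappa K : bmeas a b (sal kappa K).
Proof.
apply: bmeasN; elim: K => [|K IH].
  by apply: (eq_bmeas _ (bmeas_cst a b 0)) => t _; rewrite big_ord0.
apply: (@eq_bmeas _ _ _ (fun t => \sum_(i < K) (if t < orb i then sg kappa i else 0) +
  (if t < orb K then sg kappa K else 0))) => [t _|]; first by rewrite big_ord_recr.
apply: bmeasD => //; split; last first.
  by exists `|sg kappa K| => t _; case: ifP; rewrite ?normr0.
by apply: measurable_fun_if => //; apply: measurable_fun_ltr.
Qed.

Lemma sal_parts kappa K e x y : lo e <= x -> x < y -> y <= hi e ->
  (forall i, orb i != x) -> (forall i, orb i != y) ->
  sal kappa K y * w e y - sal kappa K x * w e x =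
  Int x y (fun t => sal kappa K t * dw e t) +
  \sum_(i < K) (if x < orb i < y then sg kappa i * w e (orb i) else 0).
Proof.
move=> lx xy yh ox oy; have [la [hb _]] := ex_lohi ex e.
elim: K => [|K IH].
  rewrite (@eq_Int _ _ _ _ (fun=> 0)) => [|t _]; last by rewrite /sal big_ord0 oppr0 mul0r.
  by rewrite /sal !big_ord0 Int_cst ?(ltW xy) // oppr0 !mul0r subrr addr0.
have E t : sal kappa K.+1 t = sal kappa K t - (if t < orb K then sg kappa K else 0).
  by rewrite /sal big_ord_recr /= opprD.
have bd := bmeasS lx yh (ex_dw ex e).
have i1 : intg x y (fun t => sal kappa K t * dw e t).
  by apply/bmeas_intg/bmeasM => //; apply: bmeasS (bmeas_sal _ _); rewrite ?(le_trans la) ?(le_trans yh).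
have i2 : intg x y (fun t => if t < orb K then dw e t else 0).
  have [m [D hD]] := bd; apply: bmeas_intg; split; last first.
    exists `|D| => t /hD h; case: ifP; rewrite ?normr0 // => _; exact: le_trans h (ler_norm _).
  apply: measurable_fun_if => //; first exact: measurable_fun_ltr.
  by apply: measurable_funS m => // t [].
rewrite (@eq_Int _ _ _ _ (fun t => sal kappa K t * dw e t -
  sg kappa K * (if t < orb K then dw e t else 0))); last first.
  by move=> t _; rewrite E; case: ifP => _; ring.
rewrite IntB //; last exact: intgZ.
rewrite IntZ // big_ord_recr /= !E.
have S := step_parts lx xy yh (ox K) (oy K).
rewrite -[Int x y (fun t => if t < orb K then dw e t else 0)](subrK (if x < orb K < y then w e (orb K) else 0)) -S.
move: IH; set I := Int _ _ _; set B := \sum_(i < K) _ => IH.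
have -> : I = sal kappa K y * w e y - sal kappa K x * w e x - B by rewrite IH; ring.
by case: (y < orb K); case: (x < orb K); case: (orb K < y) => /=; ring.
Qed.

Variables (rho : R -> R) (vrho : R -> R) (kappa : R).
Hypothesis rho_ctrl : forall s t, a <= s -> s <= t -> t <= b -> `|rho t - rho s| <= vrho t - vrho s.

Let brho : bmeas a b rho. Proof. exact: control_bmeas (ltW ab) rho_ctrl. Qed.
Let bgw : bmeas a b (glue c w).
Proof. apply: (bmeas_glue ex) => e; exact: prim_bmeas (ex_w ex e). Qed.
Let bgdw : bmeas a b (glue c dw).
Proof. apply: (bmeas_glue ex) => e; exact: ex_dw ex e. Qed.

(* [dens n] is the [n]-th term of the Neumann series of [H = tr (dw * rho + w * H)]. *)
Definition dens n := iter n (fun u => tr (fun t => glue c w t * u t))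
  (tr (fun t => glue c dw t * rho t)).

Lemma intg_dens n : intg a b (dens n).
Proof.
elim: n => [|n IH] /=; apply: (intg_tr ex fa fb); apply: intgM => //; exact: bmeas_intg.
Qed.

Lemma dens_norm n : Int a b (fun t => `|dens n t|) <= Int a b (fun t => `|dens 0 t|) * th ^+ n.
Proof.
elim: n => [|n IH]; first by rewrite mulr1.
rewrite exprSr mulrA; apply: le_trans (ler_wpM2r (ltW th0) IH).
have i := intgM bgw (intg_dens n).
apply: le_trans (Int_tr_norm ex fa fb i) _; rewrite mulrC -IntZ; last exact/intg_norm/intg_dens.
apply: le_Int; [exact: intg_norm|exact/intgZ/intg_norm/intg_dens|].
by move=> t tab; rewrite normrM ler_wpM2r // glue_w_le.
Qed.

Lemma dens_out n t : f c < t -> dens n t = 0.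
Proof. by case: n => [|n] h /=; apply: tr_out. Qed.

Lemma Int_dens n q : bmeas a b q ->
  Int a b (fun t => dens n.+1 t * q t) = Int a b (fun t => dens n t * (glue c w t * q (f t))).
Proof.
move=> bq; have -> : dens n.+1 = tr (fun t => glue c w t * dens n t) by [].
rewrite (Int_tr ex fa fb) //; last exact: intgM (intg_dens n).
by apply: eq_Int => t _; ring.
Qed.

Lemma Int_dens0 q : bmeas a b q ->
  Int a b (fun t => dens 0 t * q t) = Int a b (fun t => rho t * (glue c dw t * q (f t))).
Proof.
move=> bq; rewrite [LHS](Int_tr ex fa fb) //; last by apply: intgM => //; exact: bmeas_intg.
by apply: eq_Int => t _; ring.
Qed.

(** Differentiating [rho = tr rho] away from the jumps gives [H = tr (dw * rho + w * H)], recorded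
    in integrated form. The series clause later allows [H] to be truncated to terms that act as
    functionals of bounded variation. *)
Definition regular_density H :=
  [/\ intg a b H, forall t, f c < t -> t <= b -> H t = 0,
    (forall q, bmeas a b q -> series (fun n => Int a b (fun t => dens n t * q t)) n @[n --> \oo] -->
      Int a b (fun t => H t * q t)) &
    (forall x y, a <= x -> x <= y -> y <= f c -> Int x y H =
      Int x y (tr (fun t => glue c dw t * rho t + glue c w t * H t)))].

Lemma regular_density_exists : exists H, regular_density H.
Proof.
have th01 : 0 <= th < 1 by rewrite ltW.
have [N [H0 [nN iH0 Hs HI]]] := L1_series (ltW ab) th01 intg_dens dens_norm.
(* Makes [H] vanish everywhere beyond [f c], where [H0] is known to vanish only almost
   everywhere. *)
pose H t := if t <= f c then H0 t else 0.
have HE t : a <= t <= b -> ~ N t -> H0 t = H t.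
  move=> tab nt; rewrite /H; case: leP => // h; have h0 : series (dens^~ t) n @[n --> \oo] --> 0.
    rewrite (_ : series _ = fun=> 0); first exact: cvg_cst.
    by apply/funext => n; rewrite /series /= big1 // => i _; rewrite dens_out.
  exact: cvgn_unique (Hs t tab nt) h0.
have iH : intg a b H.
  apply: (@intg_cat _ (f c)) => //.
    by apply: (eq_intg _ (intgS (lexx a) fcb iH0)) => t /andP[_ tc]; rewrite /H tc.
  by apply: (intg_oo _ (intg_cst (f c) b 0)) => t /andP[ct _]; rewrite /H leNgt ct.
have HI' q : bmeas a b q -> series (fun n => Int a b (fun t => dens n t * q t)) n @[n --> \oo] -->
      Int a b (fun t => H t * q t).
  move=> bq; rewrite -(Int_ae nN (f := fun t => H0 t * q t)); first exact: HI.
  by move=> t tab nt; rewrite HE.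
exists H; split => // [t h _|x y ax xy yc]; first by rewrite /H leNgt h.
pose q t : R := if t <= y then (if x <= t then 1 else 0) else 0.
have bq : bmeas a b q.
  split; last by exists 1 => t _; rewrite /q; case: (t <= y); case: (x <= t); rewrite ?normr1 ?normr0.
  apply: measurable_fun_if => //; first exact: measurable_fun_ler.
  by apply: measurable_fun_if => //; apply: measurable_fun_ler.
have yb := le_trans yc fcb.
have qI (g : R -> R) : intg a b g -> Int x y g = Int a b (fun t => g t * q t).
  move=> ig; have igq : intg a b (fun t => g t * q t).
    by apply: (eq_intg _ (intgM bq ig)) => t _; rewrite mulrC.
  rewrite (@Int_cat _ x a b) ?(le_trans xy) //.
  rewrite (@Int_cat _ y x b) //; last exact: intgS igq.
  rewrite (@Int_oo _ a x _ (fun=> 0)) => [|t /andP[_ tx]]; last first.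
    by rewrite /q [x <= t]leNgt tx; case: ifP; rewrite mulr0.
  rewrite (@Int_oo _ y b _ (fun=> 0)) => [|t /andP[yt _]]; last first.
    by rewrite /q leNgt yt mulr0.
  rewrite !Int_cst // !mul0r add0r addr0; apply: eq_Int => t /andP[xt ty].
  by rewrite /q xt ty mulr1.
have iu : intg a b (fun t => glue c dw t * rho t + glue c w t * H t).
  by apply: intgD; apply: intgM => //; exact: bmeas_intg.
rewrite !qI //; last exact: (intg_tr ex fa fb).
rewrite (Int_tr ex fa fb) //.
have bqf : bmeas a b (fun t => q (f t)) := bmeas_comp_f ex bq.
have bwq : bmeas a b (fun t => glue c w t * q (f t)) by exact: bmeasM.
have h1 := HI' _ bwq.
(* The same series without its first partial sum. [Int_dens] rewrites it as the head [dens 0] plus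
   the series tested against [w * (q o f)], and uniqueness of limits gives the equation. *)
have h2 : series (fun n => Int a b (fun t => dens n t * q t)) n.+1 @[n --> \oo] -->
    Int a b (fun t => H t * q t).
  by have := HI' _ bq; rewrite -(cvg_shiftS (series _)).
have E n : series (fun n => Int a b (fun t => dens n t * q t)) n.+1 =
  Int a b (fun t => rho t * (glue c dw t * q (f t))) +
  series (fun n => Int a b (fun t => dens n t * (glue c w t * q (f t)))) n.
  elim: n => [|n IH]; first by rewrite seriesSr /series /= !big_geq // add0r addr0 Int_dens0.
  by rewrite seriesSr IH Int_dens // -addrA -seriesSr.
have h3 : series (fun n => Int a b (fun t => dens n t * q t)) n.+1 @[n --> \oo] -->
    Int a b (fun t => rho t * (glue c dw t * q (f t))) +
    Int a b (fun t => H t * (glue c w t * q (f t))).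
  by rewrite (funext E); apply: cvgD => //; exact: cvg_cst.
rewrite (cvgn_unique h2 h3) -IntD.
- by apply: eq_Int => t _; ring.
- by apply: bmeas_intg; apply: bmeasM => //; exact: bmeasM.
- by apply: (eq_intg _ (intgM bwq iH)) => t _; rewrite mulrC.
Qed.

Variable H : R -> R.
Hypothesis hH : regular_density H.

(* Normalized by [reg (f c) = 0], as [rho] vanishes beyond [f c]. *)
Definition reg t := Int a t H - Int a (f c) H.

Lemma prim_reg : prim a b reg H.
Proof.
have [iH _ _ _] := hH; have [i h] := prim_Int iH.
by split => // s t as_ st tb; rewrite -h // /reg; ring.
Qed.

Lemma reg_crit t : f c <= t -> t <= b -> reg t = 0.
Proof.
move=> ct tb; have [iH H0 _ _] := hH; have := prim_reg.2 (f c) t afc ct tb.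
rewrite {2}/reg subrr subr0 => ->; rewrite (@Int_oo _ _ _ _ (fun=> 0)) ?Int_cst ?mul0r //.
by move=> s /andP[cs st]; apply: H0 => //; exact: le_trans (ltW st) tb.
Qed.

Variable N : set R.
Hypothesis nN : mu.-negligible N.
Hypothesis Nsat : forall t, a <= t <= b -> N t -> N (f t).
Hypothesis Norb : forall i, N (orb i).
Hypothesis Ninv : forall t, a <= t <= b -> ~ N t -> rho t = tr rho t.

(** The error of the decomposition of [rho] with [K] steps; [defect_bound] makes it tend to 0
    geometrically. *)
Definition defect K t := rho t - sal kappa K t - reg t.

Lemma bmeas_defect K : bmeas a b (defect K).
Proof.
by apply: bmeasB; [apply: bmeasB => //; exact: bmeas_sal|exact: prim_bmeas prim_reg].
Qed.

Lemma sal_out K t : f c <= t -> sal kappa K t = 0.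
Proof.
move=> h; rewrite /sal big1 ?oppr0 // => i _; rewrite ltNge (le_trans _ h) //.
exact: orb_le.
Qed.

Lemma defect_out K t : f c < t -> t <= b -> ~ N t -> defect K t = 0.
Proof.
move=> ct tb nt; rewrite /defect Ninv // ?(le_trans afc (ltW ct)) //.
by rewrite tr_out // sal_out ?(ltW ct) // reg_crit ?(ltW ct) // !subr0.
Qed.

Lemma ibr_good e x : a <= x <= f c -> ~ N x -> ~ N (ibr e x).
Proof.
move=> hx nx Nt; apply: nx; have [hi_ <-] := ibrP ex fa fb e hx; apply: Nsat => //.
have [h3 [h4 _]] := ex_lohi ex e.
by case/andP: hi_ => h5 h6; rewrite (le_trans h3 h5) (le_trans h6 h4).
Qed.

Lemma sal_jump K x y : x < y -> (forall i, orb i != x) -> (forall i, orb i != y) ->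
  sal kappa K y - sal kappa K x = \sum_(i < K) (if x < orb i < y then sg kappa i else 0).
Proof.
move=> xy ox oy; rewrite /sal opprK addrC -sumrB; apply: eq_bigr => i _.
have [h|h|h] := ltgtP x (orb i); last by have := ox i; rewrite -h eqxx.
  by have [h'|h'|h'] := ltgtP y (orb i); rewrite ?subrr ?subr0 //; have := oy i; rewrite -h' eqxx.
by rewrite ltNge (ltW (lt_trans h xy)) /= subrr.
Qed.

(* The equation of transfer for the defect: the jumps of [sal K] are carried to those
   of the next orbit points, so that only the jump at [orb K] is left over. *)
Lemma defect_step K x y : a <= x -> x < y -> y < f c -> ~ N x -> ~ N y ->
  defect K y - defect K x =
    (defect K (ibr true y) * w true (ibr true y) - defect K (ibr true x) * w true (ibr true x)
     - Int (ibr true x) (ibr true y) (fun t => defect K t * dw true t)) +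
    (defect K (ibr false x) * w false (ibr false x) - defect K (ibr false y) * w false (ibr false y)
     - Int (ibr false y) (ibr false x) (fun t => defect K t * dw false t)) +
    (if x < orb K < y then sg kappa K else 0).
Proof.
move=> ax xy yc nx ny; have xc := lt_trans xy yc.
have hx : a <= x <= f c by rewrite ax ltW.
have hy : a <= y <= f c by rewrite (le_trans ax (ltW xy)) ltW.
have xb := le_trans (ltW xc) fcb; have yb := le_trans (ltW yc) fcb.
have [/andP[l1 h1] e1] := ibrP ex fa fb true hx.
have [/andP[l2 h2] e2] := ibrP ex fa fb true hy.
have [/andP[l3 h3] e3] := ibrP ex fa fb false hy.
have [/andP[l4 h4] e4] := ibrP ex fa fb false hx.
have m1 : ibr true x < ibr true y by apply: (ibr_mono ex fa fb true) => //; exact: ltW.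
have m2 : ibr false y < ibr false x by apply: (ibr_mono ex fa fb false) => //; exact: ltW.
have orb_neq t : ~ N t -> forall i, orb i != t.
  by move=> nt i; apply/eqP => E; apply: nt; rewrite -E.
have S e s t : lo e <= s -> s < t -> t <= hi e -> ~ N s -> ~ N t ->
    sal kappa K t * w e t - sal kappa K s * w e s =
    Int s t (fun t => sal kappa K t * dw e t) +
    \sum_(i < K) (if s < orb i < t then sg kappa i * w e (orb i) else 0).
  by move=> *; apply: sal_parts => //; exact: orb_neq.
have g1 : ~ N (ibr true x) by exact: ibr_good.
have g2 : ~ N (ibr true y) by exact: ibr_good.
have g3 : ~ N (ibr false y) by exact: ibr_good.
have g4 : ~ N (ibr false x) by exact: ibr_good.
have S1 := S true _ _ l1 m1 h2 g1 g2; have S2 := S false _ _ l3 m2 h4 g3 g4.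
have [iH _ _ Hseg] := hH.
have Rp e s t : lo e <= s -> s <= t -> t <= hi e ->
    reg t * w e t - reg s * w e s = Int s t (fun t => H t * w e t + reg t * dw e t).
  move=> ls st th_; have [la [hb _]] := ex_lohi ex e.
  have := primM (primS la hb prim_reg) (ex_w ex e).
  by case=> _ h; rewrite -h.
have R1 := Rp true _ _ l1 (ltW m1) h2; have R2 := Rp false _ _ l3 (ltW m2) h4.
have iu : intg a b (fun t => glue c dw t * rho t + glue c w t * H t).
  by apply: intgD; apply: intgM => //; exact: bmeas_intg.
have R3 : reg y - reg x =
    Int (ibr true x) (ibr true y) (fun t => dw true t * rho t + w true t * H t) +
    Int (ibr false y) (ibr false x) (fun t => dw false t * rho t + w false t * H t).
  rewrite (prim_reg.2 x y ax (ltW xy) yb) (Hseg x y ax (ltW xy) (ltW yc)).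
  have := Int_tr_seg ex fa fb iu (bmeas_cst a b 1) ax (ltW xy) (ltW yc).
  rewrite (@eq_Int _ x y _ (tr (fun t => glue c dw t * rho t + glue c w t * H t))) => [->|t _]; last by rewrite mulr1.
  congr (_ + _); apply: Int_oo => t /andP[q1 q2]; rewrite mulr1.
    rewrite !(@glue_oo _ a c b _ true) //= ?(le_lt_trans l1 q1) ?(lt_le_trans q2 h2) //.
  by rewrite !(@glue_oo _ a c b _ false) //= ?(le_lt_trans l3 q1) ?(lt_le_trans q2 h4).
have trE z : a <= z <= f c -> tr rho z =
    rho (ibr true z) * w true (ibr true z) - rho (ibr false z) * w false (ibr false z).
  by move=> hz; rewrite /tr /brt hz /= mulrN.
have Q1 : rho y - rho x = (rho (ibr true y) * w true (ibr true y) - rho (ibr true x) * w true (ibr true x))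
   + (rho (ibr false x) * w false (ibr false x) - rho (ibr false y) * w false (ibr false y)).
  rewrite (Ninv _ nx) ?(Ninv _ ny) ?ax ?(le_trans ax (ltW xy)) // !trE //; ring.
have D e s t : lo e <= s -> s <= t -> t <= hi e -> Int s t (fun t => defect K t * dw e t) =
    Int s t (fun t => dw e t * rho t + w e t * H t) - Int s t (fun t => sal kappa K t * dw e t)
    - Int s t (fun t => H t * w e t + reg t * dw e t).
  move=> ls st th_; have [la [hb _]] := ex_lohi ex e.
  have as_ := le_trans la ls; have tb := le_trans th_ hb.
  have bd := bmeasS ls th_ (ex_dw ex e); have bw := bmeasS ls th_ (prim_bmeas (ex_w ex e)).
  have iHs := intgS as_ tb iH.
  have ir : intg s t (fun t => dw e t * rho t) by apply/bmeas_intg/bmeasM => //; exact: bmeasS brho.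
  have iw : intg s t (fun t => w e t * H t) by exact: intgM.
  have is_ : intg s t (fun t => sal kappa K t * dw e t).
    by apply/bmeas_intg/bmeasM => //; apply: bmeasS (bmeas_sal _ _).
  have ig : intg s t (fun t => H t * w e t + reg t * dw e t).
    apply: intgD; first by apply: (eq_intg _ iw) => r _; rewrite mulrC.
    by apply/bmeas_intg/bmeasM => //; apply: bmeasS (prim_bmeas prim_reg).
  rewrite -IntB //; last exact: intgD.
  rewrite -IntB //; last by apply: intgB => //; exact: intgD.
  by apply: eq_Int => r _; rewrite /defect; ring.
rewrite (D true) ?(ltW m1) // (D false) ?(ltW m2) //.
(* Reindexing: the jump at [orb i], weighted by [w], is the jump at [orb i.+1]. The step [i = 0]
   sits at [f c], outside of the interval, and the index [K] is the one left over. If [orb i = c],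
   the next point is [f c], again outside. *)
have SJ : \sum_(i < K) (if ibr true x < orb i < ibr true y then sg kappa i * w true (orb i) else 0)
  + \sum_(i < K) (if ibr false y < orb i < ibr false x then sg kappa i * w false (orb i) else 0)
  = sal kappa K y - sal kappa K x + (if x < orb K < y then sg kappa K else 0).
  rewrite sal_jump // -?big_split /=; try exact: orb_neq.
  have <- : \sum_(i < K.+1) (if x < orb i < y then sg kappa i else 0) =
    \sum_(i < K) (if x < orb i < y then sg kappa i else 0) + (if x < orb K < y then sg kappa K else 0).
    by rewrite big_ord_recr.
  rewrite big_ord_recl /= (_ : x < f c < y = false) ?add0r; last first.
    by apply/negbTE; rewrite negb_and -!leNgt (ltW yc) orbT.
  apply: eq_bigr => i _; rewrite !add0n.
  have [oa ob] := andP (orb_ab i).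
  have [oc|co|oE] := ltgtP (orb i) c.
  - rewrite [ibr false y < _]ltNge (le_trans (ltW oc) l3) /= addr0 /wv oc.
    have hi_ : lo true <= orb i <= hi true by rewrite /= oa ltW.
    congr (if _ then _ else _); rewrite -{2}e1 -{2}e2.
    have mf := ex_mono ex true.
    congr (_ && _); apply/idP/idP.
    + by move=> h; apply: mf => //; exact: ltW.
    + by apply: contraTT; rewrite -!leNgt => h; apply: (incr_le mf).
    + by move=> h; apply: mf.
    + by apply: contraTT; rewrite -!leNgt => h; apply: (incr_le mf) => //; exact: ltW.
  - rewrite [_ < ibr true y]ltNge (le_trans h2 (ltW co)) /= andbF add0r.
    have -> : wv (orb i) = w false (orb i) by rewrite /wv ltNge (ltW co) /= co.
    have mf := ex_mono ex false.
    rewrite andbC; congr (if _ then _ else _); rewrite -{2}e3 -{2}e4.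
    congr (_ && _); apply/idP/idP.
    + by move=> h; apply: mf => //; exact: ltW.
    + by apply: contraTT; rewrite -!leNgt => h; apply: (decr_le mf).
    + by move=> h; apply: mf.
    + by apply: contraTT; rewrite -!leNgt => h; apply: (decr_le mf) => //; exact: ltW.
  - rewrite oE [c < ibr true y]ltNge h2 andbF [ibr false y < c]ltNge l3 /= addr0 (_ : f c < y = false) ?andbF //.
    by apply/negbTE; rewrite -leNgt ltW.
move: S1 S2 R1 R2 R3 Q1 SJ; rewrite /defect.
set i1 := Int _ _ _; set i2 := Int _ _ _; set i3 := Int _ _ _; set i4 := Int _ _ _.
set i5 := Int _ _ _; set i6 := Int _ _ _; set s1 := \sum_(i < K) _; set s2 := \sum_(i < K) _.
set jj := if _ then _ else _.
clearbody i1 i2 i3 i4 i5 i6 s1 s2 jj; lra.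
Qed.

End structure.

(** * Contraction of the defect and identification of the jumps *)

Section defect.
Context {R : realType}.
Notation mu := (@lebesgue_measure R).
Implicit Types (x y z s t k C V : R) (u v q Q p P : R -> R) (n i j K : nat) (e : bool).
Variables (a c b th : R) (f : R -> R) (w dw : bool -> R -> R).
Hypothesis ex : expanding a c b th f w dw.
Hypotheses (fa : f a = a) (fb : f b = a).
Notation lo := (blo a c).
Notation hi := (bhi c b).
Notation tr := (tr a c b f w).
Notation ibr := (ibr a c b f).
Notation orb i := (iter i f (f c)).

Let ac : a < c. Proof. by have /andP[] := ex_acb ex. Qed.
Let cb : c < b. Proof. by have /andP[] := ex_acb ex. Qed.
Let ab : a < b. Proof. exact: ex_ab ex. Qed.
Let afc : a <= f c. Proof. by have /andP[] := crit_ab ex. Qed.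
Let fcb : f c <= b. Proof. by have /andP[] := crit_ab ex. Qed.
Let th0 : 0 < th. Proof. by have /andP[] := ex_th ex. Qed.
Let th1 : th < 1. Proof. by have /andP[] := ex_th ex. Qed.

Variables (rho vrho : R -> R) (kappa : R) (H : R -> R) (N : set R).
Hypothesis rho_ctrl : forall s t, a <= s -> s <= t -> t <= b -> `|rho t - rho s| <= vrho t - vrho s.
Hypothesis hH : regular_density a c b f w dw rho H.
Hypothesis nN : mu.-negligible N.
Hypothesis Nsat : forall t, a <= t <= b -> N t -> N (f t).
Hypothesis Norb : forall i, N (orb i).
Hypothesis Ninv : forall t, a <= t <= b -> ~ N t -> rho t = tr rho t.
Hypothesis hleft : rho y @[y --> (f c)^'-] --> - kappa.

Notation defect := (defect a c f w rho kappa H).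
Notation reg := (reg a c f H).
Notation sal := (sal c f w kappa).
Notation sg := (sg c f w kappa).

(** The variation of [defect K] along points off [N] is at most [V]; its values on [N] are
    arbitrary. *)
Definition ctrl K V := exists v, [/\
  forall s t, a <= s -> s < t -> t <= b -> ~ N s -> ~ N t -> `|defect K t - defect K s| <= v t - v s,
  forall s t, a <= s -> s <= t -> t <= b -> v s <= v t & v b - v a <= V].

Lemma ctrl_start K : exists2 V, 0 <= V & ctrl K V.
Proof.
have [iH _ _ _] := hH; have iaH := intg_norm iH.
pose v t := vrho t + \sum_(i < K) `|sg i| * (if orb i <= t then 1 else 0) + Int a t (fun t => `|H t|).
have st_sal s t : s <= t -> `|sal K t - sal K s| <=
    \sum_(i < K) `|sg i| * (if orb i <= t then 1 else 0) - \sum_(i < K) `|sg i| * (if orb i <= s then 1 else 0).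
  move=> st; rewrite /sal opprK addrC -!sumrB; apply: le_trans (ler_norm_sum _ _ _) _.
  apply: ler_sum => i _; have [h1|h1] := leP (orb i) s.
    by rewrite (le_trans h1 st) ltNge (le_trans h1 st) /= !subrr normr0.
  have [h2|h2] := leP (orb i) t; last by rewrite !subrr normr0.
  by rewrite subr0 mulr1 mulr0 subr0.
have vd s t : a <= s -> s <= t -> t <= b -> `|defect K t - defect K s| <= v t - v s.
  move=> as_ st tb.
  have h1 := rho_ctrl as_ st tb; have h2 := st_sal s t st.
  have h3 : `|reg t - reg s| <= Int a t (fun t => `|H t|) - Int a s (fun t => `|H t|).
    rewrite ((prim_reg hH).2 s t as_ st tb) ((prim_Int iaH).2 s t as_ st tb).
    exact: norm_Int (intgS as_ tb iH).
  have -> : defect K t - defect K s = (rho t - rho s) - (sal K t - sal K s) - (reg t - reg s).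
    by rewrite /defect; ring.
  have := ler_normB ((rho t - rho s) - (sal K t - sal K s)) (reg t - reg s).
  have := ler_normB (rho t - rho s) (sal K t - sal K s).
  rewrite /v; lra.
have vm s t : a <= s -> s <= t -> t <= b -> v s <= v t.
  by move=> as_ st tb; rewrite -subr_ge0; apply: le_trans (vd s t as_ st tb).
exists (v b - v a); first by rewrite subr_ge0 vm // ltW.
by exists v; split => // s t as_ st tb _ _; apply: vd => //; exact: ltW.
Qed.

Lemma orb_gap K z : exists2 d, 0 < d & forall i, (i < K)%N -> orb i != z -> d <= `|orb i - z|.
Proof.
elim: K => [|K [d d0 hd]]; first by exists 1.
have [E|nE] := eqVneq (orb K) z.
  by exists d => // i; rewrite ltnS leq_eqVlt => /predU1P[->|]; [rewrite E eqxx|exact: hd].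
exists (Num.min d `|orb K - z|); first by rewrite lt_min d0 normr_gt0 subr_eq0.
move=> i; rewrite ltnS leq_eqVlt => /predU1P[-> _|iK h]; first by rewrite ge_min lexx orbT.
by rewrite ge_min hd.
Qed.

(** Close enough to [f c] from the left, only steps sitting at [f c] itself are seen. A return of
    the orbit to [f c] carries zero weight, so just the first step is left. *)
Lemma sal_left K : (0 < K)%N -> exists2 d, 0 < d & forall y, f c - d < y -> y < f c -> sal K y = - kappa.
Proof.
case: K => // K _; have [d d0 hd] := orb_gap K.+1 (f c); exists d => // y yd yc.
rewrite /sal big_ord_recl /= yc big1 ?addr0 // => i _.
case: ifP => // h; apply: (sg_crit ex _) => /=.
apply/eqP; apply: contraT => nE; have := hd i.+1 (ltn_ord i) nE.
have := orb_le ex i.+1 => /= hle; rewrite ler0_norm ?subr_le0 //.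
move: h; rewrite /bump /= add0n => h; lra.
Qed.

(** Just left of [f c] the limit [- kappa] of [rho] is cancelled by the first step, and [reg]
    vanishes at [f c]. These points anchor the defect: a variation bound becomes a pointwise bound,
    and no jump arises when passing beyond [f c]. *)
Lemma left_small K x k : (0 < K)%N -> x < f c -> 0 < k ->
  exists y, [/\ x < y, a < y, y < f c, ~ N y & `|defect K y| <= k].
Proof.
move=> K0 xc k0; have k2 : 0 < k / 2 by rewrite divr_gt0.
have [d1 d10 h1] := sal_left K0.
have /cvgrPdist_le /(_ _ k2) := hleft; rewrite /at_left near_withinE => /nbhs_ballP[d2 /= d20 h2].
have fcab : a <= f c <= b by rewrite afc.
have [d3 d30 h3] := prim_cont (prim_reg hH) fcab k2.
have a_fc : a < f c by apply: lt_trans ac (crit_lt ex fa).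
pose m := Num.max (Num.max x a) (Num.max (f c - d1) (Num.max (f c - d2) (f c - d3))).
have mc : m < f c by rewrite !gt_max xc a_fc /= !gtrBl d10 d20 d30.
have [y /andP[my yc] ny] := negligible_pick nN mc.
move: my; rewrite !gt_max => /andP[/andP[xy ay] /andP[y1 /andP[y2 y3]]].
exists y; split => //.
have dy : `|y - f c| = f c - y by rewrite ltr0_norm ?opprB // subr_lt0.
have q2 := h2 y; rewrite /ball /= distrC dy in q2.
have q3 := h3 y; rewrite dy in q3.
have r0 := reg_crit ex hH (lexx _) fcb.
rewrite /defect (h1 y y1 yc) opprK.
have p2 := q2 ltac:(lra) yc.
have p3 := q3 ltac:(by rewrite (ltW ay) (le_trans (ltW yc) fcb)) ltac:(lra).
rewrite r0 subr0 in p3; rewrite distrC opprK in p2.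
have := ler_normB (rho y + kappa) (reg y); lra.
Qed.

(** In [defect_step] the two branch terms have the form of [parts_ineq] with [w], bounded by [th],
    as the test function; only the leftover jump is not contracted. *)
Lemma ctrl_contract K V : (0 < K)%N -> ctrl K V -> ctrl K (th * V + `|sg K|).
Proof.
move=> K0 [v [vd vm vV]].
(* One inverse branch increases and the other decreases, so [W] is monotone; from [a] to [f c] the
   two branches together sweep [[a, b]] once. *)
pose W x := th * (v (ibr true x) - v (ibr false x)) + `|sg K| * (if orb K < x then 1 else 0).
have ibrab e x : a <= x <= f c -> a <= ibr e x <= b.
  move=> hx; have [/andP[h1 h2] _] := ibrP ex fa fb e hx; have [h3 [h4 _]] := ex_lohi ex e.
  by rewrite (le_trans h3 h1) (le_trans h2 h4).
have Wm s t : a <= s -> s <= t -> t <= f c -> W s <= W t.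
  move=> as_ st tc; apply: lerD.
    have m1 : ibr true s <= ibr true t by apply: (incr_le (ibr_mono ex fa fb true)).
    have m2 : ibr false t <= ibr false s by apply: (decr_le (ibr_mono ex fa fb false)).
    have /andP[a1 b1] : a <= ibr true s <= b by apply: ibrab; rewrite as_ (le_trans st).
    have /andP[a2 b2] : a <= ibr true t <= b by apply: ibrab; rewrite tc (le_trans as_).
    have /andP[a3 b3] : a <= ibr false s <= b by apply: ibrab; rewrite as_ (le_trans st).
    have /andP[a4 b4] : a <= ibr false t <= b by apply: ibrab; rewrite tc (le_trans as_).
    rewrite ler_pM2l //; have := vm _ _ a1 m1 b2; have := vm _ _ a4 m2 b3; lra.
  rewrite ler_wpM2l //; case: ifP => h; last by case: ifP.
  by rewrite (lt_le_trans h st).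
have low s t : a <= s -> s < t -> t < f c -> ~ N s -> ~ N t -> `|defect K t - defect K s| <= W t - W s.
  move=> as_ st tc ns nt; have st' := ltW st.
  have hs : a <= s <= f c by rewrite as_ (le_trans st') // ltW.
  have ht : a <= t <= f c by rewrite (le_trans as_) //= ltW.
  rewrite (defect_step ex fa fb kappa rho_ctrl hH Nsat Norb Ninv K as_ st tc ns nt).
  have [/andP[l1 h1] _] := ibrP ex fa fb true hs.
  have [/andP[l2 h2] _] := ibrP ex fa fb true ht.
  have [/andP[l3 h3] _] := ibrP ex fa fb false ht.
  have [/andP[l4 h4] _] := ibrP ex fa fb false hs.
  have m1 : ibr true s < ibr true t by apply: (ibr_mono ex fa fb true) => //; exact: ltW.
  have m2 : ibr false t < ibr false s by apply: (ibr_mono ex fa fb false) => //; exact: ltW.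
  have PI e x y : lo e <= x -> x < y -> y <= hi e -> ~ N x -> ~ N y ->
      `|defect K y * w e y - defect K x * w e x - Int x y (fun t => defect K t * dw e t)| <= th * (v y - v x).
    move=> lx xy yh nx ny; have [la [hb _]] := ex_lohi ex e.
    have ax := le_trans la lx; have yb := le_trans yh hb.
    apply: (parts_ineq nN) => //.
    - by apply: bmeasS (bmeas_defect ex kappa rho_ctrl hH K).
    - exact: primS lx yh (ex_w ex e).
    - exact: bmeasS lx yh (ex_dw ex e).
    - by move=> r /andP[xr ry]; apply: (ex_w_le ex); rewrite (le_trans lx xr) (le_trans ry yh).
    - by move=> r1 r2 xr1 r12 r2y; apply: vd => //; [exact: le_trans xr1|exact: le_trans yb].
  have G e x : a <= x <= f c -> ~ N x -> ~ N (ibr e x) by exact: (ibr_good ex fa fb Nsat).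
  have q1 := PI true _ _ l1 m1 h2 (G _ _ hs ns) (G _ _ ht nt).
  have q2 := PI false _ _ l3 m2 h4 (G _ _ ht nt) (G _ _ hs ns).
  have q3 : `|if s < orb K < t then sg K else 0| <=
      `|sg K| * (if orb K < t then 1 else 0) - `|sg K| * (if orb K < s then 1 else 0).
    have [h|h] := ltP s (orb K); last first.
      rewrite /= normr0 subr_ge0 ler_wpM2l //; case: ifP => k; last by case: ifP.
      by rewrite (lt_trans k st).
    rewrite /= [orb K < s]ltNge (ltW h) /= mulr0 subr0.
    by case: ifP; rewrite ?mulr1 ?mulr0 ?normr0.
  rewrite /W; move: q1 q2 q3.
  set A := _ - Int _ _ _; set B := _ - Int _ _ _; set D := if _ then _ else _.
  set I1 := `|sg K| * _; set I2 := `|sg K| * _.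
  have := ler_normD (A + B) D; have := ler_normD A B.
  clearbody A B D I1 I2; lra.
exists (fun x => W (Num.min x (f c))); split.
- move=> s t as_ st tb ns nt.
  have nc x : ~ N x -> x != f c by move=> nx; apply/eqP => E; apply: nx; rewrite E; exact: (Norb 0).
  have [tc|ct|E] := ltgtP t (f c); last by have := nc t nt; rewrite E eqxx.
    by rewrite !min_l ?(ltW tc) // ?(ltW (lt_trans st tc)) // low.
  rewrite (defect_out ex kappa hH Ninv K ct tb nt) sub0r normrN.
  have [sc|cs|E] := ltgtP s (f c); last by have := nc s ns; rewrite E eqxx.
    apply/ler_addgt0Pr => k k0.
    have [y [sy ay yc ny dy]] := left_small K0 sc k0.
    have := low s y as_ sy yc ns ny; have := Wm y (f c) (ltW ay) (ltW yc) (lexx _).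
    have := ler_normB (defect K y) (defect K y - defect K s).
    rewrite (_ : defect K y - (defect K y - defect K s) = defect K s); last by ring.
    lra.
  rewrite (defect_out ex kappa hH Ninv K cs (le_trans (ltW st) tb) ns) normr0.
  by rewrite subrr.
- move=> s t as_ st tb; apply: Wm; first by rewrite le_min as_.
    by rewrite le_min !ge_min st lexx !orbT.
  by rewrite ge_min lexx orbT.
- rewrite min_r // min_l // /W !(ibr_crit ex fa fb); have [-> ->] := ibr_fix ex fa fb.
  have : `|sg K| * (if orb K < f c then 1 else 0) - `|sg K| * (if orb K < a then 1 else 0) <= `|sg K|.
    rewrite [orb K < a]ltNge; have /andP[-> _] := orb_ab ex K; rewrite /= mulr0 subr0.
    by case: ifP; rewrite ?mulr1 ?mulr0.
  have : th * (v b - v a) <= th * V by rewrite ler_pM2l.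
  lra.
Qed.

(** For fixed [K] the contraction can be iterated indefinitely, so the variation is at most the
    fixed point [|sg K| / (1 - th)] of V -> th V + |sg K|, whatever the starting value. *)
Lemma defect_bound K x : (0 < K)%N -> a <= x <= b -> ~ N x ->
  `|defect K x| <= `|kappa| / (1 - th) * th ^+ K.
Proof.
move=> K0 /andP[ax xb] nx; have th10 : 0 < 1 - th by rewrite subr_gt0.
have E0 : 0 <= `|kappa| / (1 - th) * th ^+ K.
  by rewrite mulr_ge0 ?divr_ge0 ?exprn_ge0 // ltW.
have [xc|cx|E] := ltgtP x (f c); last by exfalso; apply: nx; rewrite E; exact: (Norb 0).
  have [V V0 hV] := ctrl_start K.
  have it n : ctrl K (th ^+ n * V + `|sg K| / (1 - th)).
    elim: n => [|n IH].
      have [v [h1 h2 h3]] := hV; exists v; split => //; apply: le_trans h3 _.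
      by rewrite expr0 mul1r lerDl divr_ge0 // ltW.
    have := ctrl_contract K0 IH; congr ctrl; rewrite exprS; field; by rewrite gt_eqF.
  apply/ler_addgt0Pr => k k0; have k2 : 0 < k / 2 by rewrite divr_gt0.
  have th01 : 0 <= th < 1 by rewrite ltW.
  have /cvgrPdist_le /(_ _ k2)[n _ hn] := cvg_pow V th01.
  have := hn n (leqnn n); rewrite /= sub0r normrN ger0_norm; last by rewrite mulr_ge0 ?exprn_ge0 // ltW.
  move=> Vn; have [v [vd vm vV]] := it n.
  have [y [xy ay yc ny dy]] := left_small K0 xc k2.
  have yb := le_trans (ltW yc) fcb.
  have := vd x y ax xy yb nx ny.
  have := vm a x (lexx a) ax xb; have := vm y b (ltW ay) yb (lexx b).
  have := ler_normB (defect K y) (defect K y - defect K x).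
  rewrite (_ : defect K y - (defect K y - defect K x) = defect K x); last by ring.
  have : `|sg K| / (1 - th) <= `|kappa| / (1 - th) * th ^+ K.
    by rewrite mulrAC ler_pM2r ?invr_gt0 // (sg_le ex).
  by rewrite mulrC in Vn; lra.
by rewrite (defect_out ex kappa hH Ninv K cx xb nx) normr0.
Qed.

Hypothesis rho_out : forall t, b < t -> rho t = 0.

Lemma right_limit z : a <= z <= b -> exists L : R, rho y @[y --> z^'+] --> L.
Proof.
move=> /andP[az]; rewrite le_eqVlt => /predU1P[->|zb]; last exact: control_right az zb rho_ctrl.
exists 0; apply/cvgrPdist_le => k k0; rewrite /at_right near_withinE.
by apply: nearW => y /rho_out ->; rewrite subrr normr0 ltW.
Qed.

Lemma right_crit : rho y @[y --> (f c)^'+] --> 0.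
Proof.
have [L hL] : exists L : R, rho y @[y --> (f c)^'+] --> L by apply: right_limit; rewrite afc.
suff <- : L = 0 by [].
apply/eqP; rewrite -normr_eq0; apply/eqP/le_anti; rewrite normr_ge0 andbT.
apply/ler_addgt0Pr => k k0; rewrite add0r.
move/cvgrPdist_le : hL => /(_ _ k0); rewrite /at_right near_withinE => /nbhs_ballP[d /= d0 hd].
have [y /andP[cy yd] ny] := @negligible_pick R N (f c) (f c + d) nN ltac:(by rewrite ltrDl).
have := hd y; rewrite /ball /= distrC gtr0_norm ?subr_gt0 // => /(_ ltac:(lra) cy).
suff -> : rho y = 0 by rewrite subr0.
have [yb|/rho_out //] := leP y b.
by rewrite Ninv ?tr_out // (le_trans afc (ltW cy)).
Qed.

Let E K := `|kappa| / (1 - th) * th ^+ K.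

Lemma right_point z K k d (L : R) : a <= z <= f c -> (0 < K)%N -> 0 < k -> 0 < d ->
  rho y @[y --> z^'+] --> L -> exists y, [/\ z < y, y < z + d,
    `|rho y - L| <= k & `|rho y - sal K y - reg z| <= E K + k].
Proof.
move=> /andP[az zc] K0 k0 d0 /cvgrPdist_le /(_ _ k0).
rewrite /at_right near_withinE => /nbhs_ballP[d1 /= d10 h1].
have E0 : 0 <= E K by rewrite /E mulr_ge0 ?divr_ge0 ?exprn_ge0 ?subr_ge0 // ltW.
have h1' y : z < y -> y < z + d1 -> `|rho y - L| <= k.
  move=> zy yd; have := h1 y; rewrite /ball /= distrC gtr0_norm ?subr_gt0 // => h.
  by rewrite distrC; apply: h => //; lra.
(* If [z = b], a point to the right leaves the interval where the defect is controlled, but there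
   all three terms vanish. *)
have zb := le_trans zc fcb; move: (zb); rewrite le_eqVlt => /predU1P[zE|zb'].
  pose y := b + Num.min d d1 / 2; have m0 : 0 < Num.min d d1 by rewrite lt_min d0.
  have m1 : Num.min d d1 <= d by rewrite ge_min lexx.
  have m2 : Num.min d d1 <= d1 by rewrite ge_min lexx orbT.
  have yb : b < y by rewrite /y; lra.
  exists y; rewrite zE; split => //; first by rewrite /y; lra.
    by apply: h1'; rewrite zE // /y; lra.
  rewrite rho_out // (sal_out ex) ?(le_trans fcb (ltW yb)) //.
  rewrite (reg_crit ex hH fcb (lexx _)) !subr0 normr0 addr_ge0 //; exact: ltW.
have zab : a <= z <= b by rewrite az.
have [d2 d20 h2] := prim_cont (prim_reg hH) zab k0.
pose m := Num.min (z + d) (Num.min (z + d1) (Num.min (z + d2) b)).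
have zm : z < m by rewrite !lt_min zb' !ltrDl d0 d10 d20.
have [y /andP[zy ym] ny] := negligible_pick nN zm.
move: ym; rewrite !lt_min => /and4P[y1 y2 y3 y4].
have yab : a <= y <= b by rewrite (le_trans az (ltW zy)) ltW.
exists y; split => //; first exact: h1'.
have := h2 y yab; rewrite gtr0_norm ?subr_gt0 // => /(_ ltac:(lra)) h3.
have := defect_bound K0 yab ny; rewrite -/(E K) => h4.
have -> : rho y - sal K y - reg z = defect K y + (reg y - reg z) by rewrite /defect; ring.
by apply: le_trans (ler_normD _ _) _; exact: lerD.
Qed.

Lemma left_point z K k d (L : R) : a < z <= f c -> (0 < K)%N -> 0 < k -> 0 < d ->
  rho y @[y --> z^'-] --> L -> exists y, [/\ z - d < y, y < z,
    `|rho y - L| <= k & `|rho y - sal K y - reg z| <= E K + k].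
Proof.
move=> /andP[az zc] K0 k0 d0 /cvgrPdist_le /(_ _ k0).
rewrite /at_left near_withinE => /nbhs_ballP[d1 /= d10 h1].
have zb := le_trans zc fcb.
have zab : a <= z <= b by rewrite ltW.
have [d2 d20 h2] := prim_cont (prim_reg hH) zab k0.
pose m := Num.max (z - d) (Num.max (z - d1) (Num.max (z - d2) a)).
have mz : m < z by rewrite !gt_max az !gtrBl d0 d10 d20.
have [y /andP[my yz] ny] := negligible_pick nN mz.
move: my; rewrite !gt_max => /and4P[y1 y2 y3 y4].
have yab : a <= y <= b by rewrite ltW //= (le_trans (ltW yz)).
exists y; split => //.
  have := h1 y; rewrite /ball /= gtr0_norm ?subr_gt0 // => h.
  by rewrite distrC; apply: h => //; lra.
have := h2 y yab; rewrite ltr0_norm ?subr_lt0 // opprB => /(_ ltac:(lra)) h3.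
have := defect_bound K0 yab ny; rewrite -/(E K) => h4.
have -> : rho y - sal K y - reg z = defect K y + (reg y - reg z) by rewrite /defect; ring.
by apply: le_trans (ler_normD _ _) _; exact: lerD.
Qed.

(** Compare sample points on the two sides of [z], closer to it than any of the first [K] orbit
    points different from [z]. The difference of [sal K] then collects exactly the visits to [z],
    and [reg], being continuous, cancels. *)
Lemma jump_cvg n : (0 < n)%N -> a < crit c f n ->
  \sum_(i < K) (if orb i == crit c f n then sg i else 0) @[K --> \oo] --> jump c f rho n.
Proof.
move=> n0; have zc : crit c f n <= f c.
  by case: n n0 => // n _; rewrite /crit iterSr; exact: orb_le ex n.
set z := crit c f n in zc *; move=> az; have zb := le_trans zc fcb.
have [L hL] : exists L : R, rho y @[y --> z^'+] --> L by apply: right_limit; rewrite ltW.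
have [M hM] := control_left az zb rho_ctrl.
have -> : jump c f rho n = L - M.
  by rewrite /jump -/z; congr (_ - _); apply: cvg_lim.
set J := fun K => \sum_(i < K) _.
have bnd K : (0 < K)%N -> `|J K - (L - M)| <= 2 * E K.
  move=> K0; apply/ler_addgt0Pr => k k0; have k4 : 0 < k / 4 by rewrite divr_gt0.
  have [d d0 hd] := orb_gap K z.
  have [|y1 [zy1 y1d r1 s1]] := right_point _ K0 k4 d0 hL; first by rewrite ltW.
  have [|y2 [zy2 y2d r2 s2]] := left_point _ K0 k4 d0 hM; first by rewrite az.
  have -> : J K = sal K y1 - sal K y2.
    rewrite /sal opprK addrC -sumrB; apply: eq_bigr => i _.
    have [->|nz] := eqVneq (orb i) z; first by rewrite y2d ltNge (ltW zy1) /= subr0.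
    have := hd i (ltn_ord i) nz; rewrite ler_normr => /orP[h|h].
      by rewrite !ifT ?subrr //; lra.
    by rewrite !ifF ?subrr //; apply/negbTE; rewrite -leNgt; lra.
  have -> : sal K y1 - sal K y2 - (L - M) =
    (rho y1 - L) - (rho y1 - sal K y1 - reg z) - (rho y2 - M) + (rho y2 - sal K y2 - reg z) by ring.
  apply: le_trans (ler_normD _ _) _.
  have := ler_normB ((rho y1 - L) - (rho y1 - sal K y1 - reg z)) (rho y2 - M).
  have := ler_normB (rho y1 - L) (rho y1 - sal K y1 - reg z); lra.
rewrite -[X in _ --> X]add0r -(cvg_shiftS J).
rewrite (_ : (fun K => J K.+1) = fun K => (J K.+1 - (L - M)) + (L - M)); last first.
  by apply/funext => K; rewrite subrK.
apply: cvgD; last exact: cvg_cst.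
apply: (@cvg_squeeze0 _ _ (fun K => 2 * (`|kappa| / (1 - th) * th) * th ^+ K)).
  by move=> K; apply: le_trans (bnd _ _) _; rewrite // /E exprS !mulrA.
by apply: cvg_pow; rewrite ltW.
Qed.

End defect.

Lemma least_spec (P : set nat) n : P n -> P (least P) /\ forall m, P m -> (least P <= m)%N.
Proof.
move=> Pn; have ex : exists m, `[< P m >] by exists n; apply/asboolP.
case: (ex_minnP ex) => m /asboolP Pm mmin.
have h : exists k, [set k | P k /\ forall j, P j -> (k <= j)%N] k.
  by exists m; split => // j Pj; apply: mmin; apply/asboolP.
exact: (xgetPex 0%N h).
Qed.

Lemma cvg_stat (R : realType) (u : nat -> R) (l : R) m :
  (forall n, u (n + m)%N = l) -> u n @[n --> \oo] --> l.
Proof.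
move=> h; apply/cvgrPdist_le => k k0; exists m => // n /= mn.
by rewrite -(subnK mn) h subrr normr0 ltW.
Qed.

(** * Sums along the critical orbit *)

Section orbits.
Context {R : realType}.
Implicit Types (x y z s t k C M : R) (F phi : R -> R) (n i j m K N : nat).
Variables (c : R) (f : R -> R).
Notation crit := (crit c f).
Notation orb i := (iter i f (f c)).

Lemma critS i : crit i.+1 = orb i.
Proof. by rewrite /Defs.crit iterSr. Qed.

Lemma critD n m : crit (n + m) = iter n f (crit m).
Proof. by rewrite /Defs.crit iterD. Qed.

Lemma min_period_spec x : is_periodic f x -> [/\ (0 < min_period f x)%N,
  iter (min_period f x) f x = x &
  forall n, (0 < n)%N -> iter n f x = x -> (min_period f x <= n)%N].
Proof.
move=> [n hn]; have [[h1 h2] h3] := @least_spec [set n | (0 < n)%N /\ iter n f x = x] n hn.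
by split => // m m0 hm; apply: h3; split.
Qed.

Lemma iter_period n p x : iter p f x = x -> iter (n + p) f x = iter n f x.
Proof. by move=> h; rewrite iterD h. Qed.

Definition orbit_cover N := forall i, exists n, [/\ (0 < n)%N, (n <= N)%N & crit n = orb i].

Definition orbit_inj N := forall i j, (0 < i)%N -> (i < j)%N -> (j <= N)%N -> crit i <> crit j.

Lemma periodic_orbit : is_periodic f c -> orbit_cover (min_period f c) /\ orbit_inj (min_period f c).
Proof.
move=> /min_period_spec[p0 pc pm]; set p := min_period f c in p0 pc pm *; split.
  move=> i; elim/ltn_ind: i => i IH; have [ip|pi] := leqP i.+1 p.
    by exists i.+1; rewrite critS.
  have [|n [n0 np E]] := IH (i - p)%N; first by lia.
  exists n; split => //; rewrite E -!critS.
  have cp : crit p = c := pc.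
  rewrite (_ : i.+1 = ((i - p).+1 + p)%N); last by lia.
  by rewrite [RHS]critD cp.
move=> i j i0 ij jp E; have : (p <= p - j + i)%N; last by lia.
by apply: pm; [lia|rewrite iterD -/(crit i) E -critD subnK].
Qed.

(** A coincidence [crit i = crit j] with [i < j] makes [crit i] periodic, so [n0 <= i]. Then it lies
    on the cycle through [crit n0], and [j - i] is at least the period, which the bound on [j]
    excludes. *)
Lemma preperiodic_orbit n0 (n1 := min_period f (crit n0)) : ~ is_periodic f c ->
  is_periodic f (crit n0) -> (forall m, is_periodic f (crit m) -> (n0 <= m)%N) ->
  orbit_cover (n0 + n1 - 1) /\ orbit_inj (n0 + n1 - 1).
Proof.
move=> nc pn0 n0min; have [p0 pc pm] := min_period_spec pn0.
rewrite -/n1 in p0 pc pm.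
have n00 : (0 < n0)%N by case: (n0) nc pn0 => //.
split.
  move=> i; elim/ltn_ind: i => i IH; have [ip|pi] := leqP i.+1 (n0 + n1 - 1).
    by exists i.+1; rewrite critS.
  have [|n [n2 np E]] := IH (i - n1)%N; first by lia.
  exists n; split => //; rewrite E -!critS.
  have -> : i.+1 = ((i.+1 - n0 - n1) + n1 + n0)%N by lia.
  have -> : (i - n1).+1 = ((i.+1 - n0 - n1) + n0)%N by lia.
  by rewrite !critD iter_period.
move=> i j i0 ij jN E.
have pi : is_periodic f (crit i).
  by exists (j - i)%N; split; [lia|rewrite -critD subnK ?E // ltnW].
have n0i := n0min i pi.
have : (n1 <= j - i)%N; last by lia.
apply: pm; first by lia.
have e0 : crit n0 = iter (n1 - (i - n0)) f (crit i).
  by rewrite -critD -{1}pc -critD; congr crit; lia.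
rewrite {1}e0 -iterD addnC iterD -critD.
by rewrite (_ : (j - i + i)%N = j) ?subnK ?(ltnW ij) // -E -e0.
Qed.

Lemma infinite_orbit : ~ (exists n, is_periodic f (crit n)) -> forall N, orbit_inj N.
Proof.
move=> nc N i j i0 ij _ E; apply: nc; exists i; exists (j - i)%N; split; first by lia.
by rewrite -critD subnK ?E // ltnW.
Qed.

Lemma cvg_bigsum N (u : nat -> nat -> R) (l : nat -> R) :
  (forall n, (0 < n)%N -> (n <= N)%N -> u n K @[K --> \oo] --> l n) ->
  \sum_(1 <= n < N.+1) u n K @[K --> \oo] --> \sum_(1 <= n < N.+1) l n.
Proof.
elim: N => [|N IH] h.
  rewrite big_geq //; under eq_fun do rewrite big_geq //; exact: cvg_cst.
rewrite big_nat_recr //=; under eq_fun do rewrite big_nat_recr //=.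
by apply: cvgD; [apply: IH => n n0 nN; apply: h => //; exact: leqW|exact: h].
Qed.

Variables (th C : R) (W J : nat -> R) (a : R).
Hypothesis th01 : 0 <= th < 1.
Hypothesis Wb : expb C th W.
Hypothesis J_cvg : forall n, (0 < n)%N -> crit n <> a ->
  \sum_(i < K) (if orb i == crit n then W i else 0) @[K --> \oo] --> J n.

(* If [orb] returns to a point then the jump there collects the weights of all the
   visits, which is why [Nf] counts each orbit point once. The point [a] is exempt:
   the jump of [rho] there is not due to the orbit. *)
Lemma sum_Nf_fin N F : F a = 0 -> orbit_cover N -> orbit_inj N ->
  series (fun i => W i * F (orb i)) K @[K --> \oo] --> \sum_(1 <= n < N.+1) J n * F (crit n).
Proof.
move=> Fa cov inj.
have E K : series (fun i => W i * F (orb i)) K =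
  \sum_(1 <= n < N.+1) (\sum_(i < K) (if orb i == crit n then W i else 0)) * F (crit n).
  rewrite /series /= big_mkord; under [RHS]eq_bigr do rewrite mulr_suml.
  rewrite exchange_big /=; apply: eq_bigr => i _.
  have [n [n0 nN nE]] := cov i.
  rewrite (bigD1_seq n) ?iota_uniq //=; last by rewrite mem_index_iota n0 ltnS.
  rewrite -nE eqxx big_nat_cond big1 ?addr0 // => m /andP[/andP[m0 mN] mn].
  case: eqP => [e|_]; last by rewrite mul0r.
  exfalso; move: mn; rewrite neq_ltn => /orP[mn|nm].
    by have := inj m n m0 mn nN; rewrite e.
  by have := inj n m n0 nm mN; rewrite e.
rewrite (funext E); apply: cvg_bigsum => n n0 nN.
have [na|na] := pselect (crit n = a).
  by rewrite na Fa mulr0; under eq_fun do rewrite mulr0; exact: cvg_cst.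
by apply: cvgMl; exact: J_cvg.
Qed.

Lemma sum_Nf F M : F a = 0 -> (forall i, `|F (orb i)| <= M) ->
  series (fun i => W i * F (orb i)) K @[K --> \oo] -->
    sum_upto (Nf f c) (fun n => J n * F (crit n)).
Proof.
move=> Fa FM; rewrite /Nf; case: asboolP => [/periodic_orbit[]|npc].
  exact: sum_Nf_fin.
case: asboolP => [[m hm]|ninf].
  have [h1 h2] := @least_spec [set n | is_periodic f (iter n f c)] m hm.
  by have [] := preperiodic_orbit npc h1 h2; exact: sum_Nf_fin.
have inj := infinite_orbit ninf.
(* On an infinite orbit every point is visited once, so the visits sum to the single weight
   [W n]. *)
have JW n : J n.+1 * F (crit n.+1) = W n * F (orb n).
  rewrite critS; have [na|na] := pselect (crit n.+1 = a); first by rewrite -critS na Fa !mulr0.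
  congr (_ * _); apply: cvgn_unique (J_cvg (ltn0Sn n) na) _.
  apply: (@cvg_stat _ _ _ n.+1) => K.
  rewrite critS (bigD1 (Ordinal (ltn_addl K (leqnn n.+1)))) //= eqxx big1 ?addr0 //.
  move=> i nEi; rewrite -!critS; case: eqP => // e; exfalso; move: nEi; rewrite -val_eqE /=.
  rewrite neq_ltn => /orP[h|h].
    exact: (inj n.+1 i.+1 n.+1 (ltn0Sn i) h (leqnn _)).
  by have := inj i.+1 n.+1 i.+1 (ltn0Sn n) h (leqnn _); rewrite e.
have C0 : 0 <= C by have := Wb 0%N; rewrite expr0 mulr1; exact: le_trans.
have [|t [_ _ cv]] := @expb_tail R (fun i => W i * F (orb i)) (C * M) th th01.
  by move=> i; rewrite normrM mulrAC ler_pM.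
rewrite /sum_upto (_ : limn _ = t 0%N) //; apply: (cvg_lim (@Rhausdorff R)).
rewrite -cvg_shiftS (_ : (fun n => _) = series (fun i => W i * F (orb i))) //.
apply/funext => n; rewrite /series /= big_add1 /=.
by apply: eq_bigr => i _; exact: JW.
Qed.

End orbits.

Section critical_sums.
Context {R : realType}.
Implicit Types (x y z s t k C M kappa : R) (X phi : R -> R) (n i j m K N : nat).
Variables (a c b th : R) (f : R -> R) (w dw : bool -> R -> R).
Hypothesis ex : expanding a c b th f w dw.
Hypothesis fw : forall e t, a <= t <= b -> t != c -> (if e then t < c else c < t) ->
  deriv_in `[a, b] f t = (w e t)^-1.
Notation orb i := (iter i f (f c)).
Notation crit := (crit c f).
Notation sg := (sg c f w).

Let th01 : 0 <= th < 1. Proof. by have /andP[/ltW -> ->] := ex_th ex. Qed.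

Lemma sg_scale kappa j : sg kappa j = kappa * sg 1 j.
Proof. by elim: j => [|j IH] /=; rewrite ?mulr1 // IH mulrA. Qed.

Lemma sg_deriv kappa j : (forall i, (i < j)%N -> orb i <> c) ->
  sg kappa j = kappa / deriv_iter a b f j (f c).
Proof.
elim: j => [|j IH] h; first by rewrite /deriv_iter big_ord0 divr1.
rewrite /= IH => [|i ij]; last by apply: h; exact: leqW.
rewrite /deriv_iter big_ord_recr /= invfM mulrA; congr (_ * _).
have oc : orb j != c by apply/eqP; exact: h.
rewrite /wv; have [lt|gt|E] := ltgtP (orb j) c; last by rewrite E eqxx in oc.
  by rewrite (@fw true) ?orb_ab // ?invrK // (orb_ab ex).
by rewrite (@fw false) ?invrK // (orb_ab ex).
Qed.

Lemma sg_zero kappa i j : orb i = c -> (i < j)%N -> sg kappa j = 0.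
Proof.
move=> ic; elim: j => // j IH; rewrite ltnS leq_eqVlt => /predU1P[<-|/IH /= ->]; last by rewrite mul0r.
by rewrite /= ic /wv ltxx mulr0.
Qed.

(** Links [Mf] to the first visit of [orb] at [c]. With the shift [orb i = crit i.+1], this visit
    occurs at index [n.-1], up to which [sg] agrees with the quotient by [deriv_iter] and after
    which it is zero. *)
Lemma Mf_spec : if Mf f c is Some n then
  [/\ (0 < n)%N, orb n.-1 = c & forall i, (i.+1 < n)%N -> orb i <> c]
  else forall i, orb i <> c.
Proof.
rewrite /Mf; case: asboolP => [/min_period_spec[p0 pc pm]|np]; last first.
  by move=> i ic; apply: np; exists i.+1; split => //; rewrite iterSr.
split => //; first by rewrite -iterSr prednK.
by move=> i ip ic; have := pm i.+1 (ltn0Sn i); rewrite iterSr ic => /(_ erefl); rewrite leqNgt ip.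
Qed.

Variables (X : R -> R) (MX : R).
Hypothesis XM : forall t, a <= t <= b -> `|X t| <= MX.

Let MX0 : 0 <= MX.
Proof. exact: le_trans (XM (orb_ab ex 0)). Qed.

Definition tau kappa i := sg kappa i * X (orb i).

Lemma tau_expb kappa : expb (`|kappa| * MX) th (tau kappa).
Proof.
by move=> i; rewrite normrM mulrAC ler_pM ?XM ?(orb_ab ex) // (sg_le ex).
Qed.

(** The term at index 0 vanishes. If [c] is periodic, so do all weights after the visit at [c], and
    the full series is the finite sum up to [Mf] minus one. *)
Lemma first_moment kappa : sum_upto (omap predn (Mf f c))
    (fun j => j%:R * X (orb j) / deriv_iter a b f j (f c)) = 0 ->
  series (fun i => i%:R * tau kappa i) n @[n --> \oo] --> 0.
Proof.
move=> h; suff h1 : series (fun i => i%:R * tau 1 i) n @[n --> \oo] --> 0.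
  rewrite -(mulr0 kappa) (_ : series _ = fun n => kappa * series (fun i => i%:R * tau 1 i) n).
    exact: cvgMr.
  apply/funext => n; rewrite /series /= mulr_sumr; apply: eq_bigr => i _.
  by rewrite /tau sg_scale; ring.
have tE j : (forall i, (i < j)%N -> orb i <> c) ->
    j%:R * X (orb j) / deriv_iter a b f j (f c) = j%:R * tau 1 j.
  by move=> hj; rewrite /tau sg_deriv //; ring.
move: h (Mf_spec); case: (Mf f c) => [p|] /= h.
  move=> [p0 pc pn]; apply: (@cvg_stat _ _ _ p); elim=> [|n IH].
    rewrite add0n -(prednK p0) /series /= big_nat_recl // mul0r add0r -[RHS]h.
    rewrite big_add1 /=; apply: eq_big_nat => j /andP[_ jp].
    by rewrite tE // => i ij; apply: pn; lia.
  by rewrite addSn seriesSr IH add0r /tau (sg_zero _ pc) ?mul0r ?mulr0 //; lia.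
move=> pn; have /andP[th0 th1] := th01; pose r := (1 + th) / 2.
have r0 : 0 < r by rewrite /r; lra.
have r1 : r < 1 by rewrite /r; lra.
have sr : 0 <= th / r < 1 by rewrite divr_ge0 ?(ltW r0) //= ltr_pdivrMr // mul1r /r; lra.
have r01 : 0 <= r < 1 by rewrite ltW.
have [|t [_ _ cv]] := @expb_tail R (fun i => i%:R * tau 1 i) (MX * (1 - th / r)^-1) r r01.
  move=> i; rewrite normrM ger0_norm //.
  have hi := tau_expb 1 i; rewrite normr1 mul1r in hi.
  apply: (@le_trans _ _ (i%:R * (MX * th ^+ i))); first by rewrite ler_wpM2l.
  have -> : th ^+ i = (th / r) ^+ i * r ^+ i by rewrite -exprMn divfK ?gt_eqF.
  rewrite !mulrA ler_wpM2r ?exprn_ge0 ?(ltW r0) // mulrAC mulrC ler_wpM2l //.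
  exact: mul_pow_le.
suff <- : t 0%N = 0 by [].
rewrite -[RHS]h; apply/esym; apply: (cvg_lim (@Rhausdorff R)).
rewrite (_ : (fun n => _) = series (fun i => i%:R * tau 1 i)) //.
apply/funext => n; case: n => [|n]; first by rewrite /series /= !big_geq.
rewrite big_add1 /series /= big_nat_recl // mul0r add0r.
by apply: eq_bigr => j _; rewrite tE.
Qed.

(** The inner sums are partial sums of [tau]. If [c] is periodic, [tau] is finitely supported with
    zero total, so the partial sums vanish from some index on and the convolution is a finite
    sum. *)
Lemma boundary_sum kappa phi M : (forall i, `|phi (orb i)| <= M) ->
  series (tau kappa) n @[n --> \oo] --> 0 ->
  sum_upto (Mf f c) (fun j => phi (crit j) *
    \sum_(1 <= k < j.+1) kappa * X (crit k) / deriv_iter a b f k.-1 (crit 1)) =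
  conv (fun i => series (tau kappa) i.+1) (fun m => phi (orb m)) 0.
Proof.
move=> phiK t0; set A := fun i => series (tau kappa) i.+1.
have hA : expb (`|kappa| * MX / (1 - th)) th A.
  move=> i; apply: le_trans (expb_series th01 (tau_expb kappa) t0 _) _.
  have /andP[th0 th1] := th01.
  rewrite exprS mulrCA ler_piMl ?(ltW th1) // mulr_ge0 ?exprn_ge0 //.
  by rewrite divr_ge0 ?mulr_ge0 // subr_ge0 ltW.
have cv := @cvg_conv R A (fun m => phi (orb m)) _ th M 0%N th01 hA phiK.
have sE j : (forall i, (i < j)%N -> orb i <> c) ->
    \sum_(1 <= k < j.+2) kappa * X (crit k) / deriv_iter a b f k.-1 (crit 1) = A j.
  move=> hj; rewrite /A /series /= big_add1 /=; apply: eq_big_nat => i /andP[_ ij].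
  have -> : f (crit i) = orb i by rewrite -critS.
  rewrite /tau sg_deriv => [|m mi]; first by ring.
  by apply: hj; exact: leq_trans mi _.
move: (Mf_spec); case: (Mf f c) => [p|] /=.
  move=> [p0 pc pn].
  have A0 i : (p <= i.+1)%N -> A i = 0.
    move=> pi; suff E m : series (tau kappa) (m + p)%N = series (tau kappa) p.
      by rewrite /A -(subnK pi) E; apply: (@cvgn_unique R (series (tau kappa))) => //; exact: cvg_stat E.
    elim: m => // m IH; rewrite addSn seriesSr IH /tau (sg_zero _ pc) ?mul0r ?addr0 //; lia.
  suff h : series (fun i => A i * phi (orb (0 + i))) m @[m --> \oo] -->
      series (fun i => A i * phi (orb (0 + i))) p.
    rewrite -(cvgn_unique h cv).
    rewrite big_add1 /= /series /=; apply: eq_big_nat => j /andP[_ jp].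
    rewrite sE => [|i ij]; last by apply: pn; exact: leq_ltn_trans ij jp.
    by rewrite add0n mulrC -critS.
  apply: (@cvg_stat _ _ _ p); elim=> // m IH.
  by rewrite addSn seriesSr IH A0 ?mul0r ?addr0 //; lia.
move=> pn; apply: (cvg_lim (@Rhausdorff R)).
rewrite -cvg_shiftS (_ : (fun n => _) = series (fun i => A i * phi (orb (0 + i)))) //.
apply/funext => n; rewrite /series /= big_add1 /=; apply: eq_bigr => j _.
by rewrite sE // add0n mulrC -critS.
Qed.

End critical_sums.

(** * The response *)

Section invariant_density.
Context {R : realType}.
Notation mu := (@lebesgue_measure R).
Implicit Types (x y z s t k C V : R) (u v q Q p P g : R -> R) (n i j K : nat) (e : bool).
Variables (a c b th : R) (f : R -> R) (w dw : bool -> R -> R).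
Hypothesis ex : expanding a c b th f w dw.
Hypotheses (fa : f a = a) (fb : f b = a).
Notation tr := (tr a c b f w).
Variable rho : R -> R.
Hypothesis brho : bmeas a b rho.
Variable m : probability (measurableTypeR R) R.
Hypothesis hm : acip a b f m.
Hypothesis hd : forall A : set R, measurable A -> m A = (\int[mu]_(x in A) (rho x)%:E)%E.

Lemma integral_subset_indic g (A : set R) : measurable A -> A `<=` `[a, b] -> intg a b g ->
  (\int[mu]_(t in A) (g t)%:E = (Int a b (fun t => g t * \1_A t))%:E)%E.
Proof.
move=> mA Aab ig.
have bA : bmeas a b (\1_A : R -> R).
  split; last by exists 1 => t _; rewrite indicE normr_nat; case: (_ \in _).
  exact: measurable_indic.
have i1 : intg a b (fun t => g t * \1_A t).
  by apply: (eq_intg _ (intgM bA ig)) => t _; rewrite mulrC.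
rewrite /Int /Rintegral fineK; last by apply: integrable_fin_num.
rewrite [LHS]integral_mkcond [RHS]integral_mkcond; apply: eq_integral => t _.
rewrite !patchE indicE; case: ifPn => tA.
  by rewrite ifT ?mulr1 //; apply/mem_set/Aab/set_mem.
by rewrite mulr0; case: ifP.
Qed.

Lemma density_mass : Int a b rho = 1.
Proof.
have [_ h _] := hm; move: h; rewrite hd; last exact: measurable_itv.
by rewrite /Int /Rintegral => ->.
Qed.

(** Invariance on a set [E] says that [rho] and [tr rho] have the same integral over [E], by the
    duality [Int_tr] with the indicator of [E]. *)
Lemma density_transfer : exists2 N : set R, mu.-negligible N &
  forall t, a <= t <= b -> ~ N t -> rho t = tr rho t.
Proof.
have [_ _ inv] := hm; have irho := bmeas_intg brho.
have it := intg_tr ex fa fb irho.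
have mab : measurable (`[a, b]%classic : set (measurableTypeR R)) by exact: measurable_itv.
have [A [mA A0 hA]] : ae_eq mu `[a, b]%classic (EFin \o rho) (EFin \o tr rho).
  apply: integral_ae_eq => //; first by have /integrableP[] := it.
  move=> E Eab mE; rewrite (integral_subset_indic mE Eab irho) (integral_subset_indic mE Eab it).
  have bE : bmeas a b (\1_E : R -> R).
    split; last by exists 1 => t _; rewrite indicE normr_nat; case: (_ \in _).
    exact: measurable_indic.
  rewrite (Int_tr ex fa fb irho bE).
  pose B := `[a, b]%classic `&` f @^-1` E.
  have mB : measurable B.
    have [mf _] := bmeas_comp_f ex bE.
    have -> : B = `[a, b]%classic `&` (\1_E \o f) @^-1` [set 1 : R].
      apply/seteqP; split => t [tab] /=; rewrite indicE.
        by move=> Et; split; rewrite // mem_set.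
      move=> h; split => //; apply: contrapT => nE; move: h; rewrite memNset //.
      by move/eqP; rewrite eq_sym oner_eq0.
    exact: mf.
  have := inv E mE; rewrite -/B hd // hd // (integral_subset_indic mB (@subIsetl _ _ _) irho).
  rewrite (integral_subset_indic mE Eab irho) => <-; congr (_%:E); apply: eq_Int => t tab.
  rewrite !indicE; congr (_ * _%:R); rewrite /B in_setI [t \in `[a, b]%classic]mem_set /= ?in_itv //.
exists A; first by exists A; split; [exact: mA|exact: A0|by move=> ?].
move=> t tab At; apply: contrapT => nE; apply: At; apply: hA => /= h.
by apply: nE; have := h; rewrite in_itv /= => /(_ tab) [].
Qed.

End invariant_density.

(** * Decay of correlations for the residue *)

Section decay.
Context {R : realType}.
Notation mu := (@lebesgue_measure R).
Implicit Types (x y z s t k C V A L M : R) (u v q Q p P g : R -> R) (n i j m K : nat) (e : bool).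
Implicit Types (T : (R -> R) -> R).
Variables (a c b th : R) (f : R -> R) (w dw ddw : bool -> R -> R).
Hypothesis ex : expanding a c b th f w dw.
Hypotheses (fa : f a = a) (fb : f b = a).
Notation lo := (blo a c).
Notation hi := (bhi c b).
Hypothesis pdw : forall e, prim (lo e) (hi e) (dw e) (ddw e).
Hypothesis bddw : forall e, bmeas (lo e) (hi e) (ddw e).
Notation tr := (tr a c b f w).

Let ab : a < b. Proof. exact: ex_ab ex. Qed.
Let afc : a <= f c. Proof. by have /andP[] := crit_ab ex. Qed.
Let fcb : f c <= b. Proof. by have /andP[] := crit_ab ex. Qed.
Let th0 : 0 < th. Proof. by have /andP[] := ex_th ex. Qed.
Let th1 : th < 1. Proof. by have /andP[] := ex_th ex. Qed.

Variables (C0 r : R).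
Hypotheses (C00 : 0 <= C0) (r01 : 0 < r < 1).
Hypothesis gap : forall T A, func a b A T -> T (fun=> 1) = 0 -> forall n q M, bmeas a b q ->
  (forall t, a <= t <= b -> `|q t| <= M) -> `|T (fun t => q (iter n f t))| <= C0 * A * r ^+ n * M.

Variables (rho vrho : R -> R).
Hypothesis rho_ctrl : forall s t, a <= s -> s <= t -> t <= b -> `|rho t - rho s| <= vrho t - vrho s.
Hypothesis mass : Int a b rho = 1.
Variables (X dX ddX H : R -> R).
Hypothesis pX : prim a (f c) X dX.
Hypothesis pdX : prim a (f c) dX ddX.
Hypothesis bddX : bmeas a (f c) ddX.
Hypothesis hH : regular_density a c b f w dw rho H.

Notation dens := (dens a c b f w dw rho).
Let Xt t := if t <= f c then X t else 0.
Let dXt t := if t <= f c then dX t else 0.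
Definition residue t := (if t <= f c then dX t else 0) * rho t + (if t <= f c then X t else 0) * H t.
Notation g := residue.

Hypothesis g0 : Int a b g = 0.

Let brho : bmeas a b rho. Proof. exact: control_bmeas (ltW ab) rho_ctrl. Qed.
Let bXt : bmeas a b Xt.
Proof. by apply: bmeas_cat => //; [exact: prim_bmeas pX|exact: bmeas_cst]. Qed.
Let bdXt : bmeas a b dXt.
Proof. by apply: bmeas_cat => //; [exact: prim_bmeas pdX|exact: bmeas_cst]. Qed.

Lemma intg_residue : intg a b g.
Proof.
have [iH _ _ _] := hH; apply: intgD; last exact: intgM bXt iH.
by apply/bmeas_intg/bmeasM.
Qed.

Lemma func_ext A T T' : (forall q, bmeas a b q -> T q = T' q) -> func a b A T -> func a b A T'.
Proof.
move=> E [lT bT vT]; split.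
- move=> k p q bp bq; rewrite -!E //; first exact: lT.
  by apply: bmeasD => //; exact: bmeasZ.
- by move=> q M bq h; rewrite -E //; exact: bT.
- by move=> q M bq h; rewrite -E //; exact: vT.
Qed.

Lemma func_add A A' T T' : func a b A T -> func a b A' T' -> func a b (A + A') (fun q => T q + T' q).
Proof.
move=> [lT bT vT] [lT' bT' vT']; split.
- by move=> k p q bp bq; rewrite lT // lT' //; ring.
- move=> q M bq h; rewrite mulrDl; apply: le_trans (ler_normD _ _) (lerD (bT _ _ bq h) (bT' _ _ bq h)).
- move=> q M bq h; rewrite mulrDl; apply: le_trans (ler_normD _ _) (lerD (vT _ _ bq h) (vT' _ _ bq h)).
Qed.

Lemma func_scale k A T : func a b A T -> func a b (`|k| * A) (fun q => k * T q).
Proof.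
move=> [lT bT vT]; split.
- by move=> s p q bp bq; rewrite lT //; ring.
- by move=> q M bq h; rewrite normrM -mulrA ler_wpM2l // bT.
- by move=> q M bq h; rewrite normrM -mulrA ler_wpM2l // vT.
Qed.

Let U m q := Int a b (fun t => dens m t * (Xt t * q t)).
Let V0 q := Int a b (fun t => rho t * (dXt t * q t)).
Let Lrho q := Int a b (fun t => rho t * q t).

(** Weighted transfer contracts the L1 norm of [dens], but on variation it is only bounded by some
    factor, so the bounds on the terms may grow like [L ^+ m]. *)
Lemma func_pieces : exists A L, [/\ 0 <= A, 1 <= L, func a b A Lrho, func a b A V0 &
  forall m, func a b (A * L ^+ m) (U m)].
Proof.
have [A0 fr] : exists A0, func a b A0 Lrho.
  by apply: (func_density ex brho) => s t as_ st tb; apply: rho_ctrl => //; exact: ltW.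
have A00 : 0 <= A0 by have [_ h _] := fr; exact: func_bd_ge0 h.
have [L1 L10 h1] := func_mult ex pdw bddw.
have [L2 L20 h2] := func_mult ex (ex_w ex) (ex_dw ex).
have fcab : a <= f c <= b by rewrite afc.
have [L3 L30 h3] := func_trunc ex fcab pX (prim_bmeas pdX).
have [L4 L40 h4] := func_trunc ex fcab pdX bddX.
have fB m : func a b ((L1 * A0) * (1 + L2) ^+ m) (fun q => Int a b (fun t => dens m t * q t)).
  elim: m => [|m IH].
    rewrite mulr1; apply: func_ext (h1 _ _ fr) => q bq.
    by rewrite (Int_dens0 ex fa fb rho_ctrl).
  have E : L2 * (L1 * A0 * (1 + L2) ^+ m) <= L1 * A0 * (1 + L2) ^+ m.+1.
    rewrite exprS [X in _ <= X]mulrCA; apply: ler_wpM2r; last by rewrite lerDr.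
    by rewrite mulr_ge0 ?exprn_ge0 ?mulr_ge0 ?addr_ge0.
  apply: (func_ext _ (funcW ab E (h2 _ _ IH))) => q bq.
  by rewrite (Int_dens ex fa fb rho_ctrl).
exists (A0 + L4 * A0 + L3 * (L1 * A0)), (1 + L2); split => //.
- by rewrite !addr_ge0 ?mulr_ge0.
- by rewrite lerDl.
- apply: (funcW ab _ fr); rewrite -addrA lerDl; by rewrite !addr_ge0 ?mulr_ge0.
- apply: (funcW ab _ (h4 _ _ fr)); rewrite addrAC lerDr; by rewrite !addr_ge0 ?mulr_ge0.
- move=> m; apply: (funcW ab _ (h3 _ _ (fB m))); rewrite mulrA ler_wpM2r ?exprn_ge0 ?addr_ge0 //.
  by rewrite lerDr !addr_ge0 ?mulr_ge0.
Qed.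

Lemma U_expb q M D : bmeas a b q -> (forall t, a <= t <= b -> `|q t| <= M) ->
  (forall t, a <= t <= b -> `|Xt t| <= D) ->
  expb (D * M * Int a b (fun t => `|dens 0 t|)) th (fun m => U m q).
Proof.
move=> bq qM XD m; have iD := intg_dens ex fa fb rho_ctrl m.
have bXq : bmeas a b (fun t => Xt t * q t) by exact: bmeasM.
have i1 : intg a b (fun t => dens m t * (Xt t * q t)).
  by apply: (eq_intg _ (intgM bXq iD)) => t _; rewrite mulrC.
have M0 : 0 <= M by apply: le_trans (qM a _); rewrite // lexx ltW.
have D0 : 0 <= D by apply: le_trans (XD a _); rewrite // lexx ltW.
apply: le_trans (norm_Int i1) _.
apply: (@le_trans _ _ (D * M * Int a b (fun t => `|dens m t|))).
  rewrite -IntZ; last exact: intg_norm.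
  apply: le_Int; [exact: intg_norm|exact/intgZ/intg_norm|].
  move=> t tab; rewrite !normrM mulrC ler_wpM2r // ler_pM ?XD ?qM //.
rewrite -[X in _ <= X]mulrA; apply: ler_wpM2l; first exact: mulr_ge0.
exact: (dens_norm ex fa fb rho_ctrl).
Qed.

(* [H] is only known to be integrable: its series is truncated after [n / p] terms,
   where [p] is such that the growth [(2 L)^(n / p)] of the variation is beaten by
   [r ^+ n]. *)
Lemma residue_decay : exists A s, [/\ 0 <= A, 0 < s < 1 & forall n q M, bmeas a b q ->
  (forall t, a <= t <= b -> `|q t| <= M) ->
  `|Int a b (fun t => g t * q (iter n f t))| <= A * s ^+ n * M].
Proof.
have [A [L [A0 L1 fr fV fU]]] := func_pieces.
have L0 : 0 <= L by exact: le_trans L1.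
pose G m q := V0 q + \sum_(i < m) U i q.
have fG m : func a b (A * (2 * L) ^+ m) (G m).
  elim: m => [|m IH].
    by rewrite mulr1; apply: func_ext fV => q bq; rewrite /G big_ord0 addr0.
  apply: (func_ext (T := fun q => G m q + U m q)).
    by move=> q bq; rewrite /G big_ord_recr /= addrA.
  apply: (funcW ab _ (func_add IH (fU m))); rewrite -mulrDr ler_wpM2l // exprS.
  have h1 : L ^+ m <= (2 * L) ^+ m by apply: lerXn2r; rewrite ?nnegrE ?mulr_ge0 //; lra.
  have h2 : 0 <= (2 * L) ^+ m by rewrite exprn_ge0 // mulr_ge0.
  have : 2 * (2 * L) ^+ m <= 2 * L * (2 * L) ^+ m by rewrite ler_wpM2r //; lra.
  lra.
have [_ [D hD]] := bXt.
have D_ge0 : 0 <= D by apply: le_trans (hD a _); rewrite // lexx ltW.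
pose D' := D * Int a b (fun t => `|dens 0 t|) / (1 - th).
have th01 : 0 <= th < 1 by rewrite ltW.
have D'0 : 0 <= D'.
  by rewrite divr_ge0 ?subr_ge0 ?(ltW th1) // mulr_ge0 // Int_ge0.
have [iH _ HI _] := hH.
have tail m q M : bmeas a b q -> (forall t, a <= t <= b -> `|q t| <= M) ->
    `|Int a b (fun t => g t * q t) - G m q| <= D' * th ^+ m * M.
  move=> bq qM; have [t [ut ht cv]] := expb_tail th01 (U_expb bq qM hD).
  have bXq : bmeas a b (fun t => Xt t * q t) by exact: bmeasM.
  have cv2 := HI _ bXq.
  have e0 : Int a b (fun t => H t * (Xt t * q t)) = t 0%N by exact: cvgn_unique cv2 cv.
  have -> : Int a b (fun t => g t * q t) = V0 q + t 0%N.
    rewrite -e0 /V0 -IntD.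
    - by apply: eq_Int => s _; rewrite /residue -/(Xt s) -/(dXt s); ring.
    - by apply/bmeas_intg/bmeasM => //; exact: bmeasM.
    - by apply: (eq_intg _ (intgM bXq iH)) => s _; rewrite mulrC.
  have -> : G m q = V0 q + (t 0%N - t m).
    congr (_ + _); elim: m => [|m IH]; first by rewrite big_ord0 subrr.
    by rewrite big_ord_recr /= IH ut; ring.
  rewrite (_ : _ - _ = t m); last by ring.
  apply: le_trans (ht m) _; rewrite (_ : _ * th ^+ m = D' * th ^+ m * M) //.
  by rewrite /D'; ring.
have b1 : bmeas a b (fun=> 1) by exact: bmeas_cst.
have G1 m : `|G m (fun=> 1)| <= D' * th ^+ m.
  have := tail m (fun=> 1) 1 b1; rewrite mulr1 => /(_ (fun _ _ => _)).
  rewrite (@eq_Int _ _ _ _ g) => [|t _]; last by rewrite mulr1.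
  by rewrite g0 sub0r normrN; apply => *; rewrite normr1.
have thm m : 0 <= th ^+ m <= 1 by rewrite exprn_ge0 ?exprn_ile1 // ltW.
(* The truncation [G m] does not have mass exactly zero. As [residue] does, its mass is at most the
   truncation error, and a multiple of the probability density [rho] removes it before [gap] is
   applied. *)
pose T m q := G m q + - G m (fun=> 1) * Lrho q.
have T1 m : T m (fun=> 1) = 0.
  rewrite /T /Lrho (@eq_Int _ _ _ _ rho) => [|t _]; last by rewrite mulr1.
  by rewrite mass mulr1 subrr.
have L21 m : 1 <= (2 * L) ^+ m by apply: exprn_ege1; lra.
have fT m : func a b ((A + D' * A) * (2 * L) ^+ m) (T m).
  apply: (funcW ab _ (func_add (fG m) (func_scale (- G m (fun=> 1)) fr))).
  rewrite normrN [X in _ <= X]mulrDl lerD2l.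
  apply: (@le_trans _ _ (D' * A)); last by rewrite ler_peMr // mulr_ge0.
  rewrite ler_wpM2r //; apply: le_trans (G1 m) _; rewrite ler_piMr //.
  by case/andP: (thm m).
have /andP[r0 r1] := r01.
have [p p0 hp] : exists2 p, (0 < p)%N & 2 * L * r ^+ p <= th.
  have r01' : 0 <= r < 1 by rewrite ltW.
  have /cvgrPdist_le /(_ _ th0)[p _ h] := cvg_pow (2 * L) r01'.
  exists p.+1 => //; have := h p.+1 (leqnSn p); rewrite /= sub0r normrN ger0_norm //.
  by rewrite mulr_ge0 ?exprn_ge0 ?mulr_ge0 // ltW.
pose B := C0 * (A + D' * A) + D' * A + D'.
have DA0 : 0 <= D' * A by exact: mulr_ge0.
have B0 : 0 <= B by rewrite /B !addr_ge0 // mulr_ge0 // addr_ge0.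
have main n q M : bmeas a b q -> (forall t, a <= t <= b -> `|q t| <= M) ->
    `|Int a b (fun t => g t * q (iter n f t))| <= B * th ^+ (n %/ p) * M.
  move=> bq qM; set m := (n %/ p)%N.
  have M0 : 0 <= M by apply: le_trans (qM a _); rewrite // lexx ltW.
  have bqn := bmeas_iter ex n bq.
  have qnM t : a <= t <= b -> `|q (iter n f t)| <= M by move=> /(ex_iter ex n) /qM.
  have h1 := tail m _ M bqn qnM.
  have h2 := gap (fT m) (T1 m) n bq qM.
  have h3 : `|Lrho (fun t => q (iter n f t))| <= A * M by have [_ + _] := fr; apply.
  have h4 : `|G m (fun=> 1) * Lrho (fun t => q (iter n f t))| <= D' * th ^+ m * (A * M).
    by rewrite normrM ler_pM.
  have h5 : C0 * ((A + D' * A) * (2 * L) ^+ m) * r ^+ n * M <= C0 * (A + D' * A) * th ^+ m * M.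
    have k0 : 0 <= C0 * (A + D' * A) by rewrite mulr_ge0 // addr_ge0.
    apply: ler_wpM2r => //; rewrite [C0 * _]mulrA -[_ * r ^+ n]mulrA; apply: ler_wpM2l => //.
    apply: (@le_trans _ _ ((2 * L * r ^+ p) ^+ m)); last first.
      by apply: lerXn2r; rewrite ?nnegrE ?mulr_ge0 ?exprn_ge0 // ltW.
    rewrite [X in _ <= X]exprMn -exprM ler_wpM2l ?exprn_ge0 ?mulr_ge0 //.
    by apply: ler_wiXn2l; rewrite ?(ltW r0) ?(ltW r1) // /m mulnC leq_trunc_div.
  set I := Int a b _ in h1 *; set G0 := G m (fun=> 1) in h4 *.
  have e : I = (I - G m (fun t => q (iter n f t))) + (T m (fun t => q (iter n f t))
     + G0 * Lrho (fun t => q (iter n f t))) by rewrite /T -/G0; ring.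
  rewrite e; apply: le_trans (ler_normD _ _) _.
  have := ler_normD (T m (fun t => q (iter n f t))) (G0 * Lrho (fun t => q (iter n f t))).
  have -> : B * th ^+ m * M = C0 * (A + D' * A) * th ^+ m * M + D' * th ^+ m * (A * M) + D' * th ^+ m * M.
    by rewrite /B; ring.
  move: h1 h2 h4 h5; lra.
(* The Bernoulli inequality again: [th <= s ^+ p] turns decay in [n / p] into decay in [n]. *)
pose s := 1 - (1 - th) / p%:R.
have p0' : 0 < p%:R :> R by rewrite ltr0n.
have x0 : 0 < (1 - th) / p%:R by rewrite divr_gt0 ?subr_gt0.
have x1 : (1 - th) / p%:R < 1.
  rewrite ltr_pdivrMr // mul1r; apply: (@lt_le_trans _ _ 1); first by rewrite gtrBl.
  by rewrite ler1n.
have s0 : 0 < s by rewrite /s subr_gt0.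
have s1 : s < 1 by rewrite /s gtrBl.
have sp : th <= s ^+ p.
  have := @bernoulli_ineq R ((1 - th) / p%:R) p; rewrite !(ltW x0, ltW x1) => /(_ isT).
  by rewrite mulrC divfK ?gt_eqF // opprB addrC subrK.
exists (B / s ^+ p), s; split; first by rewrite divr_ge0 ?exprn_ge0 // ltW.
  by rewrite s0.
move=> n q M bq qM; apply: le_trans (main n q M bq qM) _.
have M0 : 0 <= M by apply: le_trans (qM a _); rewrite // lexx ltW.
rewrite ler_wpM2r // -mulrA ler_wpM2l // mulrC ler_pdivlMr ?exprn_gt0 //.
apply: (@le_trans _ _ (s ^+ (p * (n %/ p)) * s ^+ p)).
  rewrite ler_wpM2r ?exprn_ge0 ?(ltW s0) // exprM.
  by apply: lerXn2r; rewrite ?nnegrE ?exprn_ge0 // ltW.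
rewrite -exprD; apply: ler_wiXn2l; rewrite ?(ltW s0) ?(ltW s1) //.
by rewrite {1}(divn_eq n p) mulnC leq_add2l ltnW // ltn_mod.
Qed.

(** Testing against the sign of the iterate turns the decay of correlations, uniform over bounded
    tests, into decay of the L1 norm. *)
Lemma iter_tr_decay A s : (forall n q M, bmeas a b q ->
    (forall t, a <= t <= b -> `|q t| <= M) ->
    `|Int a b (fun t => g t * q (iter n f t))| <= A * s ^+ n * M) ->
  forall n, Int a b (fun t => `|iter n tr g t|) <= A * s ^+ n.
Proof.
move=> h n; have it := intg_iter_tr ex fa fb n intg_residue.
pose q t : R := if 0 <= iter n tr g t then 1 else - 1.
have q1 t : `|q t| <= 1 by rewrite /q; case: ifP; rewrite ?normrN normr1.
have bq : bmeas a b q.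
  split; last by exists 1 => t _; exact: q1.
  apply: measurable_fun_if => //.
  by apply: measurable_fun_ler => //; exact: intg_meas it.
have := h n q 1 bq (fun t _ => q1 t); rewrite mulr1; apply: le_trans.
rewrite -(Int_iter_tr ex fa fb n intg_residue bq) (@eq_Int _ _ _ _ (fun t => `|iter n tr g t|)).
  exact: ler_norm.
move=> t _; rewrite /q; case: leP => h0; first by rewrite mulr1 ger0_norm.
by rewrite mulrN1 ltr0_norm.
Qed.

End decay.

(** * The Abel limit of the coefficients *)

Section abel_limit.
Context {R : realType}.
Implicit Types (C D K S s th z : R) (u p I beta : nat -> R) (n : nat).

Lemma expb_shift C s u : 0 <= s < 1 -> expb C s u -> expb C s (fun n => u n.+1).
Proof.
move=> /andP[s0 s1] h n; apply: le_trans (h n.+1) _.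
have C0 : 0 <= C by have := h 0%N; rewrite expr0 mulr1; exact: le_trans.
by rewrite exprS mulrCA ler_piMl ?(ltW s1) // mulr_ge0 ?exprn_ge0.
Qed.

Lemma abel_limit u p I beta C th K C' s S : 0 <= th < 1 -> 0 <= s < 1 ->
  expb C th u -> (forall n, `|p n| <= K) -> expb C' s beta ->
  series u n @[n --> \oo] --> 0 -> series (fun i => i%:R * u i) n @[n --> \oo] --> 0 ->
  series beta n @[n --> \oo] --> S ->
  (forall n, I n = - conv u p n - beta n) ->
  limn (series (fun n => z ^+ n * I n)) @[z --> 1^'-] --> - conv (fun i => series u i.+1) p 0 - S.
Proof.
move=> th01 s01 hu hp hb u0 u1 bS hI.
pose A i := series u i.+1; pose B i := series A i.+1.
have hA : expb (C / (1 - th)) th A by apply: expb_shift => //; exact: expb_series.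
have A0 : series A n @[n --> \oo] --> 0 by exact: (cvg_series_series th01 hu u0 u1).
have hB : expb (C / (1 - th) / (1 - th)) th B by apply: expb_shift => //; exact: expb_series.
have [t [bt ht ct]] := expb_tail s01 hb.
have [t' [tt' ht' _]] := expb_tail s01 ht.
have St : S = t 0%N by exact: cvgn_unique bS ct.
(* [B] sums [u] twice and [t'] is the tail of the tails of [beta]. Hence [delta] is bounded with
   second differences [I], and its first difference at 0 is the claimed limit. *)
pose delta n := - conv B p n - t' n.
have convA n : conv A p n = conv B p n - conv B p n.+1 by exact: (conv_diff n th01 hA).
have convu n : conv u p n = conv A p n - conv A p n.+1 by exact: (conv_diff n th01 hu).
set C1 := C / (1 - th) / (1 - th) in hB; set C2 := _ / (1 - s) in ht'.
have C20 : 0 <= C2 by have := ht' 0%N; rewrite expr0 mulr1; exact: le_trans.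
have hdelta n : `|delta n| <= C1 * K / (1 - th) + C2.
  rewrite /delta; apply: le_trans (ler_normB _ _) _; rewrite normrN; apply: lerD; first exact: conv_le.
  apply: le_trans (ht' n) _; case/andP: s01 => s0 s1.
  by rewrite ler_piMr // exprn_ile1 // ltW.
have hId n : I n = delta n - delta n.+1 - (delta n.+1 - delta n.+2).
  by rewrite hI convu !convA bt !tt' /delta; ring.
have -> : - conv (fun i => series u i.+1) p 0 - S = delta 0%N - delta 1%N.
  by rewrite -/A convA St tt' /delta; ring.
set D := C1 * K / (1 - th) + C2 in hdelta.
have D0 : 0 <= D by exact: le_trans (hdelta 0%N).
apply/cvgrPdist_le => e e0; rewrite near_withinE.
have k0 : 0 < e / (3 * D + 1) by rewrite divr_gt0 //; lra.
near=> z => z1.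
have zp : 0 < z < 1 by rewrite z1 andbT; near: z; exact: (lt_nbhsr ltr01).
have := abel_second_difference zp hdelta hId; rewrite distrC; move=> /le_trans; apply.
have h : 1 - z <= e / (3 * D + 1).
  rewrite -[X in X <= _]ger0_norm; last by rewrite subr_ge0 ltW.
  by near: z; exact: cvgr_dist_le.
apply: (@le_trans _ _ (3 * D * (e / (3 * D + 1)))); first by rewrite ler_wpM2l // mulr_ge0.
by rewrite mulrCA ler_piMr ?(ltW e0) // ler_pdivrMr ?mul1r; lra.
Unshelve. all: by end_near. Qed.

End abel_limit.

Section response.
Context {R : realType}.
Notation mu := (@lebesgue_measure R).
Implicit Types (x y z s t k C V A M : R) (u v q Q p P g psi D : R -> R) (n i j m K : nat) (e : bool).

Lemma Int_bound_ae x y q (N : set R) k : x <= y -> intg x y q -> mu.-negligible N -> 0 <= k ->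
  (forall t, x <= t <= y -> ~ N t -> `|q t| <= k) -> `|Int x y q| <= k * (y - x).
Proof.
move=> xy iq [B [mB B0 NB]] k0 h.
have nB : mu.-negligible (B : set (measurableTypeR R)) by exists B; split; [exact: mB|exact: B0|by []].
have bB : bmeas x y (\1_(~` B) : R -> R).
  split; last by exists 1 => t _; rewrite indicE normr_nat; case: (_ \in _).
  by apply: measurable_indic; exact: measurableC.
rewrite (@Int_ae _ _ _ _ _ (fun t => \1_(~` B) t * q t) nB); last first.
  by move=> t _ nBt; rewrite indicE mem_set ?mul1r.
apply: Int_bound => //; first exact: intgM bB iq.
move=> t txy; rewrite indicE; case: (boolP (t \in _)) => [/set_mem nBt|_]; last by rewrite mul0r normr0.
by rewrite mul1r; apply: h => // /NB.
Qed.

Variables (a c b th : R) (f : R -> R) (w dw ddw : bool -> R -> R).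
Hypothesis ex : expanding a c b th f w dw.
Hypotheses (fa : f a = a) (fb : f b = a).
Notation lo := (blo a c).
Notation hi := (bhi c b).
Notation orb i := (iter i f (f c)).

Let ac : a < c. Proof. by have /andP[] := ex_acb ex. Qed.
Let cb : c < b. Proof. by have /andP[] := ex_acb ex. Qed.
Let ab : a < b. Proof. exact: ex_ab ex. Qed.
Let afc : a <= f c. Proof. by have /andP[] := crit_ab ex. Qed.
Let fcb : f c <= b. Proof. by have /andP[] := crit_ab ex. Qed.
Let th01 : 0 <= th < 1. Proof. by have /andP[/ltW -> ->] := ex_th ex. Qed.

(** [phi o f^n] is not differentiable at preimages of [c]; absolute continuity with a bounded
    density, obtained branch by branch, is what survives composition. *)
Lemma iter_prim Q q n : prim a b Q q -> bmeas a b q ->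
  exists2 D, prim a b (Q \o iter n f) D & bmeas a b D.
Proof.
move=> pQ bq; elim: n => [|n [D pD bD]]; first by exists q.
pose E := glue c (fun e t => D (f t) / w e t).
have bE : bmeas a b E.
  apply: (bmeas_glue ex) => e; apply: bmeasM (ex_bf ex e).
  by have [l [h _]] := ex_lohi ex e; exact: bmeasS (bmeas_comp_f ex bD).
have pE e : prim (lo e) (hi e) (Q \o iter n.+1 f) E.
  have [l [h lh]] := ex_lohi ex e; have [i1 i2 _] := ex_image ex (lexx _) (lexx _) lh.
  apply: (prim_oo _ _ (prim_mono ex (lexx _) (lexx _) (ltW lh) (primS i1 i2 pD))) => t tI.
    by rewrite /= -iterSr.
  by rewrite /E (glue_oo _ tI).
by exists E => //; apply: (prim_cat (ltW ac) (ltW cb) (pE true) (pE false)).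
Qed.

Variables (rho vrho : R -> R) (kappa : R).
Hypothesis rho_ctrl : forall s t, a <= s -> s <= t -> t <= b -> `|rho t - rho s| <= vrho t - vrho s.
Variable H : R -> R.
Hypothesis hH : regular_density a c b f w dw rho H.
Variable N : set R.
Hypothesis nN : mu.-negligible N.
Hypothesis Nsat : forall t, a <= t <= b -> N t -> N (f t).
Hypothesis Norb : forall i, N (orb i).
Hypothesis Ninv : forall t, a <= t <= b -> ~ N t -> rho t = tr a c b f w rho t.
Hypothesis hleft : rho y @[y --> (f c)^'-] --> - kappa.

Variables (X dX ddX : R -> R).
Hypothesis Xa : X a = 0.
Hypothesis pX : prim a (f c) X dX.
Hypothesis pdX : prim a (f c) dX ddX.

Notation Xt t := (if t <= f c then X t else 0).
Notation g := (residue c f rho X dX H).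
Notation sal := (sal c f w kappa).
Notation reg := (reg a c f H).
Notation defect := (defect a c f w rho kappa H).

Let brho : bmeas a b rho. Proof. exact: control_bmeas (ltW ab) rho_ctrl. Qed.
Let bXt : bmeas a b (fun t => Xt t).
Proof. by apply: bmeas_cat => //; [exact: prim_bmeas pX|exact: bmeas_cst]. Qed.

Lemma Int_sal (Y y : R -> R) K : Y a = 0 -> prim a (f c) Y y ->
  Int a (f c) (fun t => y t * sal K t) = - \sum_(i < K) sg c f w kappa i * Y (orb i).
Proof.
move=> Ya [iy hY]; elim: K => [|K IH].
  rewrite big_ord0 oppr0 (@eq_Int _ _ _ _ (fun=> 0)) ?Int_cst // ?mul0r // => t _.
  by rewrite /sal big_ord0 oppr0 mulr0.
have oa : a <= orb K by case/andP: (orb_ab ex K).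
have oc : orb K <= f c by exact: orb_le ex K.
have bs : bmeas a (f c) (sal K) by exact: bmeasS (bmeas_sal _ _ _ _ _ _ _).
have bk : bmeas a (f c) (fun t => if orb K <= t then 0 else 1).
  split; last by exists 1 => t _; case: ifP; rewrite ?normr0 ?normr1.
  by apply: measurable_fun_if => //; exact: measurable_fun_ler.
have i1 : intg a (f c) (fun t => y t * sal K t).
  by apply: (eq_intg _ (intgM bs iy)) => t _; rewrite mulrC.
have i2 : intg a (f c) (fun t => (if orb K <= t then 0 else 1) * y t) by exact: intgM bk iy.
rewrite big_ord_recr /= (@eq_Int _ _ _ _ (fun t => y t * sal K t +
  (- sg c f w kappa K) * ((if orb K <= t then 0 else 1) * y t))); last first.
  move=> t _; rewrite /sal big_ord_recr /= ltNge; case: (orb K <= t) => /=; ring.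
rewrite IntD //; last exact: intgZ.
rewrite IH IntZ // opprD mulNr; congr (_ - _ * _).
rewrite (Int_cat oa oc) // (@Int_oo _ _ _ _ y) => [|t /andP[_ tk]]; last by rewrite leNgt tk mul1r.
rewrite (@eq_Int _ (orb K) _ _ (fun=> 0)) => [|t /andP[-> _]]; last by rewrite mul0r.
by rewrite Int_cst // mul0r addr0 -hY // Ya subr0.
Qed.

(* [rho = sal K + reg + defect K], and integrating by parts the pieces [reg] and
   [sal K] against [(X psi)'] leaves the boundary terms at the orbit points. *)
Lemma boundary_series psi D : prim a b psi D -> bmeas a b D ->
  series (fun i => tau c f w X kappa i * psi (orb i)) K @[K --> \oo] -->
  - Int a b (fun t => Xt t * rho t * D t) - Int a b (fun t => g t * psi t).
Proof.
move=> pp bD; pose y t := dX t * psi t + X t * D t; pose Y t := X t * psi t.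
have pY : prim a (f c) Y y by apply: primM => //; exact: primS pp.
have by_ : bmeas a (f c) y.
  apply: bmeasD; apply: bmeasM; [exact: prim_bmeas pdX| |exact: prim_bmeas pX|exact: bmeasS bD].
  by apply: bmeasS (prim_bmeas pp).
have Ya : Y a = 0 by rewrite /Y Xa mul0r.
have [iH _ _ _] := hH.
have ig : intg a b (fun t => g t * psi t).
  apply: (eq_intg _ (intgM (prim_bmeas pp) (intg_residue ex rho_ctrl pX pdX hH))) => t _.
  by rewrite mulrC.
have iD : intg a b (fun t => Xt t * rho t * D t).
  by apply: bmeas_intg; apply: bmeasM => //; exact: bmeasM.
rewrite -opprD -IntD //.
have bY := prim_bmeas pY.
have iHc : intg a (f c) H by apply: intgS iH.
have iYH : intg a (f c) (fun t => Y t * H t) by exact: intgM.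
have preg := prim_reg hH.
have bs K : bmeas a (f c) (sal K) by exact: bmeasS (bmeas_sal _ _ _ _ _ _ _).
have bd K : bmeas a (f c) (defect K) by exact: bmeasS (bmeas_defect ex _ rho_ctrl hH K).
have breg : bmeas a (f c) reg by exact: bmeasS (prim_bmeas preg).
pose J := Int a (f c) (fun t => y t * rho t + Y t * H t).
have -> : Int a b (fun t => Xt t * rho t * D t + g t * psi t) = J.
  rewrite (Int_cat afc fcb); last exact: intgD.
  rewrite [X in _ + X](@Int_oo _ _ _ _ (fun=> 0)) => [|t /andP[ct _]]; last first.
    by rewrite /residue leNgt ct /=; ring.
  rewrite Int_cst // mul0r addr0; apply: eq_Int => t /andP[_ tc].
  by rewrite /residue tc /y /Y; ring.
have JK K : J = - \sum_(i < K) sg c f w kappa i * Y (orb i) + Int a (f c) (fun t => y t * defect K t).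
  rewrite -(Int_sal K Ya pY).
  (* The integrand is the derivative of [Y * reg], whose boundary values vanish: [Y a = 0] because
     [X a = 0], and [reg (f c) = 0]. *)
  have e0 : Int a (f c) (fun t => y t * reg t + Y t * H t) = 0.
    have [_ h] := primM pY (primS (lexx a) fcb preg).
    by rewrite -h // (reg_crit ex hH) // Ya; ring.
  rewrite -[LHS]addr0 -e0 /J.
  have i1 : intg a (f c) (fun t => y t * sal K t) by apply/bmeas_intg/bmeasM.
  have i2 : intg a (f c) (fun t => y t * defect K t) by apply/bmeas_intg/bmeasM.
  have i3 : intg a (f c) (fun t => y t * reg t) by apply/bmeas_intg/bmeasM.
  rewrite e0 addr0 -[RHS]addr0 -e0 -IntD // -IntD; [|exact: intgD|exact: intgD].
  by apply: eq_Int => t _; rewrite /defect; ring.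
have [_ [Dy hy]] := by_.
have Dy0 : 0 <= Dy by apply: le_trans (hy a _); rewrite // lexx.
have k0 : 0 <= `|kappa| / (1 - th) by rewrite divr_ge0 // subr_ge0 ltW //; case/andP: th01.
have dc : Int a (f c) (fun t => y t * defect K.+1 t) @[K --> \oo] --> 0.
  apply: (@cvg_squeeze0 _ _ (fun K => Dy * (`|kappa| / (1 - th)) * (f c - a) * th ^+ K)); last exact: cvg_pow.
  move=> K; have -> : Dy * (`|kappa| / (1 - th)) * (f c - a) * th ^+ K =
    (Dy * (`|kappa| / (1 - th) * th ^+ K)) * (f c - a) by ring.
  have tK : 0 <= th ^+ K by rewrite exprn_ge0 //; case/andP: th01.
  apply: (@Int_bound_ae _ _ _ N) => //; first by apply/bmeas_intg/bmeasM.
    by rewrite mulr_ge0 // mulr_ge0.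
  move=> t /andP[ta tc] Nt; rewrite normrM ler_pM ?hy ?ta //.
  apply: le_trans (defect_bound ex fa fb rho_ctrl hH nN Nsat Norb Ninv hleft _ _ Nt) _ => //.
    by rewrite ta (le_trans tc).
  rewrite ler_wpM2l // exprS ler_piMl //; by case/andP: th01 => _ /ltW.
rewrite -cvg_shiftS -[- J]add0r.
rewrite (_ : (fun n => _) = fun K => Int a (f c) (fun t => y t * defect K.+1 t) - J).
  by apply: cvgB; [exact: dc|exact: cvg_cst].
apply/funext => K; rewrite (JK K.+1) /series /= big_mkord opprD opprK addrCA subrr addr0.
by apply: eq_bigr => i _; rewrite /tau /Y mulrA.
Qed.

(** The case [psi = 1] of [boundary_series]. *)
Lemma residue_mass : series (tau c f w X kappa) n @[n --> \oo] --> 0 -> Int a b g = 0.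
Proof.
move=> t0; have := boundary_series (prim_cst a b 1) (bmeas_cst a b 0).
rewrite (_ : (fun i => _ * 1) = tau c f w X kappa); last by apply/funext => i; rewrite mulr1.
move=> /(cvgn_unique t0)/eqP.
rewrite (@eq_Int _ _ _ (fun t => Xt t * rho t * 0) (fun=> 0)) => [|t _]; last by rewrite mulr0.
rewrite (@eq_Int _ _ _ (fun t => g t * 1) g) => [|t _]; last by rewrite mulr1.
by rewrite Int_cst ?(ltW ab) // mul0r oppr0 sub0r eq_sym oppr_eq0 => /eqP.
Qed.

End response.

Lemma negligible_countable (R : realType) (A : set R) : countable A -> (@lebesgue_measure R).-negligible A.
Proof.
move=> cA; have mA : measurable (A : set (measurableTypeR R)).
  by apply: countable_measurable => // t; exact: measurable_set1.
by exists A; split; [exact: mA|exact: countable_lebesgue_measure0|by move=> ?].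
Qed.

(** * Identification of the source and of the resolvent *)

Section regular_part.
Context {R : realType}.
Notation mu := (@lebesgue_measure R).
Implicit Types (x y z s t k C V A M : R) (u v q Q p P g psi D : R -> R) (n i j m K : nat) (e : bool).
Variables (a c b th : R) (f : R -> R) (w dw : bool -> R -> R).
Hypothesis ex : expanding a c b th f w dw.
Hypotheses (fa : f a = a) (fb : f b = a).
Notation orb i := (iter i f (f c)).

Let ac : a < c. Proof. by have /andP[] := ex_acb ex. Qed.
Let cb : c < b. Proof. by have /andP[] := ex_acb ex. Qed.
Let ab : a < b. Proof. exact: ex_ab ex. Qed.
Let afc : a <= f c. Proof. by have /andP[] := crit_ab ex. Qed.
Let fcb : f c <= b. Proof. by have /andP[] := crit_ab ex. Qed.
Let th01 : 0 <= th < 1. Proof. by have /andP[/ltW -> ->] := ex_th ex. Qed.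

Variables (rho vrho : R -> R) (kappa : R).
Hypothesis rho_ctrl : forall s t, a <= s -> s <= t -> t <= b -> `|rho t - rho s| <= vrho t - vrho s.
Variable H : R -> R.
Hypothesis hH : regular_density a c b f w dw rho H.
Variable N : set R.
Hypothesis nN : mu.-negligible N.
Hypothesis Nsat : forall t, a <= t <= b -> N t -> N (f t).
Hypothesis Norb : forall i, N (orb i).
Hypothesis Ninv : forall t, a <= t <= b -> ~ N t -> rho t = tr a c b f w rho t.
Hypothesis hleft : rho y @[y --> (f c)^'-] --> - kappa.
Hypothesis rho_out : forall t, b < t -> rho t = 0.
Notation sal := (sal c f w kappa).
Notation reg := (reg a c f H).
Notation defect := (defect a c f w rho kappa H).

Lemma crit_ge n : a <= crit c f n.
Proof. by case: n => [|n]; [exact: ltW|rewrite critS; case/andP: (orb_ab ex n)]. Qed.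

Lemma weights_cvg n : (0 < n)%N -> crit c f n <> a ->
  \sum_(i < K) (if orb i == crit c f n then sg c f w kappa i else 0) @[K --> \oo] --> jump c f rho n.
Proof.
move=> n0 /eqP na; apply: (jump_cvg ex fa fb rho_ctrl hH nN Nsat Norb Ninv hleft rho_out n0).
by rewrite lt_neqAle eq_sym na crit_ge.
Qed.

Lemma sum_jumps (F : R -> R) M : F a = 0 -> (forall i, `|F (orb i)| <= M) ->
  series (fun i => sg c f w kappa i * F (orb i)) K @[K --> \oo] -->
  sum_upto (Nf f c) (fun n => jump c f rho n * F (crit c f n)).
Proof. by move=> Fa FM; exact: (sum_Nf th01 (sg_le ex kappa) weights_cvg Fa FM). Qed.

(** As a function of its location, a step evaluated at [x > a] vanishes at location [a], so
    [sum_jumps] applies. The partial sums are [sal K x], which tend to [rho x - reg x] because the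
    defect tends to 0. *)
Lemma rho_salE x : a < x <= b -> ~ N x -> rho_sal c f rho x = rho x - reg x.
Proof.
move=> /andP[ax xb] Nx.
have sa : step_fun a x = 0 by rewrite /step_fun ltNge (ltW ax) /= gt_eqF.
have s1 i : `|step_fun (orb i) x| <= 1.
  rewrite /step_fun; case: ifP => _; first by rewrite normrN normr1.
  by case: ifP => _; rewrite ?normr0 // normrN ger0_norm; lra.
have h1 := sum_jumps (F := fun z => step_fun z x) sa s1.
apply: (cvgn_unique h1).
have -> : series (fun i => sg c f w kappa i * step_fun (orb i) x) = fun K => sal K x.
  apply/funext => K; rewrite /series /sal /= big_mkord -sumrN; apply: eq_bigr => i _.
  rewrite /step_fun; case: ifP => _; first by rewrite mulrN1.
  case: eqP => [e|_]; last by rewrite mulr0 oppr0.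
  by exfalso; apply: Nx; rewrite e; exact: Norb.
have dK : defect K.+1 x @[K --> \oo] --> 0.
  apply: (@cvg_squeeze0 _ _ (fun K => `|kappa| / (1 - th) * th * th ^+ K)); last exact: cvg_pow.
  move=> K; rewrite -[X in _ <= X]mulrA -exprS.
  by apply: (defect_bound ex fa fb rho_ctrl hH nN Nsat Norb Ninv hleft) => //; rewrite (ltW ax).
rewrite -cvg_shiftS (_ : (fun n => _) = fun K => (rho x - reg x) - defect K.+1 x).
  by have := cvgB (cvg_cst (rho x - reg x)) dK; rewrite subr0; apply.
by apply/funext => K; rewrite /defect; ring.
Qed.

Variable rho_reg : R -> R.
Hypothesis hreg : regular_part c f rho rho_reg.

(** Both sides are continuous and agree off a null set, which has points of the complement
    arbitrarily close to [x]. *)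
Lemma rho_regE x : a <= x <= b -> rho_reg x = reg x.
Proof.
move=> xab; have [cr cnt] := hreg.
have nC := negligible_countable cnt.
have nU := negligibleU nN nC.
apply/eqP; rewrite -subr_eq0 -normr_le0; apply/ler_addgt0Pl => e e0; rewrite addr0.
have e2 : 0 < e / 2 by rewrite divr_gt0.
have [d d0 hd] := prim_cont (prim_reg hH) xab e2.
have /cvgrPdist_le /(_ _ e2)/nbhs_ballP[d' d'0 hd'] := cr x.
pose r := Num.min d d'.
have r0 : 0 < r by rewrite lt_min d0.
have lt1 : Num.max a (x - r) < Num.min b (x + r).
  case/andP: xab => ax xb.
  by rewrite gt_max !lt_min ab; apply/andP; split; apply/andP; split; lra.
have [u /andP[lu ul] Nu] := negligible_pick nU lt1.
move: lu ul; rewrite gt_max lt_min => /andP[au xu] /andP[ub ux].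
have ur : `|u - x| < r by rewrite ltr_distl xu.
have [ud ud'] : `|u - x| < d /\ `|u - x| < d' by move: ur; rewrite /r lt_min => /andP.
have E : rho_reg u = reg u.
  have nNu : ~ N u by move=> h; apply: Nu; left.
  have h1 : rho u = rho_sal c f rho u + rho_reg u.
    by apply: contrapT => h; apply: Nu; right.
  move: h1; rewrite rho_salE ?au ?(ltW ub) // => h.
  by apply: (addrI (rho u - reg u)); rewrite -h; ring.
have h1 : `|rho_reg x - rho_reg u| <= e / 2 by apply: hd'; rewrite /ball /= distrC.
have h2 : `|reg u - reg x| <= e / 2 by apply: hd => //; rewrite (ltW au) (ltW ub).
have -> : rho_reg x - reg x = (rho_reg x - rho_reg u) + (reg u - reg x) by rewrite E; ring.
by apply: le_trans (ler_normD _ _) _; lra.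
Qed.

Variables (X dX ddX : R -> R).
Hypothesis pX : prim a (f c) X dX.
Hypothesis pdX : prim a (f c) dX ddX.
Hypothesis dXE : dX = deriv_in `[a, f c] X.

(** Almost everywhere, [dX * (rho - reg)] plus the derivative [dX * reg + X * H] of [X * reg] is
    [dX * rho + X * H]. *)
Lemma source_residue : exists2 N' : set R, mu.-negligible N' &
  forall t, a <= t <= b -> ~ N' t ->
    source a c f rho rho_reg X t = residue c f rho X dX H t.
Proof.
pose Y y := (X \_ `[a, crit c f 1]) y * rho_reg y.
pose D t := if t <= f c then dX t * reg t + X t * H t else 0.
have XE t : a <= t -> (X \_ `[a, crit c f 1]) t = if t <= f c then X t else 0.
  by move=> at_; rewrite patchE mem_setE /= in_itv /= at_.
have pD : prim a b Y D.
  apply: (prim_cat afc fcb).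
    apply: (prim_oo _ _ (primM pX (primS (lexx _) fcb (prim_reg hH)))) => t /andP[at_ tc].
      by rewrite /Y XE // tc rho_regE // at_ (le_trans tc).
    by rewrite /D ltW.
  (* The truncation of [X] at [f c] creates no jump in the product, since [reg] vanishes from [f c]
     on. *)
  apply: (prim_oo _ _ (prim_cst (f c) b 0)) => t /andP[ct tb].
    have at_ : a <= t by exact: le_trans ct.
    rewrite /Y XE // rho_regE ?at_ // (reg_crit ex hH) ?mulr0 //.
  by rewrite /D leNgt ct.
have [M nM hM] := prim_derive ab pD.
have nE : mu.-negligible ([set a] `|` [set b]).
  by apply: negligibleU; apply: negligible_countable; exact: countable1.
exists (N `|` M `|` ([set a] `|` [set b])).
  by apply: negligibleU nE; exact: negligibleU.
move=> t /andP[ta tb] h.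
have nN' : ~ N t by move=> ?; apply: h; left; left.
have nM' : ~ M t by move=> ?; apply: h; left; right.
have at_ : a < t.
  by rewrite lt_neqAle ta andbT; apply/eqP => e; apply: h; right; left; rewrite e.
have tb_ : t < b.
  by rewrite lt_neqAle tb andbT; apply/eqP => e; apply: h; right; right; rewrite e.
rewrite /source hM ?at_ // rho_salE ?at_ // patchE mem_setE /= in_itv /= ta /residue /D -dXE.
have -> : (point : R) = 0 by [].
by rewrite andTb; case: ifP => _; ring.
Qed.

Hypothesis fw : forall e t, a <= t <= b -> t != c -> (if e then t < c else c < t) ->
  deriv_in `[a, b] f t = (w e t)^-1.
Notation g := (residue c f rho X dX H).

Lemma resolvent_integral A s : 0 <= s < 1 ->
  (forall n, Int a b (fun t => `|iter n (tr a c b f w) g t|) <= A * s ^+ n) ->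
  forall q, bmeas a b q ->
  series (fun n => Int a b (fun t => g t * q (iter n f t))) n @[n --> \oo] -->
  Int a b (fun t => resolvent1 a b f (source a c f rho rho_reg X) t * q t).
Proof.
move=> s01 hA q bq.
have ig : intg a b g by exact: (intg_residue ex rho_ctrl pX pdX hH).
have it n : intg a b (iter n (tr a c b f w) g) by exact: (intg_iter_tr ex fa fb n ig).
have [N1 [U [nN1 iU cvU cvI]]] := L1_series (ltW ab) s01 it hA.
have [N2 nN2 hN2] := source_residue.
(* Off this set, [transfer] may be replaced by [tr] (it contains the critical orbit) and [source] by
   [residue], under all iterates at once. *)
have [N3 [nN3 sub sat]] := negligible_saturate ex fa fb (negligibleU nN nN2).
have nN13 := negligibleU nN1 nN3.
rewrite (Int_ae nN13 (g := fun t => U t * q t)); last first.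
  move=> t tab Nt; congr (_ * _).
  have nt1 : ~ N1 t by move=> ?; apply: Nt; left.
  have nt3 : ~ N3 t by move=> ?; apply: Nt; right.
  rewrite /resolvent1; apply: (cvg_lim (@Rhausdorff R)).
  rewrite (_ : (fun j => _) = (fun j => iter j (tr a c b f w) g t)); first exact: cvU.
  apply/funext => j; rewrite (iter_transferE ex fa fb fw).
    apply: (@iter_tr_off _ _ _ _ _ _ _ _ ex fa fb _ _ _ j t sat _ tab nt3) => z zab nz.
    by apply: hN2 => // h; apply: nz; apply: sub; right.
  move=> i _; apply/eqP => e; apply: nt3; apply: sub; left; rewrite e iterSr.
  exact: Norb.
rewrite (_ : (fun n => Int a b _) = fun n => Int a b (fun t => iter n (tr a c b f w) g t * q t)).
  exact: cvI bq.
by apply/funext => n; rewrite (Int_iter_tr ex fa fb).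
Qed.

End regular_part.

Lemma image_crit (R : realType) (a c b th : R) (f : R -> R) (w dw : bool -> R -> R) :
  expanding a c b th f w dw -> f a = a -> f @` `[a, b] = `[a, f c]%classic.
Proof.
move=> ex fa; have /andP[ac cb] := ex_acb ex; apply/seteqP; split => y.
  move=> [t]; rewrite /= !in_itv /= => tab <-.
  by have /andP[-> _] := ex_map ex tab; exact: (crit_max ex tab).
rewrite /= in_itv /= => /andP[ay yc].
have [|s /andP[s1 s2] <-] := @iter_IVT _ _ _ _ _ _ _ _ ex 1 a c y (lexx a) (ltW ac) (ltW cb).
  by left; rewrite /= fa ay.
by exists s => //=; rewrite in_itv /= s1 (le_trans s2 (ltW cb)).
Qed.

Theorem proposition4p6 (R : realType) (a c b : R) (f rho0 rho_reg X : R -> R)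
  (hf : unimodal_expanding 3 a c b f)
  (hmix : mixing c f)
  (hrho0 : acip_density a b f rho0)
  (hreg : regular_part c f rho0 rho_reg)
  (hX : Ck_on 2 (f @` `[a, b]) X)
  (hXa : X a = 0)
  (hJ : Jfun c f rho0 X = 0)
  (hsum : sum_upto (omap predn (Mf f c))
            (fun j => j%:R * X (iter j f (f c)) / deriv_iter a b f j (f c)) = 0)
  (phi : R -> R)
  (hphi : Ck_on 1 `[a, b] phi) :
  Psi a c b f rho0 X phi z @[z --> 1^'-] --> Psi1 a c b f rho0 rho_reg X phi.
Proof.
have [th [w [dw [ddw [ex pdw bddw fw]]]]] := extraction hf.
have [_ _ _ [fa fb] _] := hf.
have ab := ex_ab ex; have /andP[ac cb] := ex_acb ex.
have cfc := crit_lt ex fa; have /andP[afc fcb] := crit_ab ex.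
have /andP[th0 th1] := ex_th ex.
have th01 : 0 <= th < 1 by rewrite ltW.
have [bv _ rho_notin [m hm hd]] := hrho0.
have [vrho rho_ctrl] := bv_control (ltW ab) bv.
have rho_out t : b < t -> rho0 t = 0.
  by move=> bt; apply: rho_notin; rewrite in_itv /= negb_and -!ltNge bt orbT.
have brho := control_bmeas (ltW ab) rho_ctrl.
have mass := density_mass hm hd.
have [N0 nN0 hN0] := density_transfer ex fa fb brho hm hd.
have nO : (@lebesgue_measure R).-negligible (range (fun i => iter i f (f c))).
  by apply: negligible_countable; exact: card_image_le.
have [N [nN sub Nsat]] := negligible_saturate ex fa fb (negligibleU nN0 nO).
have Norb i : N (iter i f (f c)) by apply: sub; right; exists i.
have Ninv t : a <= t <= b -> ~ N t -> rho0 t = tr a c b f w rho0 t.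
  by move=> tab nNt; apply: hN0 => // h; apply: nNt; apply: sub; left.
have [H hH] := regular_density_exists ex fa fb rho_ctrl.
have hright := right_crit ex rho_ctrl nN Ninv rho_out.
have [l hl] := control_left (lt_trans ac cfc) fcb rho_ctrl.
(* The right limit at [f c] is 0, so the jump is minus the left limit. *)
pose kappa := jump c f rho0 1.
have hleft : rho0 y @[y --> (f c)^'-] --> - kappa.
  rewrite /kappa /jump (_ : crit c f 1 = f c) //.
  rewrite (cvg_lim (@Rhausdorff R) hright) (cvg_lim (@Rhausdorff R) hl).
  by rewrite sub0r opprK.
rewrite (image_crit ex fa) in hX.
have [pX [ddX pdX bddX]] := Ck_on2_prim hX.
set dX := deriv_in _ X in pX pdX.
have [_ [MX hMX]] := prim_bmeas pX.
(* [X] is controlled only on [[a, f c]]; the cut-off is bounded on all of [[a, b]] and agrees with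
   [X] along the orbit. *)
pose X0 t := if t <= f c then X t else 0.
have X0M t : a <= t <= b -> `|X0 t| <= `|MX|.
  move=> /andP[ta tb]; rewrite /X0; case: ifP => tc; last by rewrite normr0.
  by apply: le_trans (hMX t _) (ler_norm _); rewrite ta.
have orbE i : X0 (iter i f (f c)) = X (iter i f (f c)) by rewrite /X0 (orb_le ex).
have tauE : tau c f w X0 kappa = tau c f w X kappa.
  by apply/funext => i; rewrite /tau orbE.
have htau : expb (`|kappa| * `|MX|) th (tau c f w X kappa).
  by rewrite -tauE; exact: (tau_expb ex X0M).
have t0 : series (tau c f w X kappa) n @[n --> \oo] --> 0.
  rewrite -[X in _ --> X]hJ; apply: (sum_jumps ex fa fb rho_ctrl hH nN Nsat Norb Ninv hleft rho_out hXa (M := `|MX|)).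
  by move=> i; rewrite -orbE; apply: X0M; exact: orb_ab ex i.
have t1 : series (fun i => i%:R * tau c f w X kappa i) n @[n --> \oo] --> 0.
  rewrite -tauE; apply: (first_moment ex fw X0M kappa).
  rewrite -[RHS]hsum; congr (sum_upto _ _); apply/funext => j; by rewrite orbE.
have g0 := residue_mass ex fa fb rho_ctrl hH nN Nsat Norb Ninv hleft hXa pX pdX t0.
have [C0 [r [C00 r01 gap]]] := spectral_gap ex (mixing_covers ex fa hmix).
have [A [s [A0 s01 hA]]] := residue_decay ex fa fb pdw bddw C00 r01 gap rho_ctrl mass pX pdX bddX hH g0.
have s01' : 0 <= s < 1 by case/andP: s01 => /ltW -> ->.
have hD := iter_tr_decay ex fa fb rho_ctrl pX pdX hH hA.
have pphi := Ck_on1_prim hphi; have bphi := prim_bmeas pphi.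
have bdphi : bmeas a b (deriv_in `[a, b] phi) by case: hphi => _ /within_bmeas.
have [_ [K hK]] := bphi.
have res := resolvent_integral ex fa fb rho_ctrl hH nN Nsat Norb Ninv hleft rho_out hreg pX pdX erefl fw s01' hD bphi.
pose p n := phi (iter n f (f c)).
have pK n : `|p n| <= K by apply: hK; exact: orb_ab ex n.
pose beta n := Int a b (fun t => residue c f rho0 X dX H t * phi (iter n f t)).
have hbeta : expb (A * K) s beta by move=> n; rewrite mulrAC; exact: hA.
pose I n := Int a b (fun t => (X \_ `[a, crit c f 1]) t * rho0 t * derive1 (phi \o iter n f) t).
(* The pointwise derivative in [Psi] is replaced by a bounded density. The scalar [k] allows the
   factor [z ^+ n] to be taken out without discussing integrability of [derive1]. *)
have IE n : exists D, [/\ prim a b (phi \o iter n f) D, bmeas a b D &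
    forall k, Int a b (fun t => k * (X \_ `[a, crit c f 1]) t * rho0 t * derive1 (phi \o iter n f) t) =
      k * Int a b (fun t => X0 t * rho0 t * D t)].
  have [D pD bD] := iter_prim ex n pphi bdphi; exists D; split => // k.
  have [M nM hM] := prim_derive ab pD.
  have bX0 : bmeas a b X0 by apply: bmeas_cat => //; [exact: prim_bmeas pX|exact: bmeas_cst].
  rewrite -IntZ; last by apply/bmeas_intg/bmeasM => //; exact: bmeasM.
  pose E := fun t => k * X0 t * rho0 t * derive1 (phi \o iter n f) t.
  rewrite (@Int_oo _ _ _ _ E) => [|t /andP[ta tb]]; last first.
    by rewrite /E patchE mem_setE in_itv /= (ltW ta).
  rewrite (@Int_oo _ _ _ _ (fun t => if (a < t < b) then E t else k * (X0 t * rho0 t * D t))); last first.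
    by move=> t ->.
  apply: (Int_ae nM) => t _ Mt; case: ifP => // tab.
  by rewrite /E hM // -!mulrA.
have PsiE z : Psi a c b f rho0 X phi z = limn (series (fun n => z ^+ n * I n)).
  congr (limn (series _)); apply/funext => n; have [D [_ _ hk]] := IE n.
  rewrite -[LHS]/(Int a b _) hk; congr (_ * _).
  rewrite -[LHS]mul1r -hk; apply: eq_Int => t _; by rewrite mul1r.
have hI n : I n = - conv (tau c f w X kappa) p n - beta n.
  have [D [pD bD hk]] := IE n.
  have -> : I n = Int a b (fun t => X0 t * rho0 t * D t).
    by rewrite -[RHS]mul1r -hk; apply: eq_Int => t _; rewrite mul1r.
  have := boundary_series ex fa fb rho_ctrl hH nN Nsat Norb Ninv hleft hXa pX pdX pD bD.
  rewrite (_ : (fun i => _ * _) = fun i => tau c f w X kappa i * p (n + i)%N); last first.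
    by apply/funext => i; rewrite /p iterD.
  move=> h; have := cvgn_unique h (cvg_conv (n := n) th01 htau pK).
  by rewrite -/(beta n) => <-; rewrite opprB opprK addrAC subrr add0r.
have := abel_limit th01 s01' htau pK hbeta t0 t1 res hI.
rewrite (_ : (fun z => limn _) = Psi a c b f rho0 X phi); last by apply/funext => z; rewrite PsiE.
rewrite (_ : _ - _ = Psi1 a c b f rho0 rho_reg X phi) //.
rewrite /Psi1 -/kappa; congr (- _ - _).
rewrite -tauE -(boundary_sum ex fw X0M pK) ?tauE //.
congr (sum_upto _ _); apply/funext => j; congr (_ * _).
rewrite big_add1 [RHS]big_add1; apply: eq_bigr => i _; congr (_ * _ / _).
by rewrite critS orbE.
Qed.
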